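(* Let $P$ be a linear partial differential operator with constant coefficients on $\mathbb{R}^N$ and let $s>1$. If $P$ is not $\mathfrak{h}(\mathscr{D}', G^s)$, then for every $t>s$ there exist an open set $U\subset\mathbb{R}^N$ and $u\in G^t(U)\setminus G^s(U)$ such that $Pu\in G^s(U)$.
   Context: $P$ is $\mathfrak{h}(\mathscr{D}',G^s)$ if for every open set $U\subset\mathbb{R}^N$, every distribution $u\in\mathscr{D}'(U)$ with $Pu\in G^s(U)$ belongs to $G^s(U)$. For $s>1$, $G^s(U)$ is the space of Gevrey functions of order $s$ (Roumieu type): $f\in\mathcal{C}^\infty(U)$ such that for every compact $K\subset U$ there are $C,h>0$ with $\sup_K|\partial^\alpha f|\le C h^{|\alpha|}|\alpha|!^{s}$ for all multi-indices $\alpha$. *)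

(* Defs.v *)
From HB Require Import structures.
From mathcomp Require Import all_boot all_order all_algebra.
From mathcomp Require Import all_classical all_reals all_analysis.
From mathcomp Require Import complex.
(* The notations of multinomials clash with those of mathcomp-analysis. *)
From mathcomp Require Import -(notations) mpoly.
Set Implicit Arguments.
Unset Strict Implicit.
Unset Printing Implicit Defensive.
Import Order.TTheory GRing.Theory Num.Theory.
Import numFieldNormedType.Exports.
Local Open Scope classical_set_scope.
Local Open Scope complex_scope.
Local Open Scope ring_scope.

Section Defs.
Variables (R : realType) (N : nat).

(* Functions on an open set U of R^N are represented by total functions; every
   predicate below relative to U depends only on their values on U. *)
Local Notation E := ('rV[R]_N).
Local Notation C := (R[i]).
Implicit Types (f g phi psi : E -> C) (U K : set E) (P : mpoly N C).

(* R[i] carries no canonical normed R-module structure, so differentiability,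
   continuity and integrals of complex-valued functions are taken on real and
   imaginary parts. *)
Definition pderiv (j : 'I_N) f : E -> C := fun x =>
  ('D_(delta_mx 0 j) (fun y => complex.Re (f y)) x) +i*
  ('D_(delta_mx 0 j) (fun y => complex.Im (f y)) x).

Definition pderivable (j : 'I_N) f (x : E) : Prop :=
  derivable (fun y => complex.Re (f y)) x (delta_mx 0 j) /\
  derivable (fun y => complex.Im (f y)) x (delta_mx 0 j).

Definition ccontinuous_at f (x : E) : Prop :=
  {for x, continuous (fun y => complex.Re (f y))} /\
  {for x, continuous (fun y => complex.Im (f y))}.

Definition smooth U f : Prop :=
  forall (s : seq 'I_N) (x : E), U x ->
    ccontinuous_at (foldr pderiv f s) x /\
    forall j, pderivable j (foldr pderiv f s) x.

Definition mderiv (a : multinom N) f : E -> C :=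
  foldr (fun j g => iter (a j) (pderiv j) g) f (enum 'I_N).

Definition gevrey (s : R) U f : Prop :=
  smooth U f /\
  forall K, compact K -> K `<=` U ->
    exists A h : R, [/\ 0 < A, 0 < h &
      forall (a : multinom N) (x : E), K x ->
        Normc.normc (mderiv a f x)
          <= A * h ^+ mdeg a * ((mdeg a)`!%:R `^ s)].

(* The operator P(d/dx_1, ..., d/dx_N) of a polynomial P; since the
   coefficients are complex, using d/dx_j or D_j = -i d/dx_j gives the same
   class of operators. *)
Definition diffop P f : E -> C := fun x =>
  \sum_(a <- msupp P) mcoeff a P * mderiv a f x.

Definition test_on K phi : Prop :=
  smooth setT phi /\ forall x, ~ K x -> phi x = 0.

Definition test_function U phi : Prop :=
  exists K, [/\ compact K, K `<=` U & test_on K phi].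

(* A distribution on U is a functional of which only the values on the test
   functions of U are relevant. *)
Definition distribution U (u : (E -> C) -> C) : Prop :=
  (forall (c : C) phi psi, test_function U phi -> test_function U psi ->
     u (fun x => c * phi x + psi x) = c * u phi + u psi) /\
  (forall K, compact K -> K `<=` U ->
     exists (A : R) (k : nat), forall phi, test_on K phi ->
       Normc.normc (u phi) <=
         A * \sum_(a : bmultinom N k.+1)
               sup (range (fun x => Normc.normc (mderiv a phi x)))).

(* <P u, phi> = <u, P(-d/dx) phi> *)
Definition diffop_distr P (u : (E -> C) -> C) : (E -> C) -> C := fun phi =>
  \sum_(a <- msupp P) mcoeff a P * ((-1) ^+ mdeg a * u (mderiv a phi)).

End Defs.

(* The Lebesgue integral over R^n, as an iterated one-dimensional integral; it
   is only applied to continuous functions with compact support. *)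
Fixpoint integral_rV (R : realType) (n : nat) : ('rV[R]_n -> R) -> R :=
  match n with
  | 0%N => fun f => f 0
  | n'.+1 => fun f =>
      \int[@lebesgue_measure R]_t
        integral_rV (fun x : 'rV[R]_n' => f (row_mx (t%:M : 'rV[R]_1) x))
  end.

Definition cintegral_rV (R : realType) (n : nat) (f : 'rV[R]_n -> R[i]) : R[i] :=
  integral_rV (fun x => complex.Re (f x)) +i*
  integral_rV (fun x => complex.Im (f x)).

Definition distr_of_fun (R : realType) (N : nat) (f : 'rV[R]_N -> R[i]) :
    ('rV[R]_N -> R[i]) -> R[i] :=
  fun phi => cintegral_rV (fun x => f x * phi x).

Definition gevrey_distr (R : realType) (N : nat) (s : R) (U : set 'rV[R]_N)
    (u : ('rV[R]_N -> R[i]) -> R[i]) : Prop :=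
  exists f : 'rV[R]_N -> R[i], gevrey s U f /\
    forall phi, test_function U phi -> u phi = distr_of_fun f phi.

(* The property written h(D', G^s). *)
Definition hypoelliptic_distr_gevrey (R : realType) (N : nat)
    (P : mpoly N R[i]) (s : R) : Prop :=
  forall U : set 'rV[R]_N, open U ->
  forall u : ('rV[R]_N -> R[i]) -> R[i], distribution U u ->
    gevrey_distr s U (diffop_distr P u) -> gevrey_distr s U u.

(* Main.v *)
(* Everything depends on the condition (Z): P(z) = 0 implies |z|^(1/s) <= C (1 + |Re z|).

   If (Z) fails, there are zeros z_k with |Re z_k| arbitrarily small compared with
   |z_k|^(1/s).  The series of the solutions exp(-|z_k|^(1/t) - |Re z_k|) exp<x, z_k> of
   P(D)v = 0 is in G^t on the cube |x_j| < 1 for every choice of the z_k.  When they grow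
   fast enough, one derivative of order about |z_k|^(1/s) at 0 is dominated by the k-th term,
   which is too large for G^s.

   If (Z) holds, every distribution u with P(D)u in G^s is in G^t: let chi be a cut-off of
   class G^(t/s) and e the exponential of frequency xi.  The numbers c_b = u((D^b chi) e)
   satisfy sum_b T_b c_b = (P(D)u)(chi e), where T_b are the Taylor coefficients of P at
   -i xi.  By (Z), P has no zero in a polydisc of radius rho ~ |xi|^(1/s) around -i xi, so
   |T_b| <= C0 |P(-i xi)| rho^(-|b|).  Iterating K ~ |xi|^(1/t) times, with
   |D^b chi| <= (H K^(t/s))^|b| << rho^|b|, gives c_0 = O(exp(-c |xi|^(1/t))), and u is
   locally the sum of a Fourier series with such coefficients.

   Hence if no v in G^t \ G^s with P(D)v in G^s existed, (Z) would hold and every u with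
   P(D)u in G^s would be in G^t, hence in G^s, contradicting the hypothesis on P. *)

Require Import Defs.
From mathcomp Require Import all_boot all_order all_algebra.
From mathcomp Require Import all_classical all_reals all_analysis.
From mathcomp Require Import complex.
From mathcomp Require Import -(notations) mpoly.
From mathcomp Require Import ring lra zify.
Set Implicit Arguments.
Unset Strict Implicit.
Unset Printing Implicit Defensive.
Import Order.TTheory GRing.Theory Num.Theory.
Import numFieldNormedType.Exports.
Local Open Scope classical_set_scope.
Local Open Scope complex_scope.
Local Open Scope ring_scope.

(** * Complex-valued functions and their derivatives *)

(** Why t/s: with K of order |xi|^(1/t), a cut-off of class G^(t/s) costs about K^(t/s), which is of
    order |xi|^(1/s), per derivative; this is a small part of the radius rho once K is a small
    multiple of |xi|^(1/t). Compact support requires t/s > 1, and this is where t > s enters. The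
    same inequality makes the derivatives of P(D)u, of size K^s per order, small against |xi|.
    Fourier inversion is replaced by means against the kernel cos^(2M). They are finite sums of
    exponentials with explicit coefficients, they commute with derivatives and converge uniformly.
    Applied to test functions they recover u from the Fourier coefficients of chi u; they also yield
    the du Bois-Reymond lemma and the commutation of partial derivatives, which a definition of
    smoothness by words of derivatives does not contain. For the counterexample, exp(-|z|^(1/t)) is
    split in two halves: one absorbs |z|^n into a G^t bound, the other makes the series summable.
    The factor exp(-|Re z|) compensates the growth of the exponential on the cube. *)

Notation normc := Normc.normc.

Section ComplexModulus.
Variable R : realType.
Implicit Types z w : R[i].

Lemma normc_ge0 z : 0 <= normc z.
Proof. by case: z => a b /=; rewrite sqrtr_ge0. Qed.

Lemma ler_normcD z w : normc (z + w) <= normc z + normc w.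
Proof. exact: le_normcD. Qed.

Lemma normc_opp z : normc (- z) = normc z.
Proof. by case: z => a b /=; rewrite !sqrrN. Qed.

Lemma normc_distC z w : normc (z - w) = normc (w - z).
Proof. by rewrite -normc_opp opprB. Qed.

Lemma ler_normcB z w : normc (z - w) <= normc z + normc w.
Proof. by rewrite -(normc_opp w) ler_normcD. Qed.

Lemma normc_sum (I : Type) (r : seq I) (P : pred I) (F : I -> R[i]) :
  normc (\sum_(i <- r | P i) F i) <= \sum_(i <- r | P i) normc (F i).
Proof.
elim/big_rec2 : _ => [|i x y _ le_yx]; first by rewrite Normc.normc0.
by rewrite (le_trans (ler_normcD _ _))// lerD2l.
Qed.

Lemma normcX z n : normc (z ^+ n) = normc z ^+ n.
Proof.
by elim: n => [|n IHn]; rewrite ?expr0 ?Normc.normc1// !exprS Normc.normcM IHn.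
Qed.

Lemma normc_prod (I : Type) (r : seq I) (P : pred I) (F : I -> R[i]) :
  normc (\prod_(i <- r | P i) F i) = \prod_(i <- r | P i) normc (F i).
Proof.
by elim/big_rec2 : _ => [|i x y _ <-]; rewrite ?Normc.normc1// Normc.normcM.
Qed.

Lemma normc_real (x : R) : normc x%:C = `|x|.
Proof. by rewrite /normc /= expr0n addr0 sqrtr_sqr. Qed.

Lemma normc_nat n : normc (n%:R : R[i]) = n%:R.
Proof. by rewrite -(rmorph_nat (real_complex R)) normc_real normr_nat. Qed.

Lemma ler_Re_normc z : `|complex.Re z| <= normc z.
Proof. by case: z => a b /=; rewrite -sqrtr_sqr ler_wsqrtr// lerDl sqr_ge0. Qed.

Lemma ler_Im_normc z : `|complex.Im z| <= normc z.
Proof. by case: z => a b /=; rewrite -sqrtr_sqr ler_wsqrtr// lerDr sqr_ge0. Qed.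

Lemma ler_normc_ReIm z : normc z <= `|complex.Re z| + `|complex.Im z|.
Proof.
have -> : z = (complex.Re z)%:C + 'i * (complex.Im z)%:C.
  by case: z => a b; apply/eqP; rewrite eq_complex/=; apply/andP; split;
     apply/eqP; rewrite ?mul0r ?mul1r; ring.
apply: le_trans (ler_normcD _ _) _; rewrite Normc.normcM !normc_real/=.
by rewrite expr0n add0r expr1n sqrtr1 mul1r !(mul0r,mul1r,addr0,add0r,subr0,oppr0).
Qed.

Lemma normc_eq0 z : (normc z == 0) = (z == 0).
Proof.
by apply/eqP/eqP => [/Normc.eq0_normc//|->]; rewrite Normc.normc0.
Qed.

Lemma normc_gt0 z : (0 < normc z) = (z != 0).
Proof. by rewrite lt_def normc_eq0 normc_ge0 andbT. Qed.

Lemma ReD z w : complex.Re (z + w) = complex.Re z + complex.Re w.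
Proof. by case: z => ? ?; case: w. Qed.
Lemma ImD z w : complex.Im (z + w) = complex.Im z + complex.Im w.
Proof. by case: z => ? ?; case: w. Qed.
Lemma ReN z : complex.Re (- z) = - complex.Re z.
Proof. by case: z. Qed.
Lemma ImN z : complex.Im (- z) = - complex.Im z.
Proof. by case: z. Qed.
Lemma ReM z w : complex.Re (z * w) =
  complex.Re z * complex.Re w - complex.Im z * complex.Im w.
Proof. by case: z => ? ?; case: w. Qed.
Lemma ImM z w : complex.Im (z * w) =
  complex.Re z * complex.Im w + complex.Im z * complex.Re w.
Proof. by case: z => ? ?; case: w. Qed.
Lemma Re_sum (I : Type) (r : seq I) (P : pred I) (F : I -> R[i]) :
  complex.Re (\sum_(i <- r | P i) F i) = \sum_(i <- r | P i) complex.Re (F i).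
Proof. by elim/big_rec2 : _ => [//|i x y _ <-]; rewrite ReD. Qed.
Lemma Im_sum (I : Type) (r : seq I) (P : pred I) (F : I -> R[i]) :
  complex.Im (\sum_(i <- r | P i) F i) = \sum_(i <- r | P i) complex.Im (F i).
Proof. by elim/big_rec2 : _ => [//|i x y _ <-]; rewrite ImD. Qed.

Lemma complex_eqP z w :
  complex.Re z = complex.Re w -> complex.Im z = complex.Im w -> z = w.
Proof. by case: z => ? ?; case: w => ? ? /= -> ->. Qed.

Definition cexp z : R[i] :=
  (expR (complex.Re z) * cos (complex.Im z)) +i*
  (expR (complex.Re z) * sin (complex.Im z)).

Lemma cexp0 : cexp 0 = 1.
Proof. by rewrite /cexp /= expR0 cos0 sin0 mulr1 mulr0. Qed.

Lemma cexpD z w : cexp (z + w) = cexp z * cexp w.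
Proof.
by rewrite /cexp ReD ImD expRD cosD sinD; apply: complex_eqP;
  rewrite ?ReM ?ImM /=; ring.
Qed.

Lemma normc_cexp z : normc (cexp z) = expR (complex.Re z).
Proof.
by rewrite /cexp /= !exprMn -mulrDr cos2Dsin2 mulr1 sqrtr_sqr ger0_norm// expR_ge0.
Qed.

End ComplexModulus.

(** * Directional derivatives as derivatives along lines *)

Section LineDerivative.
Variable R : realType.

Lemma is_derive_line (V : normedModType R) (f : V -> R) (x v : V) (l : R) :
  is_derive x v f l <-> is_derive (0 : R) 1 (fun h : R => f (h *: v + x)) l.
Proof.
have E : 'D_v f x = 'D_1 (fun h : R => f (h *: v + x)) 0.
  rewrite /derive; set g1 := fun h => h^-1 *: _; set g2 := fun h => h^-1 *: _.
  suff -> : g1 = g2 by [].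
  by rewrite funeqE /g1 /g2 => h /=; rewrite addr0 scale0r add0r [_%:A]mulr1.
split=> -[d e]; rewrite ?E in e.
  exact: DeriveDef ((derivable1P f x v).1 d) e.
by apply: (DeriveDef ((derivable1P f x v).2 d)); rewrite E.
Qed.

Lemma is_derive_comp1 (V : normedModType R) (f : V -> R) (g : R -> R)
    (x v : V) (l m : R) :
  is_derive x v f l -> is_derive (f x) 1 g m ->
  is_derive x v (fun y => g (f y)) (m * l).
Proof.
move=> /is_derive_line df dg; apply/is_derive_line.
by apply: (@is_derive1_comp _ g (fun h => f (h *: v + x)) 0 m l) => //;
  rewrite scale0r add0r.
Qed.

Lemma is_derive_coord (N : nat) (x : 'rV[R]_N) (j k : 'I_N) :
  is_derive x (delta_mx 0 j) (fun y : 'rV[R]_N => y 0 k) (j == k)%:R.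
Proof.
apply/is_derive_line.
have -> : (fun h : R => (h *: delta_mx 0 j + x : 'rV[R]_N) 0 k) =
   (fun h : R => (j == k)%:R * h + x 0 k).
  by apply/funext => h; rewrite !mxE /= eq_sym mulrC.
apply: (is_derive_eq (is_deriveD (is_deriveZ (j == k)%:R (is_derive_id (0 : R) 1))
  (is_derive_cst (x 0 k) (0 : R) 1))).
by rewrite addr0 /GRing.scale/= mulr1.
Qed.

End LineDerivative.

Section PartialDerivatives.
Variables (R : realType) (N : nat).
Local Notation E := 'rV[R]_N.
Local Notation C := (R[i]).
Implicit Types (f g : E -> C) (U K : set E) (x : E) (j : 'I_N).

(** Existence and value in one relation, so that derivatives are computed by composing rules;
    [pderiv] is total and says nothing about existence. *)
Definition is_pd j f x (l : C) : Prop :=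
  is_derive x (delta_mx 0 j) (fun y => complex.Re (f y)) (complex.Re l) /\
  is_derive x (delta_mx 0 j) (fun y => complex.Im (f y)) (complex.Im l).

Lemma is_pd_val j f x l : is_pd j f x l -> pderiv j f x = l.
Proof. by case=> -[_ d1] [_ d2]; apply: complex_eqP; rewrite /= ?d1 ?d2. Qed.

Lemma is_pd_ex j f x l : is_pd j f x l -> pderivable j f x.
Proof. by case=> -[d1 _] [d2 _]. Qed.

Lemma pderivableP j f x : pderivable j f x -> is_pd j f x (pderiv j f x).
Proof. by case=> d1 d2; split; apply/derivableP. Qed.

Lemma is_pd_near j f g x l :
  (\near x, f x = g x) -> is_pd j f x l -> is_pd j g x l.
Proof.
move=> fg [d1 d2]; split; [move: d1|move: d2]; apply: near_eq_is_derive;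
  by apply: filterS fg => y ->.
Qed.

Lemma pderiv_near j f g x : (\near x, f x = g x) -> pderiv j f x = pderiv j g x.
Proof.
by move=> fg; apply: complex_eqP => /=; apply: near_eq_derive;
  apply: filterS fg => y ->.
Qed.

Lemma is_pd_cst j (c : C) x : is_pd j (fun=> c) x 0.
Proof. by split; apply: is_derive_cst. Qed.

Lemma is_pdD j f g x l m : is_pd j f x l -> is_pd j g x m ->
  is_pd j (fun y => f y + g y) x (l + m).
Proof.
move=> [f1 f2] [g1 g2]; split; rewrite ?ReD ?ImD; under eq_fun do rewrite ?ReD ?ImD.
- exact: is_deriveD.
- exact: is_deriveD.
Qed.

Lemma is_pdN j f x l : is_pd j f x l -> is_pd j (fun y => - f y) x (- l).
Proof.
move=> [f1 f2]; split; rewrite ?ReN ?ImN; under eq_fun do rewrite ?ReN ?ImN.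
- exact: is_deriveN.
- exact: is_deriveN.
Qed.

Lemma is_pdB j f g x l m : is_pd j f x l -> is_pd j g x m ->
  is_pd j (fun y => f y - g y) x (l - m).
Proof. by move=> df dg; apply: is_pdD => //; exact: is_pdN. Qed.

Lemma is_pdM j f g x l m : is_pd j f x l -> is_pd j g x m ->
  is_pd j (fun y => f y * g y) x (l * g x + f x * m).
Proof.
move=> [f1 f2] [g1 g2]; split.
- under eq_fun do rewrite ReM.
  apply: (is_derive_eq (is_deriveB (is_deriveM f1 g1) (is_deriveM f2 g2))).
  by rewrite ReD !ReM /GRing.scale/=; ring.
- under eq_fun do rewrite ImM.
  apply: (is_derive_eq (is_deriveD (is_deriveM f1 g2) (is_deriveM f2 g1))).
  by rewrite ImD !ImM /GRing.scale/=; ring.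
Qed.

Lemma is_pd_eq j f x l m : is_pd j f x l -> l = m -> is_pd j f x m.
Proof. by move=> + <-. Qed.

Lemma is_pdZ j f x l (c : C) : is_pd j f x l ->
  is_pd j (fun y => c * f y) x (c * l).
Proof.
move=> df; apply: is_pd_eq (is_pdM (is_pd_cst j c x) df) _.
by rewrite mul0r add0r.
Qed.

Lemma is_pd_sum j (I : Type) (r : seq I) (F : I -> E -> C) (l : I -> C) x :
  (forall i, is_pd j (F i) x (l i)) ->
  is_pd j (fun y => \sum_(i <- r) F i y) x (\sum_(i <- r) l i).
Proof.
move=> dF; elim: r => [|i r IHr].
  by rewrite big_nil; under eq_fun do rewrite big_nil; apply: is_pd_cst.
by rewrite big_cons; under eq_fun do rewrite big_cons; apply: is_pdD.
Qed.

Lemma is_pd_coord j (G : R -> R) (k : 'I_N) x (m : R) :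
  is_derive (x 0 k) 1 G m ->
  is_pd j (fun y => (G (y 0 k))%:C) x ((j == k)%:R * m)%:C.
Proof.
move=> dG; split; last exact: is_derive_cst.
apply: is_derive_eq; first exact: (is_derive_comp1 (is_derive_coord x j k) dG).
by rewrite /= mulrC.
Qed.

Definition cdot (x : E) (z : 'I_N -> C) : C := \sum_k z k * (x 0 k)%:C.

Definition expf (z : 'I_N -> C) : E -> C := fun x => cexp (cdot x z).

Lemma Re_cdot x z : complex.Re (cdot x z) = \sum_k complex.Re (z k) * x 0 k.
Proof. by rewrite Re_sum; apply: eq_bigr => k _; rewrite ReM /= mulr0 subr0. Qed.

Lemma Im_cdot x z : complex.Im (cdot x z) = \sum_k complex.Im (z k) * x 0 k.
Proof. by rewrite Im_sum; apply: eq_bigr => k _; rewrite ImM /= mulr0 add0r. Qed.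

Lemma is_derive_lincomb j (a : 'I_N -> R) x :
  is_derive x (delta_mx 0 j) (fun y : E => \sum_k a k * y 0 k) (a j).
Proof.
have H (r : seq 'I_N) : is_derive x (delta_mx 0 j) (fun y : E => \sum_(k <- r) a k * y 0 k)
    (\sum_(k <- r) a k * (j == k)%:R).
  elim: r => [|k r IHr].
    by rewrite big_nil; under eq_fun do rewrite big_nil; apply: is_derive_cst.
  rewrite big_cons; under eq_fun do rewrite big_cons.
  apply: is_deriveD.
  exact: (is_deriveZ (a k) (is_derive_coord x j k)).
apply: is_derive_eq (H _) _.
rewrite (bigD1 j)//= eqxx mulr1 big1 ?addr0// => k kj.
by rewrite eq_sym (negbTE kj) mulr0.
Qed.

Lemma is_pd_expf j z x : is_pd j (expf z) x (z j * expf z x).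
Proof.
have dR := is_derive_lincomb j (fun k => complex.Re (z k)) x.
have dI := is_derive_lincomb j (fun k => complex.Im (z k)) x.
split.
- under eq_fun do rewrite /expf /cexp /= Re_cdot Im_cdot.
  have e1 := is_derive_comp1 dR (is_derive_expR _).
  have e2 := is_derive_comp1 dI (is_derive_cos _).
  apply: (is_derive_eq (is_deriveM e1 e2)).
  by rewrite ReM /expf /cexp /= Re_cdot Im_cdot /GRing.scale/=; ring.
- under eq_fun do rewrite /expf /cexp /= Re_cdot Im_cdot.
  have e1 := is_derive_comp1 dR (is_derive_expR _).
  have e2 := is_derive_comp1 dI (is_derive_sin _).
  apply: (is_derive_eq (is_deriveM e1 e2)).
  by rewrite ImM /expf /cexp /= Re_cdot Im_cdot /GRing.scale/=; ring.
Qed.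

Lemma continuous_atP (V : normedModType R) (p : V -> R) (x : V) :
  {for x, continuous p} <->
  forall e, 0 < e -> \forall y \near x, `|p x - p y| <= e.
Proof. exact: (@cvgrPdist_le _ _ _ (nbhs x) (nbhs_filter x) p (p x)). Qed.

Lemma continuous_at_ext (V : normedModType R) (p q : V -> R) (x : V) :
  p =1 q -> {for x, continuous p} -> {for x, continuous q}.
Proof. by move=> /funext ->. Qed.

Lemma ccontinuous_near f g x :
  (\near x, f x = g x) -> ccontinuous_at f x -> ccontinuous_at g x.
Proof.
have H (p q : E -> R) : (\near x, p x = q x) ->
    {for x, continuous p} -> {for x, continuous q}.
  move=> pq /continuous_atP cp; apply/continuous_atP => e e0.
  have <- : p x = q x by exact: (@nbhs_singleton _ x _ pq).
  by apply: filterS2 pq (cp e e0) => y <-.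
by move=> fg [c1 c2]; split; [move: c1|move: c2]; apply: H;
  apply: filterS fg => y ->.
Qed.

Lemma ccontinuous_cst (c : C) x : ccontinuous_at (fun=> c) x.
Proof. by split; apply: cst_continuous. Qed.

Lemma ccontinuousD f g x : ccontinuous_at f x -> ccontinuous_at g x ->
  ccontinuous_at (fun y => f y + g y) x.
Proof.
move=> [f1 f2] [g1 g2]; split.
- apply: continuous_at_ext (fun y => esym (ReD (f y) (g y))) _.
  exact: continuousD f1 g1.
- apply: continuous_at_ext (fun y => esym (ImD (f y) (g y))) _.
  exact: continuousD f2 g2.
Qed.

Lemma ccontinuousM f g x : ccontinuous_at f x -> ccontinuous_at g x ->
  ccontinuous_at (fun y => f y * g y) x.
Proof.
move=> [f1 f2] [g1 g2]; split.
- apply: continuous_at_ext (fun y => esym (ReM (f y) (g y))) _.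
  exact: continuousB (continuousM f1 g1) (continuousM f2 g2).
- apply: continuous_at_ext (fun y => esym (ImM (f y) (g y))) _.
  exact: continuousD (continuousM f1 g2) (continuousM f2 g1).
Qed.

Lemma ccontinuousP f x : ccontinuous_at f x <->
  forall e : R, 0 < e -> \forall y \near x, normc (f y - f x) <= e.
Proof.
split=> [[c1 c2] e e0|H].
  have e2 : 0 < e / 2 by rewrite divr_gt0.
  have /continuous_atP/(_ _ e2) h1 := c1; have /continuous_atP/(_ _ e2) h2 := c2.
  apply: filterS2 h1 h2 => y h1 h2.
  rewrite normc_distC (le_trans (ler_normc_ReIm _))// ReD ImD ReN ImN.
  by rewrite [leRHS]splitr lerD.
by split; apply/continuous_atP => e e0; have := H e e0; apply: filterS => y;
  apply: le_trans; rewrite normc_distC; [rewrite -ReN -ReD ler_Re_normc|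
  rewrite -ImN -ImD ler_Im_normc].
Qed.

End PartialDerivatives.

(** * Uniform limits of differentiable functions *)

Section LimitOfDerivatives.
Variable R : realType.

(** The common rate of the limits below: estimates of the form c / (M+1) hold for every M and need
    no threshold index. *)
Definition iS (M : nat) : R := M.+1%:R^-1.

Lemma iS0 : iS 0 = 1. Proof. exact: invr1. Qed.

Lemma iS_ge0 M : 0 <= iS M. Proof. by rewrite invr_ge0. Qed.

Lemma iS_small (c e : R) : 0 < e -> exists M : nat, c * iS M <= e.
Proof.
move=> e0; exists (Num.trunc (`|c| / e)).
rewrite /iS ler_pdivrMr ?ltr0n// mulrC -ler_pdivrMr//.
apply: le_trans (ltW (truncnS_gt _)).
by rewrite ler_pM2r ?invr_gt0// ler_norm.
Qed.

Lemma iS_le (M M' : nat) : (M <= M')%N -> iS M' <= iS M.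
Proof. by move=> MM'; rewrite /iS lef_pV2 ?posrE ?ltr0n// ler_nat. Qed.

(** The limit is the supremum of the lower bounds [u M - c * iS M], each of which lies below every
    [u M' + c * iS M']. *)
Lemma real_cauchy_limit (u : nat -> R) (c : R) :
  (forall M M', (M <= M')%N -> `|u M - u M'| <= c * iS M) ->
  exists l, forall M, `|u M - l| <= c * iS M.
Proof.
move=> hu; have c0 : 0 <= c.
  by have := hu 0%N 0%N (leqnn _); rewrite subrr normr0 iS0 mulr1.
have le_uu M M' : u M - c * iS M <= u M' + c * iS M'.
  have h K : 0 <= c * iS K by rewrite mulr_ge0 ?iS_ge0.
  have [MM'|/ltnW MM'] := leqP M M'; have := hu _ _ MM'; rewrite ler_distl;
    by move: (h M) (h M') => ? ? /andP[? ?]; lra.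
pose A := range (fun M => u M - c * iS M).
have A0 : A !=set0 by exists (u 0%N - c * iS 0), 0%N.
have Aub M : ubound A (u M + c * iS M) by move=> _ [K _ <-].
exists (sup A) => M; rewrite ler_distl; apply/andP; split.
  rewrite lerBlDr; apply: ge_sup => //; exact: Aub.
rewrite -lerBlDr; apply: ub_le_sup; last by exists M.
by exists (u 0%N + c * iS 0); exact: Aub.
Qed.

Lemma complex_cauchy_limit (u : nat -> R[i]) (c : R) :
  (forall M M', (M <= M')%N -> normc (u M - u M') <= c * iS M) ->
  exists l, forall M, normc (u M - l) <= (c + c) * iS M.
Proof.
move=> hu.
have [|a ha] := @real_cauchy_limit (fun M => complex.Re (u M)) c.
  by move=> M M' /hu; apply: le_trans; rewrite -ReN -ReD ler_Re_normc.
have [|b hb] := @real_cauchy_limit (fun M => complex.Im (u M)) c.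
  by move=> M M' /hu; apply: le_trans; rewrite -ImN -ImD ler_Im_normc.
exists (a +i* b) => M; apply: le_trans (ler_normc_ReIm _) _.
by rewrite ReD ImD ReN ImN mulrDl lerD.
Qed.

Lemma mean_value_bound (g dg : R -> R) (h B : R) :
  (forall y : R, `|y| <= `|h| -> is_derive y 1 g (dg y)) ->
  (forall y : R, `|y| <= `|h| -> `|dg y| <= B) ->
  `|g h - g 0| <= B * `|h|.
Proof.
move=> dgP dgB.
have cg a b : -`|h| <= a -> b <= `|h| -> {within `[a, b], continuous g}.
  move=> ha hb; apply: derivable_within_continuous => y.
  rewrite in_itv/= => /andP[ay yb]; apply: (@ex_derive _ _ _ _ _ _ (dg y)).
  by apply: dgP; rewrite ler_norml (le_trans ha ay) (le_trans yb hb).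
have [h0|h0] := leP 0 h.
  have hh : `|h| = h by rewrite ger0_norm.
  have [|||c ch ->] := @MVT_segment _ g dg 0 h => //.
  - move=> y; rewrite in_itv/= => /andP[/ltW y0 /ltW yh].
    by apply: dgP; rewrite ger0_norm ?hh.
  - by apply: cg; rewrite ?hh ?oppr_le0.
  - rewrite subr0 normrM ler_wpM2r// dgB//.
    by move: ch; rewrite in_itv/= => /andP[c0 ch]; rewrite ger0_norm ?hh.
have hh : `|h| = - h by rewrite ltr0_norm.
have [|||c ch e] := @MVT_segment _ g dg h 0; first exact: ltW.
- move=> y; rewrite in_itv/= => /andP[/ltW y0 /ltW yh].
  by apply: dgP; rewrite ler0_norm// hh lerN2.
- by apply: cg; rewrite ?hh ?opprK// oppr_ge0 ltW.
- rewrite distrC e sub0r normrM normrN ler_wpM2r// dgB//.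
  by move: ch; rewrite in_itv/= => /andP[c0 ch]; rewrite ler0_norm// hh lerN2.
Qed.

Variable V : normedModType R.
Implicit Types (f : V -> R) (x v : V).

Lemma is_derive_line_at f x v (h l : R) :
  is_derive (h *: v + x) v f l -> is_derive h 1 (fun t : R => f (t *: v + x)) l.
Proof.
move=> /is_derive_line D; apply/is_derive_line.
suff <- : (fun t : R => f (t *: v + (h *: v + x))) =
          (fun t : R => f ((t *: 1 + h) *: v + x)) by [].
by apply/funext => t; rewrite addrA -scalerDl [_%:A]mulr1.
Qed.

Lemma is_deriveP f x v l : is_derive x v f l <->
  forall e, 0 < e -> \forall h \near 0^', `|l - h^-1 * (f (h *: v + x) - f x)| <= e.
Proof.
have E : (fun h : R => h^-1 *: ((f \o shift x) (h *: v) - f x)) =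
  (fun h : R => h^-1 * (f (h *: v + x) - f x)) by [].
split=> [[d <-] e e0|H].
  move: d; rewrite /derivable /derive E => /cvgrPdist_le; exact.
have c : (fun h : R => h^-1 * (f (h *: v + x) - f x)) @ (0 : R)^' --> l.
  exact/cvgrPdist_le.
apply: DeriveDef; rewrite /derivable /derive E; first by apply/cvg_ex; exists l.
exact/cvg_lim.
Qed.

Lemma near_line (U : set V) x v : open U -> U x ->
  exists2 d : R, 0 < d & forall h : R, `|h| <= d -> U (h *: v + x).
Proof.
move=> oU Ux; have nU : nbhs x U by apply: open_nbhs_nbhs.
have c : {for (0 : R), continuous (fun h : R => h *: v + x)}.
  apply: (@continuousD _ _ _ (fun h : R => h *: v) (fun=> x)).
    exact: scalel_continuous.
  exact: cst_continuous.
have /c/nbhs_ballP[d /= d0 dU] : nbhs ((0 : R) *: v + x) U.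
  by rewrite scale0r add0r.
exists (d / 2) => [|h hd]; first by rewrite divr_gt0.
apply: dU; rewrite /ball /= sub0r normrN (le_lt_trans hd)//.
by rewrite ltr_pdivrMr// ltr_pMr// ltr1n.
Qed.

Lemma is_derive_limit (U : set V) (F dF : nat -> V -> R) f df v x (c c' : R) :
  open U -> U x ->
  (forall M y, U y -> is_derive y v (F M) (dF M y)) ->
  (forall M y, U y -> `|F M y - f y| <= c * iS M) ->
  (forall M y, U y -> `|dF M y - df y| <= c' * iS M) ->
  is_derive x v f (df x).
Proof.
move=> oU Ux dFP Ff dFf; have [d d0 dU] := near_line v oU Ux.
have c'0 : 0 <= c' by have := dFf 0%N x Ux; rewrite iS0 mulr1; apply: le_trans.
(* Differentiability of [f] is the goal, so the mean value theorem is applied to [F M - F K]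
   instead, whose derivative is of size [(c' + c') * iS M]; then [K] goes to infinity, which costs
   the arbitrary [e]. *)
have diff_le M h : `|h| <= d ->
    `|(F M (h *: v + x) - f (h *: v + x)) - (F M x - f x)| <=
    ((c' + c') * iS M) * `|h|.
  move=> hd; apply/ler_addgt0Pr => e e0.
  have [M' hM'] : exists M', (c + c) * iS M' <= e by exact: iS_small.
  pose K := maxn M M'.
  have : `|(F M (h *: v + x) - F K (h *: v + x)) - (F M x - F K x)| <=
      ((c' + c') * iS M) * `|h|.
    have -> : F M x - F K x = F M ((0 : R) *: v + x) - F K ((0 : R) *: v + x).
      by rewrite scale0r add0r.
    apply: (@mean_value_bound (fun t => F M (t *: v + x) - F K (t *: v + x))
      (fun t => dF M (t *: v + x) - dF K (t *: v + x))) => y yh.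
      by apply: is_deriveB; apply: is_derive_line_at; apply/dFP/dU/(le_trans yh).
    have Uy : U (y *: v + x) by apply/dU/(le_trans yh).
    have := dFf M _ Uy; have := dFf K _ Uy; rewrite !ler_distl.
    have h1 : c' * iS K <= c' * iS M.
      by rewrite ler_wpM2l// iS_le// leq_maxl.
    by move=> /andP[? ?] /andP[? ?]; rewrite mulrDl; apply/andP; split; lra.
  have := Ff K _ Ux; have := Ff K _ (dU _ hd).
  have : (c + c) * iS K <= e.
    apply: le_trans hM'; rewrite ler_wpM2l ?iS_le ?leq_maxr//.
    by have := Ff 0%N x Ux; rewrite iS0 mulr1; have := normr_ge0 (F 0%N x - f x); lra.
  rewrite mulrDl !ler_norml => ? /andP[? ?] /andP[? ?] /andP[? ?].
  by apply/andP; split; lra.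
apply/is_deriveP => e e0.
have e3 : 0 < e / 2 by rewrite divr_gt0.
(* Two copies of [c'] pay for the difference quotient of [F M - f], one for [dF M] against [df]. *)
have [M hM] := iS_small (c' + c' + c') e3.
have /is_deriveP/(_ _ e3) H1 := dFP M _ Ux.
have H2 : \forall h \near (0 : R)^', `|h| <= d.
  by apply: cvg_within; apply/nbhs_normP; exists d => //= y /=;
    rewrite sub0r normrN => /ltW.
have H3 : \forall h \near (0 : R)^', h != 0 by exact: nbhs_dnbhs_neq.
apply: filterS3 H2 H3 H1 => h hd h0 H; have h0' : 0 < `|h| by rewrite normr_gt0.
have := diff_le M h hd; have := dFf M x Ux.
set a := F M (h *: v + x) in H *; set b := f (h *: v + x).
move=> H1 H2.
have {}H2 : `|h^-1 * ((a - b) - (F M x - f x))| <= (c' + c') * iS M.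
  by rewrite normrM normfV mulrC ler_pdivrMr.
have -> : df x - h^-1 * (b - f x) = (dF M x - h^-1 * (a - F M x)) +
   h^-1 * ((a - b) - (F M x - f x)) - (dF M x - df x) by field.
move: hM; rewrite !mulrDl.
move: H H1 H2; rewrite !mulrDl !ler_norml.
by move=> /andP[? ?] /andP[? ?] /andP[? ?] ?; apply/andP; split; lra.
Qed.

End LimitOfDerivatives.

Local Notation mderiv := Defs.mderiv.

(** * Calculus of smooth functions *)

Section Smooth.
Variables (R : realType) (N : nat).
Local Notation E := 'rV[R]_N.
Local Notation C := (R[i]).
Implicit Types (f g : E -> C) (U K : set E) (x : E) (j : 'I_N).

Local Notation dw f s := (foldr (@pderiv R N) f s).

(** Smoothness of finite order, peeling the innermost derivative first. Induction on [n] handles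
    products, whose derivative is a sum of products of lower order; the words of [smooth] would
    require a full Leibniz formula. *)
Fixpoint smoothn n U f : Prop :=
  (forall x, U x -> ccontinuous_at f x) /\
  if n is n'.+1 then forall j, (forall x, U x -> pderivable j f x) /\
    smoothn n' U (pderiv j f) else True.

Lemma smooth_pderiv U f j : smooth U f -> smooth U (pderiv j f).
Proof. by move=> sf s x Ux; have := sf (rcons s j) x Ux; rewrite foldr_rcons. Qed.

Lemma smooth_foldr U f s : smooth U f -> smooth U (dw f s).
Proof.
elim: s => [|j s IHs] sf; first exact: sf.
by apply: smooth_pderiv; exact: IHs.
Qed.

Lemma smoothP U f : smooth U f <-> forall n, smoothn n U f.
Proof.
split=> [sf n|sf s].
  elim: n f sf => [|n IHn] f sf /=; split=> //.
  - by move=> x Ux; exact: (sf [::] x Ux).1.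
  - by move=> x Ux; exact: (sf [::] x Ux).1.
  - move=> j; split=> [x Ux|]; first exact: (sf [::] x Ux).2.
    exact/IHn/smooth_pderiv.
elim/last_ind: s f sf => [|s i IHs] f sf x Ux /=.
  split=> [|j]; first exact: (sf 0%N).1.
  exact: ((sf 1%N).2 j).1.
by rewrite foldr_rcons; apply: IHs => // n; exact: ((sf n.+1).2 i).2.
Qed.

Lemma smooth_sub U V f : U `<=` V -> smooth V f -> smooth U f.
Proof. by move=> UV sf s x /UV Vx; exact: sf s x Vx. Qed.

Lemma smooth_local U f :
  (forall x, U x -> exists2 V, V x & smooth V f) -> smooth U f.
Proof. by move=> H s x /H[V Vx sf]; exact: sf s x Vx. Qed.

Lemma near_open U (P : E -> Prop) x : open U -> U x -> (forall y, U y -> P y) ->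
  \forall y \near x, P y.
Proof. by move=> oU Ux UP; apply: filterS (open_nbhs_nbhs (conj oU Ux)). Qed.

Lemma pderiv_open U f g j : open U -> (forall x, U x -> f x = g x) ->
  forall x, U x -> pderiv j f x = pderiv j g x.
Proof. by move=> oU fg x Ux; apply/pderiv_near/(near_open oU Ux). Qed.

Lemma foldr_open U f g s : open U -> (forall x, U x -> f x = g x) ->
  forall x, U x -> dw f s x = dw g s x.
Proof. by move=> oU fg; elim: s => //= j s IHs; exact: pderiv_open. Qed.

Lemma smoothn_open n U f g : open U -> (forall x, U x -> f x = g x) ->
  smoothn n U f -> smoothn n U g.
Proof.
move=> oU; elim: n f g => [|n IHn] f g fg /= [cf df]; split=> //.
- by move=> x Ux; apply: ccontinuous_near (cf x Ux); exact: near_open Ux fg.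
- by move=> x Ux; apply: ccontinuous_near (cf x Ux); exact: near_open Ux fg.
move=> j; split=> [x Ux|].
  apply: is_pd_ex; apply: is_pd_near (pderivableP ((df j).1 x Ux)).
  exact: near_open Ux fg.
by apply: IHn (df j).2; exact: pderiv_open.
Qed.

#[local] Opaque smooth pderiv.

Lemma smooth_open U f g : open U -> (forall x, U x -> f x = g x) ->
  smooth U f -> smooth U g.
Proof.
by move=> oU fg /smoothP sf; apply/smoothP => n; exact: smoothn_open (sf n).
Qed.


Lemma smoothnD n U f g : open U ->
  smoothn n U f -> smoothn n U g -> smoothn n U (fun x => f x + g x).
Proof.
move=> oU; elim: n f g => [|n IHn] f g /= [cf df] [cg dg]; split=> //.
- by move=> x Ux; apply: ccontinuousD; [apply: cf|apply: cg].
- by move=> x Ux; apply: ccontinuousD; [apply: cf|apply: cg].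
move=> j; have D x : U x -> is_pd j (fun x => f x + g x) x (pderiv j f x + pderiv j g x).
  by move=> Ux; apply: is_pdD; apply: pderivableP; [apply: (df j).1|apply: (dg j).1].
split=> [x /D/is_pd_ex//|].
apply: (@smoothn_open n U (fun x => pderiv j f x + pderiv j g x)) => //.
  by move=> x /D/is_pd_val.
by apply: IHn; [apply: (df j).2|apply: (dg j).2].
Qed.

Lemma smoothnS n U f : smoothn n.+1 U f -> smoothn n U f.
Proof.
elim: n f => [|n IHn] f /= [cf df]; split=> // j; split; first exact: (df j).1.
by apply: IHn; exact: (df j).2.
Qed.

Lemma smoothnM n U f g : open U ->
  smoothn n U f -> smoothn n U g -> smoothn n U (fun x => f x * g x).
Proof.
move=> oU; elim: n f g => [|n IHn] f g sf sg; split=> //.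
- by move=> x Ux; apply: ccontinuousM; [apply: sf.1|apply: sg.1].
- by move=> x Ux; apply: ccontinuousM; [apply: sf.1|apply: sg.1].
move=> j; have D x : U x -> is_pd j (fun x => f x * g x) x
    (pderiv j f x * g x + f x * pderiv j g x).
  by move=> Ux; apply: is_pdM; apply: pderivableP; [apply: (sf.2 j).1|apply: (sg.2 j).1].
split=> [x /D/is_pd_ex//|].
apply: (@smoothn_open n U (fun x => pderiv j f x * g x + f x * pderiv j g x)) => //.
  by move=> x /D/is_pd_val.
apply: smoothnD => //; apply: IHn; try exact: smoothnS.
- exact: (sf.2 j).2.
- exact: (sg.2 j).2.
Qed.

Lemma smooth_cst U (c : C) : open U -> smooth U (fun=> c).
Proof.
move=> oU; apply/smoothP => n; elim: n c => [|n IHn] c /=; split=> //;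
  try by move=> x _; exact: ccontinuous_cst.
move=> j; split=> [x _|]; first exact: is_pd_ex (is_pd_cst j c x).
by apply: (@smoothn_open n U (fun=> 0)) (IHn 0) => // x _;
   rewrite (is_pd_val (is_pd_cst j c x)).
Qed.

Lemma smoothD U f g : open U -> smooth U f -> smooth U g ->
  smooth U (fun x => f x + g x).
Proof. by move=> oU /smoothP sf /smoothP sg; apply/smoothP => n; exact: smoothnD. Qed.

Lemma smoothM U f g : open U -> smooth U f -> smooth U g ->
  smooth U (fun x => f x * g x).
Proof. by move=> oU /smoothP sf /smoothP sg; apply/smoothP => n; exact: smoothnM. Qed.

Lemma smoothZ U f (c : C) : open U -> smooth U f -> smooth U (fun x => c * f x).
Proof. by move=> oU sf; refine (smoothM oU (smooth_cst c oU) sf). Qed.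

Lemma smoothB U f g : open U -> smooth U f -> smooth U g ->
  smooth U (fun x => f x - g x).
Proof.
move=> oU sf sg; rewrite (_ : (fun x => _) = (fun x => f x + (-1) * g x)).
  refine (smoothD oU sf (smoothZ (-1) oU sg)).
by apply/funext => x; rewrite mulN1r.
Qed.

Lemma smooth_sum U (I : Type) (r : seq I) (F : I -> E -> C) : open U ->
  (forall i, smooth U (F i)) -> smooth U (fun x => \sum_(i <- r) F i x).
Proof.
move=> oU sF; elim: r => [|i r IHr].
  by under eq_fun do rewrite big_nil; exact: (smooth_cst 0 oU).
under eq_fun do rewrite big_cons; exact: (smoothD oU (sF i) IHr).
Qed.

Section Derivatives.
Variables (U : set E) (oU : open U).

Lemma smooth_is_pd f s j x : smooth U f -> U x ->
  is_pd j (dw f s) x (dw f (j :: s) x).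
Proof. by move=> sf Ux; apply: pderivableP; exact: (sf s x Ux).2. Qed.

Lemma foldrD f g s x : smooth U f -> smooth U g -> U x ->
  dw (fun x => f x + g x) s x = dw f s x + dw g s x.
Proof.
move=> sf sg; elim: s x => [//|j s IHs] x Ux /=.
rewrite (pderiv_open j oU IHs Ux); apply: is_pd_val.
exact: is_pdD (smooth_is_pd s j sf Ux) (smooth_is_pd s j sg Ux).
Qed.

Lemma foldrZ f (c : C) s x : smooth U f -> U x ->
  dw (fun x => c * f x) s x = c * dw f s x.
Proof.
move=> sf; elim: s x => [//|j s IHs] x Ux /=.
rewrite (pderiv_open j oU IHs Ux); apply: is_pd_val.
exact: is_pdZ (smooth_is_pd s j sf Ux).
Qed.

Lemma foldrB f g s x : smooth U f -> smooth U g -> U x ->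
  dw (fun x => f x - g x) s x = dw f s x - dw g s x.
Proof.
move=> sf sg; elim: s x => [//|j s IHs] x Ux /=.
rewrite (pderiv_open j oU IHs Ux); apply: is_pd_val.
exact: is_pdB (smooth_is_pd s j sf Ux) (smooth_is_pd s j sg Ux).
Qed.

Lemma foldr_sum (I : Type) (r : seq I) (F : I -> E -> C) s x :
  (forall i, smooth U (F i)) -> U x ->
  dw (fun x => \sum_(i <- r) F i x) s x = \sum_(i <- r) dw (F i) s x.
Proof.
move=> sF; elim: s x => [//|j s IHs] x Ux /=.
rewrite (pderiv_open j oU IHs Ux); apply: is_pd_val.
by apply: is_pd_sum => i; exact: smooth_is_pd (sF i) Ux.
Qed.

(* The word is read from its end, so that no product of two words appears. *)
Lemma foldrM f g s j x : smooth U f -> smooth U g -> U x ->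
  dw (fun x => f x * g x) (rcons s j) x =
  dw (fun x => pderiv j f x * g x) s x + dw (fun x => f x * pderiv j g x) s x.
Proof.
move=> sf sg Ux; have sf' := smooth_pderiv j sf; have sg' := smooth_pderiv j sg.
rewrite foldr_rcons -(foldrD s (smoothM oU sf' sg) (smoothM oU sf sg') Ux).
apply: (foldr_open s oU _ Ux) => y Uy; apply: is_pd_val.
exact: is_pdM (smooth_is_pd [::] j sf Uy) (smooth_is_pd [::] j sg Uy).
Qed.

(** The tool for proving smoothness and computing all derivatives at once: first derivatives only
    move the index. It is used with scalar factors for exponentials, with words for limits and with
    multi-indices for tensor products. *)
Lemma smooth_family (I : Type) (F : I -> E -> C) (d : 'I_N -> I -> I) :
  (forall i x, U x -> ccontinuous_at (F i) x) ->
  (forall i j x, U x -> is_pd j (F i) x (F (d j i) x)) ->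
  forall i, smooth U (F i) /\
    forall s x, U x -> dw (F i) s x = F (foldr d i s) x.
Proof.
move=> cF dF i.
have D s : forall x, U x -> dw (F i) s x = F (foldr d i s) x.
  elim: s => [//|j s IHs] x Ux /=.
  by rewrite (pderiv_open j oU IHs Ux); apply: is_pd_val; exact: dF.
split=> // s x Ux; split=> [|j].
  apply: ccontinuous_near (cF (foldr d i s) x Ux).
  by apply: near_open Ux _ => // y Uy; rewrite D.
apply: is_pd_ex; apply: is_pd_near (dF (foldr d i s) j x Ux).
by apply: near_open Ux _ => // y Uy; rewrite D.
Qed.

(** The pointwise limits [G (s, _)] of the derivatives along the words [s] form a family in which
    differentiating in the direction [j] replaces [s] by [j :: s], by [is_derive_limit]. *)
Lemma smooth_limit (F : nat -> E -> C) : (forall M, smooth U (F M)) ->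
  (forall s, exists c : R, forall M M' x, (M <= M')%N -> U x ->
     normc (dw (F M) s x - dw (F M') s x) <= c * iS R M) ->
  exists f, smooth U f /\ forall s, exists c : R, forall M x, U x ->
     normc (dw (F M) s x - dw f s x) <= c * iS R M.
Proof.
move=> sF /choice[c hc].
have ex (p : seq 'I_N * E) : exists l, U p.2 -> forall M,
    normc (dw (F M) p.1 p.2 - l) <= (c p.1 + c p.1) * iS R M.
  have [Up|nUp] := pselect (U p.2); last by exists 0.
  have [|l hl] := @complex_cauchy_limit _ (fun M => dw (F M) p.1 p.2) (c p.1).
    by move=> M M' MM'; exact: hc.
  by exists l.
have [G hG] := choice ex.
have cvG s M x : U x -> normc (dw (F M) s x - G (s, x)) <= (c s + c s) * iS R M.
  by move=> Ux; exact: (hG (s, x)).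
have contG s x : U x -> ccontinuous_at (fun y => G (s, y)) x.
  move=> Ux; apply/ccontinuousP => e e0.
  have e2 : 0 < e / 2 by rewrite divr_gt0.
  have [M hM] := iS_small ((c s + c s) + (c s + c s)) e2.
  have /ccontinuousP/(_ _ e2) := (sF M s x Ux).1.
  have : \forall y \near x, U y by apply: near_open Ux _.
  apply: filterS2 => y Uy H.
  have -> : G (s, y) - G (s, x) = (dw (F M) s y - dw (F M) s x) -
     (dw (F M) s y - G (s, y)) + (dw (F M) s x - G (s, x)) by ring.
  have h1 := cvG s M y Uy; have h2 := cvG s M x Ux.
  apply: le_trans (ler_normcD _ _) _.
  apply: le_trans (lerD (ler_normcB _ _) (lexx _)) _.
  by move: hM h1 h2 H; rewrite mulrDl; lra.
have dG s j x : U x -> is_pd j (fun y => G (s, y)) x (G (j :: s, x)).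
  move=> Ux; split.
  - apply: (@is_derive_limit R E U (fun M y => complex.Re (dw (F M) s y))
      (fun M y => complex.Re (dw (F M) (j :: s) y)) (fun y => complex.Re (G (s, y)))
      (fun y => complex.Re (G (j :: s, y))) (delta_mx 0 j) x
      (c s + c s) (c (j :: s) + c (j :: s))) => // M y Uy.
    + exact: (smooth_is_pd s j (sF M) Uy).1.
    + by rewrite -ReN -ReD (le_trans (ler_Re_normc _))// cvG.
    + by rewrite -ReN -ReD (le_trans (ler_Re_normc _))// cvG.
  - apply: (@is_derive_limit R E U (fun M y => complex.Im (dw (F M) s y))
      (fun M y => complex.Im (dw (F M) (j :: s) y)) (fun y => complex.Im (G (s, y)))
      (fun y => complex.Im (G (j :: s, y))) (delta_mx 0 j) x
      (c s + c s) (c (j :: s) + c (j :: s))) => // M y Uy.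
    + exact: (smooth_is_pd s j (sF M) Uy).2.
    + by rewrite -ImN -ImD (le_trans (ler_Im_normc _))// cvG.
    + by rewrite -ImN -ImD (le_trans (ler_Im_normc _))// cvG.
have [sG GE] := @smooth_family _ (fun s y => G (s, y)) (@cons _) contG
  (fun s j x => @dG s j x) [::].
exists (fun y => G ([::], y)); split=> // s; exists (c s + c s) => M x Ux.
rewrite GE// (_ : foldr _ _ s = s); first exact: cvG.
by elim: s {c hc ex hG cvG contG dG sG GE} => //= j s ->.
Qed.

End Derivatives.

(** The word that [mderiv] differentiates along; through it every statement about words applies to
    multi-indices. *)
Definition mword (a : multinom N) : seq 'I_N :=
  flatten [seq nseq (a j) j | j <- enum 'I_N].

Lemma mderivE (a : multinom N) f : mderiv a f = dw f (mword a).
Proof.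
rewrite /mderiv /mword; elim: (enum 'I_N) => [//|j r IHr] /=.
rewrite foldr_cat -IHr; move: (foldr _ f r) => g.
by elim: (a j) => //= n ->.
Qed.

Lemma prod_mword (S : comPzRingType) (a : multinom N) (F : 'I_N -> S) :
  \prod_(j <- mword a) F j = \prod_j F j ^+ a j.
Proof.
rewrite /mword big_flatten big_map big_enum/=; apply: eq_bigr => j _.
by rewrite big_nseq; elim: (a j) => //= n ->; rewrite exprS.
Qed.

Lemma size_mword (a : multinom N) : size (mword a) = mdeg a.
Proof.
rewrite /mword size_flatten /shape -map_comp mdegE sumnE big_map big_enum/=.
by apply: eq_bigr => j _; rewrite size_nseq.
Qed.

Lemma smooth_expf U (z : 'I_N -> C) : open U -> smooth U (expf z) /\
  forall s x, U x -> dw (expf z) s x = (\prod_(j <- s) z j) * expf z x.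
Proof.
move=> oU.
have cE x : ccontinuous_at (expf z) x.
  have cl (a : 'I_N -> R) : {for x, continuous (fun y : E => \sum_k a k * y 0 k)}.
    have H (r : seq 'I_N) : {for x, continuous (fun y : E => \sum_(k <- r) a k * y 0 k)}.
      elim: r => [|k r IHr].
        by apply: continuous_at_ext (fun y => esym (big_nil _ _ _ _)) _; apply: cst_continuous.
      apply: continuous_at_ext (fun y => esym (big_cons _ _ _ _ _ _)) _.
      apply: continuousD IHr; apply: continuousM; first exact: cst_continuous.
      exact: coord_continuous.
    exact: H.
  split.
  - have H (y : E) : expR (\sum_k complex.Re (z k) * y 0 k) *
        cos (\sum_k complex.Im (z k) * y 0 k) = complex.Re (expf z y).
      by rewrite /expf /cexp /= Re_cdot Im_cdot.
    apply: continuous_at_ext H _; apply: continuousM.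
      apply: continuous_comp; [exact: cl|exact: continuous_expR].
    apply: continuous_comp; [exact: cl|exact: continuous_cos].
  - have H (y : E) : expR (\sum_k complex.Re (z k) * y 0 k) *
        sin (\sum_k complex.Im (z k) * y 0 k) = complex.Im (expf z y).
      by rewrite /expf /cexp /= Re_cdot Im_cdot.
    apply: continuous_at_ext H _; apply: continuousM.
      apply: continuous_comp; [exact: cl|exact: continuous_expR].
    apply: continuous_comp; [exact: cl|exact: continuous_sin].
pose F (c : C) (x : E) := c * expf z x.
have [||sF FE] := @smooth_family U oU _ F (fun j c => z j * c) _ _ 1.
- by move=> c x _; apply: ccontinuousM => //; exact: ccontinuous_cst.
- move=> c j x _; apply: is_pd_eq (is_pdZ c (is_pd_expf j z x)) _.
  by rewrite /F; ring.
have F1 : F 1 = expf z by apply/funext => x; rewrite /F mul1r.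
rewrite -F1; split=> // s x Ux; rewrite FE// /F mul1r; congr (_ * _).
by elim: s => [|j s IHs]; rewrite ?big_nil// big_cons /= IHs.
Qed.

End Smooth.

(** * Integrals over boxes *)

Section ContinuousOnRows.
Variable R : realType.

Lemma continuous_rVP (n : nat) (f : 'rV[R]_n -> R) : continuous f <->
  forall (x : 'rV[R]_n) (e : R), 0 < e -> exists2 d : R, 0 < d &
    forall y : 'rV[R]_n, (forall k, `|x 0 k - y 0 k| < d) -> `|f x - f y| <= e.
Proof.
split=> [cf x e e0|H x].
  have /continuous_atP/(_ e e0)/nbhs_ballP[d /= d0 dP] := cf x.
  exists d => // y xy; apply: dP; split=> // i j; rewrite ord1; exact: xy.
apply/continuous_atP => e e0; have [d d0 dP] := H x e e0.
apply/nbhs_ballP; exists d => //= y [_ xy]; apply: dP => k.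
exact: xy.
Qed.

Lemma cont_rVD n (f g : 'rV[R]_n -> R) : continuous f -> continuous g ->
  continuous (fun x => f x + g x).
Proof. by move=> cf cg x; exact: (continuousD (cf x) (cg x)). Qed.

Lemma cont_rVM n (f g : 'rV[R]_n -> R) : continuous f -> continuous g ->
  continuous (fun x => f x * g x).
Proof. by move=> cf cg x; exact: (continuousM (cf x) (cg x)). Qed.

Lemma cont_rVZ n c (f : 'rV[R]_n -> R) : continuous f ->
  continuous (fun x => c * f x).
Proof. by move=> cf; apply: cont_rVM cf => x; exact: cst_continuous. Qed.

(** The shape in which [integral_rV] splits off its outermost variable. *)
Definition rcons0 (n : nat) (t : R) (x : 'rV[R]_n) : 'rV[R]_n.+1 :=
  row_mx (t%:M : 'rV[R]_1) x.

Lemma rcons0_0 n t (x : 'rV[R]_n) : rcons0 t x 0 ord0 = t.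
Proof.
have -> : (ord0 : 'I_n.+1) = @lshift 1 n ord0 by exact: val_inj.
by apply: (etrans (row_mxEl (t%:M : 'rV[R]_1) x 0 ord0)); rewrite mxE eqxx mulr1n.
Qed.

Lemma rcons0_lift n t (x : 'rV[R]_n) k : rcons0 t x 0 (lift ord0 k) = x 0 k.
Proof.
have -> : lift ord0 k = @rshift 1 n k by exact: val_inj.
exact: (row_mxEr (t%:M : 'rV[R]_1) x 0 k).
Qed.

Lemma line_coord n (t : R) (j i : 'I_n) (y : 'rV[R]_n) :
  (t *: delta_mx 0 j + y) 0 i = (i == j)%:R * t + y 0 i.
Proof. by rewrite !mxE /= mulrC. Qed.

Lemma forall_ordS n (P : 'I_n.+1 -> Prop) :
  (forall k, P k) <-> P ord0 /\ forall k, P (lift ord0 k).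
Proof.
split=> [H|[H0 H] k]; first by split.
by case: (unliftP ord0 k) => [j ->|->].
Qed.

Lemma continuous_slice n (f : 'rV[R]_n.+1 -> R) t :
  continuous f -> continuous (fun x => f (rcons0 t x)).
Proof.
move=> /continuous_rVP cf; apply/continuous_rVP => x e e0.
have [d d0 dP] := cf (rcons0 t x) e e0; exists d => // y xy; apply: dP.
apply/forall_ordS; split=> [|k]; first by rewrite !rcons0_0 subrr normr0.
by rewrite !rcons0_lift.
Qed.

Definition box (B : R) n : set 'rV[R]_n := [set x : 'rV[R]_n | forall k, `|x 0 k| <= B].

Lemma compact_box B n : compact (@box B n).
Proof.
have := @rV_compact R n (fun=> `[-B, B]%classic) (fun=> @segment_compact _ _ _).
congr compact; apply/seteqP; split=> x /= H k; have := H k;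
  by rewrite /= in_itv/= ler_norml.
Qed.

Lemma box_rcons0 B n t (x : 'rV[R]_n) :
  `|t| <= B -> box B x -> box B (rcons0 t x).
Proof.
move=> tB xB; apply/forall_ordS; rewrite rcons0_0; split=> // k.
by rewrite rcons0_lift.
Qed.

(** Tube lemma: compactness of the box makes the continuity in the first variable uniform in the
    others. *)
Lemma tube n (f : 'rV[R]_n.+1 -> R) B t0 e : continuous f -> 0 < e ->
  exists2 d : R, 0 < d & forall (t : R) (x : 'rV[R]_n), `|t - t0| < d -> box B x ->
    `|f (rcons0 t x) - f (rcons0 t0 x)| <= e.
Proof.
move=> /continuous_rVP cf e0.
have e2 : 0 < e / 2 by rewrite divr_gt0.
have /compact_near_coveringP H := @compact_box B n.
have /nbhs_ballP[d /= d0 dP] : \forall t \near t0,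
    @box B n `<=` (fun x => `|f (rcons0 t x) - f (rcons0 t0 x)| <= e).
  refine (H R (nbhs t0) (fun t x => `|f (rcons0 t x) - f (rcons0 t0 x)| <= e) _ _).
  move=> x _; have [d d0 dP] := cf (rcons0 t0 x) _ e2.
  exists (ball x d, ball t0 d).
    by split; apply: nbhsx_ballx.
  move=> [y t] /= [[_ xy] tt0].
  have h1 : `|f (rcons0 t0 x) - f (rcons0 t y)| <= e / 2.
    apply: dP; apply/forall_ordS; rewrite !rcons0_0; split=> // k.
    by rewrite !rcons0_lift; exact: xy.
  have h2 : `|f (rcons0 t0 x) - f (rcons0 t0 y)| <= e / 2.
    apply: dP; apply/forall_ordS; rewrite !rcons0_0 subrr normr0; split=> // k.
    by rewrite !rcons0_lift; exact: xy.
  by move: h1 h2; rewrite !ler_norml => /andP[? ?] /andP[? ?]; apply/andP; split; lra.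
exists d => // t x tt0 xB; apply: dP => //=.
by rewrite /ball/= distrC.
Qed.

End ContinuousOnRows.

Section BoxIntegral.
Variable R : realType.
Variable B : R.
Hypothesis B0 : 0 < B.
Notation mu := (@lebesgue_measure R).

Definition sint (g : R -> R) : R := \int[mu]_(t in `[- B, B]) g t.

Lemma sint_integrable (g : R -> R) : continuous g ->
  mu.-integrable `[- B, B] (EFin \o g).
Proof.
move=> cg; apply: continuous_compact_integrable; first exact: segment_compact.
exact: continuous_subspaceT.
Qed.

Lemma sint_cst c : sint (fun=> c) = (2 * B) * c.
Proof.
rewrite /sint Rintegral_cst//= lebesgue_measure_itv/= lte_fin.
have lt : - B < B by move: B0; lra.
rewrite lt.
by rewrite -EFinB /=; ring.
Qed.

Lemma sintD (f g : R -> R) : continuous f -> continuous g ->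
  sint (fun t => f t + g t) = sint f + sint g.
Proof. by move=> cf cg; rewrite /sint RintegralD//; exact: sint_integrable. Qed.

Lemma sintZ c (f : R -> R) : continuous f -> sint (fun t => c * f t) = c * sint f.
Proof. by move=> cf; rewrite /sint RintegralZl//; exact: sint_integrable. Qed.

Lemma eq_sint (f g : R -> R) : (forall t, `|t| <= B -> f t = g t) -> sint f = sint g.
Proof.
move=> fg; apply: eq_Rintegral => t; rewrite inE/= in_itv/= => tB.
by apply: fg; rewrite ler_norml.
Qed.

Lemma sint_le (f g : R -> R) : continuous f -> continuous g ->
  (forall t, `|t| <= B -> f t <= g t) -> sint f <= sint g.
Proof.
move=> cf cg fg; apply: le_Rintegral => //; try exact: sint_integrable.
by move=> t; rewrite /= in_itv/= => tB; apply: fg; rewrite ler_norml.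
Qed.

Lemma sint_FTC (F f : R -> R) : continuous f ->
  (forall t : R, is_derive t 1 F (f t)) -> sint f = F B - F (- B).
Proof.
move=> cf dF; have dF' t : derivable F t 1 by apply: ex_derive.
have cF : continuous F.
  by move=> t; apply/differentiable_continuous/derivable1_diffP.
have lt : - B < B by move: B0; lra.
have h1 : {within `[(- B), B], continuous f} by exact: continuous_subspaceT.
have h2 : derivable_oo_LRcontinuous F (- B) B.
  by split=> [t _|| ]; [exact: dF'|apply: cvg_at_right_filter; exact: cF|
    apply: cvg_at_left_filter; exact: cF].
have h3 : {in `](- B), B[, F^`()%classic =1 f}.
  by move=> t _; rewrite derive1E derive_val.
by rewrite /sint /Rintegral (continuous_FTC2 lt h1 h2 h3).
Qed.

Lemma sint_dist (f g : R -> R) e : continuous f -> continuous g ->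
  (forall t, `|t| <= B -> `|f t - g t| <= e) ->
  `|sint f - sint g| <= (2 * B) * e.
Proof.
move=> cf cg fg; rewrite ler_distl -sint_cst.
have cc : continuous (fun _ : R => e) by move=> ?; exact: cst_continuous.
have -> : sint g - sint (fun=> e) = sint (fun t => g t + (-1) * e).
  by rewrite sintD// ?sint_cst; [ring|move=> ?; exact: cst_continuous].
have -> : sint g + sint (fun=> e) = sint (fun t => g t + e) by rewrite sintD.
have cD c : continuous (fun t => g t + c).
  by move=> t; apply: continuousD; [exact: cg|exact: cst_continuous].
by apply/andP; split; apply: sint_le => // t /fg; rewrite ler_norml => /andP[? ?]; lra.
Qed.

(** The recursion of [integral_rV] over the segment from -B to B, on which every continuous function
    is integrable. *)
Fixpoint bint (n : nat) : ('rV[R]_n -> R) -> R :=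
  match n with
  | 0%N => fun f => f 0
  | n'.+1 => fun f => sint (fun t => @bint n' (fun x => f (rcons0 t x)))
  end.

Lemma box0 n : box B (0 : 'rV[R]_n).
Proof. by move=> k; rewrite mxE normr0 ltW. Qed.

(** The two claims depend on each other: the estimate in dimension n gives the continuity of inner
    integrals over dimension n, and this continuity is what allows the outer integration in
    dimension n+1. *)
Lemma bint_core n : (forall (f g : 'rV[R]_n -> R) e, continuous f -> continuous g ->
    (forall x : 'rV[R]_n, box B x -> `|f x - g x| <= e) ->
    `|bint f - bint g| <= (2 * B) ^+ n * e) /\
  (forall f : 'rV[R]_n.+1 -> R, continuous f ->
    continuous (fun t => bint (fun x => f (rcons0 t x)))).
Proof.
have S (m : nat) : (forall (f g : 'rV[R]_m -> R) e, continuous f -> continuous g ->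
    (forall x : 'rV[R]_m, box B x -> `|f x - g x| <= e) ->
    `|bint f - bint g| <= (2 * B) ^+ m * e) ->
  (forall f : 'rV[R]_m.+1 -> R, continuous f ->
    continuous (fun t => bint (fun x => f (rcons0 t x)))).
  move=> H f cf t0; apply/(@continuous_atP R R^o) => e e0.
  have Bm : 0 < (2 * B) ^+ m by rewrite exprn_gt0// mulr_gt0.
  have [d d0 dP] := tube B t0 cf (divr_gt0 e0 Bm).
  apply/nbhs_ballP; exists d => //= t tt0.
  have -> : e = (2 * B) ^+ m * (e / (2 * B) ^+ m) by rewrite mulrC divfK// gt_eqF.
  apply: H; try exact: continuous_slice.
  by move=> x xB; rewrite distrC; apply: dP => //; rewrite distrC.
suff H : forall (f g : 'rV[R]_n -> R) e, continuous f -> continuous g ->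
    (forall x : 'rV[R]_n, box B x -> `|f x - g x| <= e) ->
    `|bint f - bint g| <= (2 * B) ^+ n * e by split=> //; exact: S.
elim: n => [|n IHn] f g e cf cg fg.
  by rewrite expr0 mul1r /=; apply: fg; exact: box0.
rewrite /= exprS -mulrA; apply: sint_dist; try exact: S.
move=> t tB; apply: IHn; try exact: continuous_slice.
by move=> x xB; apply: fg; exact: box_rcons0.
Qed.

Lemma bint_continuous n (f : 'rV[R]_n.+1 -> R) : continuous f ->
  continuous (fun t => bint (fun x => f (rcons0 t x))).
Proof. exact: (bint_core n).2. Qed.

Lemma bint_dist n (f g : 'rV[R]_n -> R) e : continuous f -> continuous g ->
  (forall x, box B x -> `|f x - g x| <= e) ->
  `|bint f - bint g| <= (2 * B) ^+ n * e.
Proof. exact: (bint_core n).1. Qed.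

Lemma eq_bint n (f g : 'rV[R]_n -> R) : (forall x, box B x -> f x = g x) ->
  bint f = bint g.
Proof.
elim: n f g => [|n IHn] f g fg /=; first by apply: fg; exact: box0.
apply: eq_sint => t tB; apply: IHn => x xB; apply: fg; exact: box_rcons0.
Qed.

Lemma bintD n (f g : 'rV[R]_n -> R) : continuous f -> continuous g ->
  bint (fun x => f x + g x) = bint f + bint g.
Proof.
elim: n f g => [//|n IHn] f g cf cg /=.
rewrite -sintD; try exact: bint_continuous.
by apply: eq_sint => t _; apply: IHn; exact: continuous_slice.
Qed.

Lemma bintZ n c (f : 'rV[R]_n -> R) : continuous f ->
  bint (fun x => c * f x) = c * bint f.
Proof.
elim: n f => [//|n IHn] f cf /=.
rewrite -sintZ; last exact: bint_continuous.
by apply: eq_sint => t _; apply: IHn; exact: continuous_slice.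
Qed.

Lemma bint_le n (f g : 'rV[R]_n -> R) : continuous f -> continuous g ->
  (forall x, box B x -> f x <= g x) -> bint f <= bint g.
Proof.
elim: n f g => [|n IHn] f g cf cg fg /=; first by apply: fg; exact: box0.
apply: sint_le; try exact: bint_continuous.
move=> t tB; apply: IHn; try exact: continuous_slice.
by move=> x xB; apply: fg; exact: box_rcons0.
Qed.

Lemma bint_cst n c : bint (fun _ : 'rV[R]_n => c) = (2 * B) ^+ n * c.
Proof.
elim: n => [|n IHn] /=; first by rewrite expr0 mul1r.
by under eq_fun do rewrite IHn; rewrite sint_cst exprS mulrA.
Qed.

Lemma bint_prod n (g : 'I_n -> R -> R) : (forall k, continuous (g k)) ->
  bint (fun x => \prod_k g k (x 0 k)) = \prod_k sint (g k).
Proof.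
elim: n g => [|n IHn] g cg /=; first by rewrite !big_ord0.
rewrite big_ord_recl -IHn; last by move=> k; exact: cg.
rewrite [RHS]mulrC -sintZ//; apply: eq_sint => t _.
have cP : continuous (fun x : 'rV[R]_n => \prod_k g (lift ord0 k) (x 0 k)).
  have H (r : seq 'I_n) : continuous (fun x : 'rV[R]_n => \prod_(k <- r) g (lift ord0 k) (x 0 k)).
    elim: r => [|k r IHr] y.
      by apply: continuous_at_ext (fun y => esym (big_nil _ _ _ _)) _; apply: cst_continuous.
    apply: continuous_at_ext (fun y => esym (big_cons _ _ _ _ _ _)) _.
    apply: continuousM (IHr y); apply: continuous_comp; [exact: coord_continuous|exact: cg].
  exact: H.
rewrite [RHS]mulrC -bintZ//.
apply: eq_bint => x _; rewrite big_ord_recl rcons0_0; congr (_ * _).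
by apply: eq_bigr => k _; rewrite rcons0_lift.
Qed.

Lemma integral_rV0 n : integral_rV (fun _ : 'rV[R]_n => 0) = 0 :> R.
Proof.
elim: n => [//|n IHn] /=; under eq_Rintegral do rewrite IHn.
by rewrite Rintegral_cst// mul0r.
Qed.

Lemma integral_rV_bint n (f : 'rV[R]_n -> R) :
  (forall x, ~ box B x -> f x = 0) -> integral_rV f = bint f.
Proof.
elim: n f => [//|n IHn] f f0 /=; rewrite /sint Rintegral_mkcond.
apply: eq_Rintegral => t _; rewrite /patch mem_setE in_itv/= -ler_norml.
case: ifPn => tB.
  by apply: IHn => x xB; apply: f0 => H; apply: xB => k;
     rewrite -(rcons0_lift t x); exact: H.
rewrite -[RHS](integral_rV0 n); congr integral_rV; apply/funext => x.
by apply: f0 => /(_ ord0); rewrite [row_mx _ _](_ : _ = rcons0 t x)// rcons0_0 => tB';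
  rewrite tB' in tB.
Qed.

(* Differentiation under the inner integrals reduces every coordinate to the
   outermost one, where it is the fundamental theorem of calculus. *)
Lemma bint_deriv0 n (f df : 'rV[R]_n -> R) (j : 'I_n) :
  continuous f -> continuous df ->
  (forall x : 'rV[R]_n, is_derive x (delta_mx 0 j) f (df x)) ->
  (forall x : 'rV[R]_n, B <= `|x 0 j| -> f x = 0) -> bint df = 0.
Proof.
elim: n f df j => [|n IHn] f df j; first by case: j.
move=> cf cdf dfP f0.
have [k E|E] := unliftP ord0 j => /=; last first.
  have dF (t0 : R) : is_derive t0 1 (fun t => bint (fun x => f (rcons0 t x)))
      (bint (fun x => df (rcons0 t0 x))).
    apply/is_deriveP => e e0.
    have Bm : 0 < (2 * B) ^+ n by rewrite exprn_gt0// mulr_gt0.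
    (* Integrating over the inner box multiplies an error by the volume (2B)^n, hence the
       division. *)
    have [d d0 dP] := tube B t0 cdf (divr_gt0 e0 Bm).
    have H2 : \forall h \near (0 : R)^', `|h| < d.
      by apply: cvg_within; apply/nbhs_normP; exists d => //= y /=;
        rewrite sub0r normrN.
    have H3 : \forall h \near (0 : R)^', h != 0 by exact: nbhs_dnbhs_neq.
    apply: filterS2 H2 H3 => h hd h0.
    have cs t : continuous (fun x : 'rV[R]_n => f (rcons0 t x)) by exact: continuous_slice.
    have ci : continuous (fun x : 'rV[R]_n => f (rcons0 (h *: 1 + t0) x) +
        (-1) * f (rcons0 t0 x)).
      by apply: cont_rVD; [exact: cs|apply: cont_rVZ; exact: cs].
    have cd := @cont_rVZ R n h^-1 _ ci.
    have -> : h^-1 * (bint (fun x => f (rcons0 (h *: 1 + t0) x)) -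
        bint (fun x => f (rcons0 t0 x))) =
      bint (fun x => h^-1 * (f (rcons0 (h *: 1 + t0) x) + (-1) * f (rcons0 t0 x))).
      rewrite bintZ// bintD//; last by apply: cont_rVZ; exact: cs.
      by rewrite bintZ// mulN1r.
    rewrite [leRHS](_ : e = (2 * B) ^+ n * (e / (2 * B) ^+ n)); last first.
      by rewrite mulrC divfK// gt_eqF.
    apply: bint_dist => //; first exact: continuous_slice.
    move=> x xB.
    have line t : rcons0 (t + t0) x = t *: delta_mx 0 ord0 + rcons0 t0 x.
      apply/rowP/forall_ordS; rewrite line_coord !rcons0_0 eqxx mul1r.
      by split=> // k; rewrite line_coord !rcons0_lift mul0r add0r.
    (* Subtracting the linear part [t * df] leaves a function whose derivative is an increment of
       [df], small uniformly in [x] by [tube]. *)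
    have MV := @mean_value_bound R
      (fun t => f (t *: delta_mx 0 ord0 + rcons0 t0 x) - t * df (rcons0 t0 x))
      (fun t => df (t *: delta_mx 0 ord0 + rcons0 t0 x) - df (rcons0 t0 x)) h
      (e / (2 * B) ^+ n).
    have {MV} : `|f (h *: delta_mx 0 ord0 + rcons0 t0 x) - h * df (rcons0 t0 x) -
        f (rcons0 t0 x)| <= e / (2 * B) ^+ n * `|h|.
      have -> : f (rcons0 t0 x) =
        f ((0 : R) *: delta_mx 0 ord0 + rcons0 t0 x) - 0 * df (rcons0 t0 x).
        by rewrite scale0r add0r mul0r subr0.
      apply: MV => t th.
        apply: is_deriveB.
          by apply: is_derive_line_at; rewrite -E; exact: dfP.
        apply: (is_derive_eq (is_deriveM (is_derive_id t (1 : R))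
          (is_derive_cst (df (rcons0 t0 x)) t (1 : R)))).
        by rewrite scaler0 add0r /GRing.scale/= mulr1.
      rewrite -line; apply: dP => //.
      by rewrite addrK (le_lt_trans th).
    rewrite -line [_%:A]mulr1 => H.
    have -> : df (rcons0 t0 x) - h^-1 * (f (rcons0 (h + t0) x) + -1 * f (rcons0 t0 x)) =
      - (h^-1 * (f (rcons0 (h + t0) x) - h * df (rcons0 t0 x) - f (rcons0 t0 x))).
      by field.
    by rewrite normrN normrM normfV mulrC ler_pdivrMr ?normr_gt0.
  rewrite (sint_FTC (bint_continuous cdf) dF).
  have z t : `|t| = B -> bint (fun x => f (rcons0 t x)) = 0.
    move=> tB; rewrite (@eq_bint _ _ (fun=> 0)) ?bint_cst ?mulr0// => x _.
    by apply: f0; rewrite E rcons0_0 tB.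
  by rewrite !z ?subrr ?normrN// ger0_norm// ltW.
rewrite {}E in dfP f0.
rewrite (@eq_sint _ (fun=> 0)) ?sint_cst ?mulr0// => t _.
apply: (IHn (fun x => f (rcons0 t x)) _ k); try exact: continuous_slice.
  move=> x; apply/is_derive_line.
  have /is_derive_line := dfP (rcons0 t x).
  congr is_derive; apply/funext => h; congr f.
  apply/rowP/forall_ordS; rewrite line_coord !rcons0_0 mul0r add0r.
  split=> // i; rewrite line_coord !rcons0_lift line_coord.
  by rewrite (inj_eq (@lift_inj _ _)).
by move=> x xB; apply: f0; rewrite rcons0_lift.
Qed.

End BoxIntegral.

Section ComplexBoxIntegral.
Variables (R : realType) (N : nat) (B : R).
Hypothesis B0 : 0 < B.
Local Notation E := 'rV[R]_N.
Local Notation C := (R[i]).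
Implicit Types (f g phi psi : E -> C) (K : set E).
Local Notation dw f s := (foldr (@pderiv R N) f s).

Definition ccont f := forall x, ccontinuous_at f x.

Lemma ccont_Re f : ccont f -> continuous (fun x => complex.Re (f x)).
Proof. by move=> cf x; exact: (cf x).1. Qed.

Lemma ccont_Im f : ccont f -> continuous (fun x => complex.Im (f x)).
Proof. by move=> cf x; exact: (cf x).2. Qed.

Lemma ccontD f g : ccont f -> ccont g -> ccont (fun x => f x + g x).
Proof. by move=> cf cg x; exact: ccontinuousD (cf x) (cg x). Qed.

Lemma ccontM f g : ccont f -> ccont g -> ccont (fun x => f x * g x).
Proof. by move=> cf cg x; exact: ccontinuousM (cf x) (cg x). Qed.

Lemma ccont_cst (c : C) : ccont (fun=> c).
Proof. by move=> x; exact: ccontinuous_cst. Qed.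

Lemma ccontZ (c : C) f : ccont f -> ccont (fun x => c * f x).
Proof. by move=> cf; apply: ccontM => //; exact: ccont_cst. Qed.

Lemma ccont_sum (I : Type) (r : seq I) (F : I -> E -> C) :
  (forall i, ccont (F i)) -> ccont (fun x => \sum_(i <- r) F i x).
Proof.
move=> cF; elim: r => [|i r IHr].
  by under eq_fun do rewrite big_nil; exact: ccont_cst.
by under eq_fun do rewrite big_cons; exact: ccontD (cF i) IHr.
Qed.

Lemma smooth_ccont f : smooth setT f -> ccont f.
Proof. by move=> sf x; exact: (sf [::] x I).1. Qed.

Lemma ccont_expf z : ccont (@expf R N z).
Proof. by apply: smooth_ccont; exact: (smooth_expf z openT).1. Qed.

Definition cbint f : C :=
  bint B (fun x => complex.Re (f x)) +i* bint B (fun x => complex.Im (f x)).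

Lemma eq_cbint f g : (forall x, box B x -> f x = g x) -> cbint f = cbint g.
Proof.
by move=> fg; congr (_ +i* _); apply: (eq_bint B0) => x xB; rewrite fg.
Qed.

Lemma cbintD f g : ccont f -> ccont g ->
  cbint (fun x => f x + g x) = cbint f + cbint g.
Proof.
move=> cf cg; rewrite /cbint; under eq_fun do rewrite ReD.
under [X in _ +i* bint B X]eq_fun do rewrite ImD.
by rewrite !(bintD B0)//; [exact: ccont_Im|exact: ccont_Im|exact: ccont_Re|exact: ccont_Re].
Qed.

Lemma cbintZ (c : C) f : ccont f -> cbint (fun x => c * f x) = c * cbint f.
Proof.
move=> cf; have c1 := ccont_Re cf; have c2 := ccont_Im cf.
have Z1 (a : R) := @cont_rVZ R N a _ c1; have Z2 (a : R) := @cont_rVZ R N a _ c2.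
apply: complex_eqP; rewrite ?ReM ?ImM /=.
- under eq_fun do rewrite ReM -mulNr.
  by rewrite (bintD B0 (Z1 _) (Z2 _)) !(bintZ B0)// mulNr.
- under eq_fun do rewrite ImM.
  by rewrite (bintD B0 (Z2 _) (Z1 _)) !(bintZ B0).
Qed.

Lemma cbint0 : cbint (fun=> 0) = 0.
Proof. by rewrite /cbint /= bint_cst// mulr0. Qed.

Lemma cbint_sum (I : Type) (r : seq I) (F : I -> E -> C) :
  (forall i, ccont (F i)) ->
  cbint (fun x => \sum_(i <- r) F i x) = \sum_(i <- r) cbint (F i).
Proof.
move=> cF; elim: r => [|i r IHr].
  by rewrite big_nil; under eq_fun do rewrite big_nil; exact: cbint0.
rewrite big_cons -IHr; under eq_fun do rewrite big_cons.
by rewrite cbintD//; exact: ccont_sum.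
Qed.

Lemma cbint_dist f g e : ccont f -> ccont g ->
  (forall x, box B x -> normc (f x - g x) <= e) ->
  normc (cbint f - cbint g) <= 2 * ((2 * B) ^+ N * e).
Proof.
move=> cf cg fg; apply: le_trans (ler_normc_ReIm _) _.
rewrite ReD ImD ReN ImN mulr2n mulrDl !mul1r; apply: lerD.
- apply: (bint_dist B0); try exact: ccont_Re.
  by move=> x /fg; apply: le_trans; rewrite -ReN -ReD ler_Re_normc.
- apply: (bint_dist B0); try exact: ccont_Im.
  by move=> x /fg; apply: le_trans; rewrite -ImN -ImD ler_Im_normc.
Qed.

Lemma cbint_le f e : ccont f -> (forall x, box B x -> normc (f x) <= e) ->
  normc (cbint f) <= 2 * ((2 * B) ^+ N * e).
Proof.
move=> cf fe; rewrite -[cbint f]subr0 -cbint0.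
by apply: cbint_dist => //; [exact: ccont_cst|move=> x xB; rewrite subr0 fe].
Qed.

Lemma cintegral_rV_cbint f : (forall x, ~ box B x -> f x = 0) ->
  cintegral_rV f = cbint f.
Proof.
by move=> f0; congr (_ +i* _); apply: integral_rV_bint => x xB; rewrite f0.
Qed.

Lemma test_on_pderiv K phi j : closed K -> test_on K phi -> test_on K (pderiv j phi).
Proof.
move=> cK [sphi phi0]; split; first exact: smooth_pderiv.
move=> x Kx; rewrite -(@is_pd_val R N j (fun=> 0) x 0); last exact: is_pd_cst.
by apply: (@pderiv_open R N (~` K)) => //; exact: closed_openC.
Qed.

Lemma test_on_foldr K phi s : closed K -> test_on K phi -> test_on K (dw phi s).
Proof.
by move=> cK tphi; elim: s => [//|j s IHs]; exact: test_on_pderiv cK IHs.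
Qed.

Lemma closed_box b : closed (@box R b N).
Proof. by apply: compact_closed; [exact: norm_hausdorff|exact: compact_box]. Qed.

Lemma cbint_pderiv0 b phi j : b < B -> test_on (@box R b N) phi -> cbint (pderiv j phi) = 0.
Proof.
move=> bB [sphi phi0].
have cd : ccont (pderiv j phi) by apply: smooth_ccont; exact: smooth_pderiv.
have cp := smooth_ccont sphi.
have D x := @smooth_is_pd R N setT phi [::] j x sphi I.
have nb (x : E) : B <= `|x 0 j| -> ~ box b x.
  by move=> h /(_ j); rewrite leNgt (lt_le_trans bB h).
apply: complex_eqP => /=.
- apply: (bint_deriv0 B0 (ccont_Re cp) (ccont_Re cd) (fun x => (D x).1)) => x /nb h.
  by rewrite phi0.
- apply: (bint_deriv0 B0 (ccont_Im cp) (ccont_Im cd) (fun x => (D x).2)) => x /nb h.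
  by rewrite phi0.
Qed.

Lemma test_onM K phi f : test_on K phi -> smooth setT f ->
  test_on K (fun x => phi x * f x).
Proof.
move=> [sphi phi0] sf; split; first exact: (smoothM openT sphi sf).
by move=> x /phi0 ->; rewrite mul0r.
Qed.

Lemma fourier_parts b phi z j : b < B -> test_on (@box R b N) phi ->
  cbint (fun x => pderiv j phi x * expf z x) =
  - z j * cbint (fun x => phi x * expf z x).
Proof.
move=> bB tphi; have [se De] := @smooth_expf R N setT z openT.
have := cbint_pderiv0 j bB (test_onM tphi se).
have sphi := tphi.1; have sphi' := smooth_pderiv j sphi.
rewrite (_ : pderiv j _ = fun x => pderiv j phi x * expf z x +
   z j * (phi x * expf z x)); last first.
  apply/funext => x; apply: is_pd_val.
  apply: is_pd_eq (is_pdM (@smooth_is_pd R N setT phi [::] j x sphi I) (is_pd_expf j z x)) _.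
  by rewrite /=; ring.
rewrite cbintD ?cbintZ; last first.
- by apply: ccontZ; exact: smooth_ccont (test_onM tphi se).1.
- exact: smooth_ccont (smoothM openT sphi' se).
- exact: smooth_ccont (test_onM tphi se).1.
by move=> /eqP; rewrite addr_eq0 => /eqP ->; rewrite mulNr.
Qed.

Lemma fourier_parts_word b phi z s : b < B -> test_on (@box R b N) phi ->
  cbint (fun x => dw phi s x * expf z x) =
  \prod_(j <- s) (- z j) * cbint (fun x => phi x * expf z x).
Proof.
move=> bB tphi; elim: s => [|j s IHs]; first by rewrite big_nil mul1r.
rewrite big_cons -mulrA -IHs; apply: fourier_parts bB _.
by apply: test_on_foldr => //; exact: closed_box.
Qed.

End ComplexBoxIntegral.

(** * Trigonometric approximation *)

Section CosineKernel.
Variables (R : realType) (B : R).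
Hypothesis B0 : 0 < B.

(** Half of the fundamental frequency of the period 2B: [cos (l * t)] changes sign over a period, so
    its even powers are periodic. *)
Definition halffreq : R := pi / (2 * B).
Notation l := halffreq.

Lemma halffreq_gt0 : 0 < l.
Proof. by rewrite /halffreq divr_gt0 ?pi_gt0// mulr_gt0. Qed.

Lemma halffreqE : 2 * B * l = pi.
Proof. by rewrite /halffreq mulrC divfK// gt_eqF// mulr_gt0. Qed.

Lemma is_derive_angle (x y : R) :
  is_derive y 1 (fun t : R => l * (x - t)) (- l).
Proof.
apply: (is_derive_eq (is_deriveZ l (is_deriveB (is_derive_cst x y (1 : R))
  (is_derive_id y (1 : R))))).
by rewrite sub0r /GRing.scale/= mulrN1.
Qed.

Lemma is_derive_expn (x : R) n :
  is_derive x 1 (fun t : R => t ^+ n) (n%:R * x ^+ n.-1).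
Proof.
apply: DeriveDef; first exact: exprn_derivable.
by rewrite exp_derive /GRing.scale/= mulr1.
Qed.

Lemma is_derive_comp_expn (f : R -> R) (x df : R) n : is_derive x 1 f df ->
  is_derive x 1 (fun t => f t ^+ n) (n%:R * f x ^+ n.-1 * df).
Proof. by move=> dfx; exact: (is_derive1_comp (is_derive_expn (f x) n) dfx). Qed.

Lemma continuous_cosX (x : R) n : continuous (fun y : R => cos (l * (x - y)) ^+ n).
Proof.
move=> y; apply: differentiable_continuous; apply/derivable1_diffP.
exact: (ex_derive (is_derive := is_derive_comp_expn n
  (is_derive1_comp (is_derive_cos _) (is_derive_angle x y)))).
Qed.

Lemma continuous_sinX (x : R) n : continuous (fun y : R => sin (l * (x - y)) ^+ n).
Proof.
move=> y; apply: differentiable_continuous; apply/derivable1_diffP.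
exact: (ex_derive (is_derive := is_derive_comp_expn n
  (is_derive1_comp (is_derive_sin _) (is_derive_angle x y)))).
Qed.

Lemma contRM (f g : R -> R) : continuous f -> continuous g ->
  continuous (fun x => f x * g x).
Proof. by move=> cf cg x; exact: (continuousM (cf x) (cg x)). Qed.

Lemma contRD (f g : R -> R) : continuous f -> continuous g ->
  continuous (fun x => f x + g x).
Proof. by move=> cf cg x; exact: (continuousD (cf x) (cg x)). Qed.

Lemma contRZ c (f : R -> R) : continuous f -> continuous (fun x => c * f x).
Proof. by move=> cf; apply: contRM cf => x; exact: cst_continuous. Qed.

(* Wallis' recursion: integrate the derivative of [sin cos^(2M+1)] over a period. *)
Lemma sint_cos_rec M (x : R) :
  (2 * M + 2)%:R * sint B (fun y => cos (l * (x - y)) ^+ (2 * M + 2)) =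
  (2 * M + 1)%:R * sint B (fun y => cos (l * (x - y)) ^+ (2 * M)).
Proof.
pose th y := l * (x - y).
pose F (y : R) := sin (th y) * cos (th y) ^+ (2 * M).+1.
pose f (y : R) := (- l * (2 * M + 2)%:R) * cos (th y) ^+ (2 * M + 2) +
  (l * (2 * M + 1)%:R) * cos (th y) ^+ (2 * M).
have cX n := @continuous_cosX x n.
have cf : continuous f.
  by apply: contRD; apply: contRZ; exact: cX.
have dF (y : R) : is_derive y 1 F (f y).
  have ds := is_derive1_comp (is_derive_sin (th y)) (is_derive_angle x y).
  have dc := is_derive1_comp (is_derive_cos (th y)) (is_derive_angle x y).
  apply: (is_derive_eq (is_deriveM ds (is_derive_comp_expn (2 * M).+1 dc))).
  have ss := sin2cos2 (th y).
  rewrite /f /GRing.scale /=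
     addn2 addn1 !exprS -!natr1.
  move: (cos (th y)) (sin (th y)) ss => c s; rewrite !expr2 => ss.
  apply/eqP; rewrite -subr_eq0; apply/eqP.
  (* A multiple of 1 - cos^2 - sin^2 = 0 is added so that [ring] can conclude. *)
  have -> : forall X Y : R, X - Y = X - Y +
      l * ((2 * M)%:R + 1) * c ^+ (2 * M) * (1 - c * c - s * s).
    by move=> X Y; rewrite ss subrr mulr0 addr0.
  by move: (c ^+ (2 * M)) => P; ring.
(* The angle differs by pi between the two ends; [sin] and the odd power of [cos] both change sign,
   so the boundary terms cancel. *)
have E : F B = F (- B).
  have thE : th (- B) = th B + pi.
    by rewrite /th -halffreqE; ring.
  rewrite /F thE sinDpi cosDpi exprNn -signr_odd /= oddM /= expr1; ring.
have := sint_FTC B0 cf dF; rewrite E subrr /f.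
have i1 := @contRZ (- l * (2 * M + 2)%:R) _ (cX (2 * M + 2)%N).
have i2 := @contRZ (l * (2 * M + 1)%:R) _ (cX (2 * M)%N).
rewrite (sintD B i1 i2) !sintZ// => H.
have l0 := lt0r_neq0 halffreq_gt0.
apply: (mulfI l0); apply/eqP; rewrite -subr_eq0 -oppr_eq0; apply/eqP.
by rewrite -[RHS]H; ring.
Qed.

(** The inverse of binomial(2M, M) / 4^M, the mean of cos^(2M). *)
Definition kweight M : R := 4 ^+ M * (M`!%:R) ^+ 2 / ((2 * M)`!)%:R.

Lemma kweightS M : kweight M.+1 * (2 * M + 1)%:R = kweight M * (2 * M + 2)%:R.
Proof.
rewrite /kweight (_ : 2 * M.+1 = (2 * M).+2)%N; last lia.
rewrite !factS !natrM exprS addn2 addn1.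
have h1 : ((2 * M)`!)%:R != 0 :> R by rewrite pnatr_eq0 -lt0n fact_gt0.
have h2 : (2 * M).+1%:R != 0 :> R by rewrite pnatr_eq0.
have h3 : (2 * M).+2%:R != 0 :> R by rewrite pnatr_eq0.
have -> : (2 * M).+2%:R = 2 * M.+1%:R :> R.
  by rewrite -natrM; congr _%:R; lia.
field.
by rewrite h1 -natrM !nat1r !pnatr_eq0.
Qed.

Lemma kweight_gt0 M : 0 < kweight M.
Proof.
by rewrite /kweight divr_gt0 ?mulr_gt0 ?exprn_gt0 ?ltr0n ?fact_gt0.
Qed.

(** The kernel of de la Vallee-Poussin: nonnegative, of mean 1, and a trigonometric polynomial of
    period 2B. *)
Definition kern M (x y : R) : R := kweight M * cos (l * (x - y)) ^+ (2 * M).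

Lemma kern_ge0 M x y : 0 <= kern M x y.
Proof. by rewrite mulr_ge0 ?(ltW (kweight_gt0 M))// mul2n -muln2 exprM sqr_ge0. Qed.

Lemma continuous_kern M x : continuous (kern M x).
Proof. by apply: contRZ; exact: continuous_cosX. Qed.

Lemma sint_kern M x : sint B (kern M x) = 2 * B.
Proof.
rewrite sintZ; last exact: continuous_cosX.
elim: M => [|M IHM].
  rewrite /kweight muln0 expr0 fact0 expr1n mul1r divr1 mul1r.
  by rewrite (@eq_sint _ _ _ (fun=> 1)) ?(sint_cst B0) ?mulr1// => t _; rewrite expr0.
have h : (2 * M + 1)%:R != 0 :> R by rewrite pnatr_eq0 addn1.
apply: (mulIf h); rewrite mulrAC kweightS -IHM (_ : 2 * M.+1 = 2 * M + 2)%N; last lia.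
by rewrite -mulrA sint_cos_rec; ring.
Qed.

(** Since [kern M] times cos^2 is (2M+1)/(2M+2) times [kern M.+1], this second moment is explicit;
    its decay in M is what concentrates the kernel on the diagonal. *)
Lemma sint_kern_sin M x :
  sint B (fun y => kern M x y * sin (l * (x - y)) ^+ 2) = 2 * B / (2 * M + 2)%:R.
Proof.
have h1 : (2 * M + 1)%:R != 0 :> R by rewrite pnatr_eq0 addn1.
have h2 : (2 * M + 2)%:R != 0 :> R by rewrite pnatr_eq0 addn2.
have w0 := lt0r_neq0 (kweight_gt0 M.+1).
have -> : sint B (fun y => kern M x y * sin (l * (x - y)) ^+ 2) =
   sint B (fun y => kern M x y + (- (2 * M + 1)%:R / (2 * M + 2)%:R) * kern M.+1 x y).
  apply: eq_sint => t _; rewrite sin2cos2 /kern.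
  rewrite (_ : 2 * M.+1 = 2 * M + 2)%N; last lia.
  rewrite exprD; have := kweightS M.
  move: (cos _ ^+ (2 * M)) (cos _ ^+ 2) => P c H.
  have -> : kweight M = kweight M.+1 * (2 * M + 1)%:R / (2 * M + 2)%:R.
    by rewrite H mulfK.
  by field.
have i1 := @continuous_kern M x; have i2 := @continuous_kern M.+1 x.
rewrite (sintD B i1 (@contRZ _ _ i2)) (sintZ B _ i2) !sint_kern.
have e : (2 * M + 2)%:R = (2 * M + 1)%:R + 1 :> R by rewrite natr1; congr _%:R; lia.
by move: h2; rewrite e; move: (_%:R) => m h2; field.
Qed.

(** The limit 3 pi / 4 is reached for |x| <= B/2 and |y| <= B, where the angle is at most l (3B/2).
    It stays below pi, so the sine vanishes only at 0. *)
Lemma sin_lower (a : R) : 0 < a -> exists2 eta : R, 0 < eta &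
  forall t, a <= `|t| -> `|t| <= 3 / 4 * pi -> eta <= sin t ^+ 2.
Proof.
move=> a0; have [ab|ab] := leP a (3 / 4 * pi); last first.
  by exists 1 => // t h1 h2; move: (lt_le_trans ab h1); rewrite ltNge h2.
have cs : {within `[a, 3 / 4 * pi], continuous (@sin R)}.
  by apply: continuous_subspaceT => x; exact: continuous_sin.
have [c cab hc] := EVT_min ab cs.
have sc : 0 < sin c.
  apply: sin_gt0_pi; move: cab; rewrite in_itv/= => /andP[h1 h2].
  rewrite (lt_le_trans a0 h1)/= (le_lt_trans h2)//.
  by have := pi_gt0 R; lra.
exists (sin c ^+ 2) => [|t h1 h2]; first by rewrite exprn_gt0.
have -> : sin t ^+ 2 = sin `|t| ^+ 2.
  by have [_|_] := ger0P t; rewrite ?sinN ?sqrrN.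
have h3 : sin c <= sin `|t| by apply: hc; rewrite in_itv/= h1.
by rewrite lerXn2r ?nnegrE ?(ltW sc) ?(le_trans (ltW sc) h3).
Qed.

End CosineKernel.

(** * Uniform convergence of the kernel means *)

Section Korovkin.
Variables (R : realType) (N : nat) (B : R).
Hypothesis B0 : 0 < B.
Local Notation E := 'rV[R]_N.
Local Notation l := (halffreq B).
Local Notation kern := (kern B).

Definition kernN M (x y : E) : R := \prod_j kern M (x 0 j) (y 0 j).

Lemma kernN_ge0 M x y : 0 <= kernN M x y.
Proof. by apply: prodr_ge0 => j _; exact: kern_ge0. Qed.

Lemma cont_prod_coord (I : Type) (r : seq I) (k : I -> 'I_N) (g : I -> R -> R) :
  (forall i, continuous (g i)) ->
  continuous (fun y : E => \prod_(i <- r) g i (y 0 (k i))).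
Proof.
move=> cg; elim: r => [|i r IHr] y.
  by apply: continuous_at_ext (fun y => esym (big_nil _ _ _ _)) _; apply: cst_continuous.
apply: continuous_at_ext (fun y => esym (big_cons _ _ _ _ _ _)) _.
apply: continuousM (IHr y); apply: continuous_comp; [exact: coord_continuous|exact: cg].
Qed.

Lemma cont_sum_rV (I : Type) (r : seq I) (g : I -> E -> R) :
  (forall i, continuous (g i)) -> continuous (fun y : E => \sum_(i <- r) g i y).
Proof.
move=> cg; elim: r => [|i r IHr] y.
  by apply: continuous_at_ext (fun y => esym (big_nil _ _ _ _)) _; apply: cst_continuous.
apply: continuous_at_ext (fun y => esym (big_cons _ _ _ _ _ _)) _.
exact: (continuousD (cg i y) (IHr y)).
Qed.

Lemma continuous_kernN M (x : E) : continuous (kernN M x).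
Proof.
by apply: (@cont_prod_coord _ _ id (fun j => kern M (x 0 j))) => j; exact: continuous_kern.
Qed.

Lemma bint_kernN M (x : E) : bint B (kernN M x) = (2 * B) ^+ N.
Proof.
rewrite /kernN (bint_prod B0 (g := fun j => kern M (x 0 j))); last first.
  by move=> j; exact: continuous_kern.
by under eq_bigr do rewrite (sint_kern B0); rewrite prodr_const card_ord.
Qed.

Definition sin2 (k : 'I_N) (x y : E) : R := sin (l * (x 0 k - y 0 k)) ^+ 2.

Lemma continuous_sin2 k (x : E) : continuous (sin2 k x).
Proof.
move=> y; rewrite /sin2.
apply: (@continuous_comp _ _ _ (fun y : E => y 0 k) (fun t => sin (l * (x 0 k - t)) ^+ 2)).
  exact: coord_continuous.
exact: continuous_sinX.
Qed.

Lemma bint_kernN_sin2 M (x : E) k :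
  bint B (fun y => kernN M x y * sin2 k x y) = (2 * B) ^+ N / (2 * M + 2)%:R.
Proof.
pose g (j : 'I_N) (t : R) := if j == k then kern M (x 0 j) t * sin (l * (x 0 j - t)) ^+ 2
  else kern M (x 0 j) t.
have cg j : continuous (g j).
  rewrite /g; case: eqP => _; last exact: continuous_kern.
  apply: contRM; first exact: continuous_kern.
  exact: continuous_sinX.
have -> : (fun y => kernN M x y * sin2 k x y) = (fun y => \prod_j g j (y 0 j)).
  apply/funext => y; rewrite /kernN /sin2 (bigD1 k)//= [RHS](bigD1 k)//= /g eqxx.
  rewrite mulrAC; congr (_ * _); apply: eq_bigr => j /negbTE ->//.
rewrite (bint_prod B0 cg) (bigD1 k)//= {1}/g eqxx (sint_kern_sin B0).
rewrite (eq_bigr (fun=> 2 * B)); last first.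
  by move=> j /negbTE jk; rewrite /g jk (sint_kern B0).
rewrite mulrAC; congr (_ / _).
by rewrite -[in RHS](card_ord N) -prodr_const [RHS](bigD1 k).
Qed.

Lemma box_bounded (g : E -> R) : continuous g ->
  exists2 G, 0 <= G & forall x, box B x -> `|g x| <= G.
Proof.
move=> cg.
have b0 : @box R B N !=set0 by exists 0; exact: box0.
have cn : {within @box R B N, continuous (fun x => `|g x|)}.
  apply: continuous_subspaceT => x; apply: continuous_comp; first exact: cg.
  exact: norm_continuous.
have [c cB hc] := compact_EVT_max b0 (@compact_box R B N) cn.
by exists `|g c| => // x xB; apply: hc; rewrite inE.
Qed.

Lemma box_unif_continuous (g : E -> R) e : continuous g -> 0 < e ->
  exists2 d : R, 0 < d & forall x y : E, box B x ->
    (forall k, `|x 0 k - y 0 k| < d) -> `|g x - g y| <= e.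
Proof.
move=> /continuous_rVP cg e0; have e2 : 0 < e / 2 by rewrite divr_gt0.
have /compact_near_coveringP H := @compact_box R B N.
have /nbhs_ballP[d /= d0 dP] : \forall d \near (0 : R), @box R B N `<=`
    (fun x => forall y : E, (forall k, `|x 0 k - y 0 k| < d) -> `|g x - g y| <= e).
  refine (H R (nbhs (0 : R)) (fun d x => forall y : E, (forall k, `|x 0 k - y 0 k| < d) ->
    `|g x - g y| <= e) _ _).
  move=> x _; have [d d0 dP] := cg x _ e2; have d2 : 0 < d / 2 by rewrite divr_gt0.
  exists (ball x (d / 2), ball (0 : R) (d / 2)).
    by split; apply: nbhsx_ballx.
  move=> [z t] /= [[_ xz]]; rewrite /ball/= sub0r normrN => td y zy.
  have h1 : `|g x - g z| <= e / 2.
    apply: dP => k; apply: lt_trans (xz 0 k) _.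
    by rewrite ltr_pdivrMr// ltr_pMr// ltr1n.
  have h2 : `|g x - g y| <= e / 2.
    apply: dP => k; have := xz 0 k; have := zy k; rewrite /ball/=.
    by move: td; rewrite !ltr_norml => /andP[? ?] /andP[? ?] /andP[? ?]; apply/andP; split; lra.
  by move: h1 h2; rewrite !ler_norml => /andP[? ?] /andP[? ?]; apply/andP; split; lra.
exists (d / 2) => [|x y xB]; first by rewrite divr_gt0.
apply: (dP (d / 2)) => //; rewrite /ball/= sub0r normrN ger0_norm ?divr_ge0 ?(ltW d0)//.
by rewrite ltr_pdivrMr// ltr_pMr// ltr1n.
Qed.

(* Korovkin's argument: the oscillation of [g] is dominated by a small constant
   plus a multiple of the functions [sin2 k x], whose means against the kernel
   are explicit. *)
Lemma korovkin (g : E -> R) e : continuous g -> 0 < e ->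
  exists M0 : nat, forall M x, (M0 <= M)%N -> box (B / 2) x ->
    `|bint B (fun y => kernN M x y * g y) - (2 * B) ^+ N * g x| <= e.
Proof.
move=> cg e0; set V := (2 * B) ^+ N.
have V0 : 0 < V by rewrite exprn_gt0// mulr_gt0.
(* The kernel has total mass V, so this part of the oscillation contributes e/2. *)
have e1 : 0 < e / (2 * V) by rewrite divr_gt0// mulr_gt0.
have [G G0 hG] := box_bounded cg; have [d d0 hd] := box_unif_continuous cg e1.
have l0 := halffreq_gt0 B0.
have [eta eta0 heta] := @sin_lower R (l * d) (mulr_gt0 l0 d0).
(* Where some coordinates of x and y differ by d or more, one [sin2] is at least eta, and [Q] times
   it exceeds the trivial bound 2G on the oscillation. *)
pose Q := 2 * G / eta; have Q0 : 0 <= Q by rewrite divr_ge0 ?mulr_ge0// ltW.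
have s0 k x y : 0 <= sin2 k x y by rewrite sqr_ge0.
have osc x y : box (B / 2) x -> box B y ->
    `|g y - g x| <= e / (2 * V) + Q * \sum_k sin2 k x y.
  move=> xB yB.
  have S0 : 0 <= \sum_k sin2 k x y by rewrite sumr_ge0.
  have xB' : box B x by move=> k; apply: le_trans (xB k) _; move: B0; lra.
  have [/existsP[k hk]|/existsPn hn] := boolP [exists k, d <= `|x 0 k - y 0 k|]; last first.
    rewrite distrC (le_trans (hd x y xB' _)) ?lerDl ?(mulr_ge0 Q0 S0)// => k.
    by rewrite ltNge hn.
  have h1 : eta <= sin2 k x y.
    apply: heta; rewrite normrM (gtr0_norm l0) ?ler_pM2l//.
    have -> : 3 / 4 * pi = l * (3 / 2 * B) :> R by rewrite -(halffreqE B0); field.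
    rewrite ler_pM2l// (le_trans (ler_normB _ _))//.
    by have := xB k; have := yB k; lra.
  have h2 : eta <= \sum_k sin2 k x y.
    apply: le_trans h1 _; rewrite (bigD1 k)//= lerDl sumr_ge0//.
  have h3 : 2 * G <= Q * \sum_k sin2 k x y.
    by rewrite /Q mulrAC (ler_pdivlMr _ _ eta0) ler_wpM2l// mulr_ge0.
  have := hG _ xB'; have := hG _ yB; have := ler_normB (g y) (g x); move: e1 h3.
  by move: (e / (2 * V)) => ?; lra.
have [M0 hM0] := @iS_small R (Q * N%:R * V) (e / 2) (divr_gt0 e0 (ltr0n _ 2)).
exists M0 => M x M0M xB.
pose h y := e / (2 * V) + Q * \sum_k sin2 k x y.
have ck := @continuous_kernN M x.
have cS : continuous (fun y => \sum_k sin2 k x y).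
  by apply: cont_sum_rV => k; exact: continuous_sin2.
have cc c : continuous (fun _ : E => c : R) by move=> ?; exact: cst_continuous.
have ch : continuous h by apply: cont_rVD => //; exact: cont_rVZ.
have kh : bint B (fun y => kernN M x y * h y) <= e.
  have -> : (fun y => kernN M x y * h y) = (fun y => (e / (2 * V)) * kernN M x y +
      Q * \sum_k kernN M x y * sin2 k x y).
    by apply/funext => y; rewrite /h -mulr_sumr; ring.
  have cks k : continuous (fun y => kernN M x y * sin2 k x y).
    by apply: cont_rVM => //; exact: continuous_sin2.
  have bs (r : seq 'I_N) : bint B (fun y => \sum_(k <- r) kernN M x y * sin2 k x y) =
      (size r)%:R * (V / (2 * M + 2)%:R).
    elim: r => [|k r IHr].
      by rewrite mul0r; under eq_fun do rewrite big_nil; rewrite bint_cst// mulr0.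
    under eq_fun do rewrite big_cons.
    rewrite (bintD B0) ?IHr ?bint_kernN_sin2 -?/V//=; last exact: cont_sum_rV.
    by rewrite -natr1; ring.
  rewrite (bintD B0); try by apply: cont_rVZ => //; exact: cont_sum_rV.
  rewrite !(bintZ B0)//; last exact: cont_sum_rV.
  rewrite bint_kernN -/V bs -sum1_size sum1_card card_ord.
  have -> : e / (2 * V) * V = e / 2 by field; rewrite gt_eqF.
  have : Q * N%:R * V * iS R M <= e / 2.
    apply: le_trans hM0; apply: ler_wpM2l; last exact: iS_le.
    exact: (mulr_ge0 (mulr_ge0 Q0 (ler0n _ _)) (ltW V0)).
  have le2 : (M.+1 <= 2 * M + 2)%N by rewrite addn2 ltnS leqW// leq_pmull.
  have le3 : (2 * M + 2)%:R^-1 <= iS R M.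
    by rewrite /iS lef_pV2 ?posrE ?ltr0n ?addn2// ler_nat -addn2.
  have QV : 0 <= Q * N%:R * V := mulr_ge0 (mulr_ge0 Q0 (ler0n _ _)) (ltW V0).
  have h1 := ler_wpM2l QV le3.
  rewrite [Q * (N%:R * _)](_ : _ = Q * N%:R * V * (2 * M + 2)%:R^-1); last by rewrite !mulrA.
  by move: h1; move: (_ * iS R M) (_ * _^-1) => a b; lra.
have ckg : continuous (fun y => kernN M x y * g y) by exact: cont_rVM.
have ckh : continuous (fun y => kernN M x y * h y) by exact: cont_rVM.
have ckc c : continuous (fun y => c * kernN M x y) by exact: cont_rVZ.
have E1 : V * g x = bint B (fun y => g x * kernN M x y).
  by rewrite (bintZ B0)// bint_kernN mulrC.
rewrite ler_distl; apply/andP; split.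
- rewrite lerBlDr; apply: le_trans (lerD (lexx _) kh).
  rewrite E1 -(bintD B0)//; apply: (bint_le B0); rewrite //; first exact: cont_rVD.
  move=> y yB; rewrite [g x * _]mulrC -mulrDr ler_wpM2l ?kernN_ge0//.
  by have := osc x y xB yB; rewrite -/(h y) ler_norml => /andP[? ?]; lra.
- apply: le_trans (lerD (lexx _) kh).
  rewrite E1 -(bintD B0)//; apply: (bint_le B0); rewrite //; first exact: cont_rVD.
  move=> y yB; rewrite [g x * _]mulrC -mulrDr ler_wpM2l ?kernN_ge0//.
  by have := osc x y xB yB; rewrite -/(h y) ler_norml => /andP[? ?]; lra.
Qed.

End Korovkin.

(** * The kernel means as finite Fourier sums *)

Section TrigonometricApproximation.
Variables (R : realType) (N : nat) (B : R).
Hypothesis B0 : 0 < B.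
Local Notation E := 'rV[R]_N.
Local Notation C := (R[i]).
Local Notation l := (halffreq B).
Local Notation dw f s := (foldr (@pderiv R N) f s).

Lemma cexp_natmul (z : C) n : cexp z ^+ n = cexp (n%:R * z).
Proof.
elim: n => [|n IHn]; first by rewrite expr0 mul0r cexp0.
by rewrite exprS IHn -cexpD -natr1; congr cexp; ring.
Qed.

Lemma natC n : (n%:R : C) = n%:R +i* (0 : R).
Proof. by rewrite -(rmorph_nat (real_complex R)). Qed.

Lemma cosC (t : R) : ((2 * cos t)%:C : C) = cexp (0 +i* t) + cexp (0 +i* (- t)).
Proof.
by rewrite /cexp /= expR0 cosN sinN; apply: complex_eqP; rewrite ?ReD ?ImD /=; ring.
Qed.

Definition kcoef (M i : nat) : R := (M`!%:R) ^+ 2 / (i`!%:R * (2 * M - i)`!%:R).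

(** Binomial expansion of (e^(it) + e^(-it))^(2M). Only even multiples of [l] occur, so the index i
    stands for the frequency numbered M - i of the period 2B. *)
Lemma kernC M (x y : R) : ((kern B M x y)%:C : C) =
  \sum_(i < (2 * M).+1) (kcoef M i)%:C *
     cexp (0 +i* (2 * l * (M%:R - i%:R) * (x - y))).
Proof.
set t := l * (x - y).
have -> : kern B M x y = kweight R M / 4 ^+ M * (2 * cos t) ^+ (2 * M).
  have e4 : (2 : R) ^+ (2 * M) = 4 ^+ M by rewrite exprM -natrX.
  by rewrite /kern -/t exprMn e4 mulrA divfK// expf_neq0// pnatr_eq0.
set a := kweight R M / 4 ^+ M.
have -> : ((a * (2 * cos t) ^+ (2 * M))%:C : C) = a%:C * ((2 * cos t)%:C) ^+ (2 * M).
  by rewrite -rmorphXn -rmorphM.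
rewrite cosC exprDn mulr_sumr; apply: eq_bigr => i _.
have i_le : (i <= 2 * M)%N by rewrite -ltnS.
have -> : kcoef M i = a * 'C(2 * M, i)%:R.
  have := bin_fact i_le; rewrite /a /kcoef /kweight => e.
  have h1 : (i`!)%:R != 0 :> R by rewrite pnatr_eq0 -lt0n fact_gt0.
  have h2 : ((2 * M - i)`!)%:R != 0 :> R by rewrite pnatr_eq0 -lt0n fact_gt0.
  have h3 : ('C(2 * M, i))%:R != 0 :> R by rewrite pnatr_eq0 -lt0n bin_gt0.
  have h4 : (4 : R) ^+ M != 0 by rewrite expf_neq0// pnatr_eq0.
  rewrite -e !natrM.
  by field; rewrite h1 h2 h3 h4.
have -> : ((a * 'C(2 * M, i)%:R)%:C : C) = a%:C * 'C(2 * M, i)%:R.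
  by rewrite natC; apply: complex_eqP; rewrite ?ReM ?ImM /=; ring.
rewrite !cexp_natmul -cexpD -mulrA -[_ *+ _]mulr_natl; congr (_ * (_ * cexp _)).
rewrite !natC natrB//; apply: complex_eqP; rewrite ?ReD ?ImD ?ReM ?ImM /= natrM /t; ring.
Qed.

Definition imz (xi : 'I_N -> R) : 'I_N -> C := fun j => 0 +i* xi j.

Definition freq M (k : {ffun 'I_N -> 'I_(2 * M).+1}) : 'I_N -> R :=
  fun j => 2 * l * (M%:R - (k j)%:R).

Definition kcoefN M (k : {ffun 'I_N -> 'I_(2 * M).+1}) : R := \prod_j kcoef M (k j).

Lemma cexp_sum (I : Type) (r : seq I) (F : I -> C) :
  cexp (\sum_(i <- r) F i) = \prod_(i <- r) cexp (F i).
Proof. by elim/big_rec2 : _ => [|i x y _ <-]; rewrite ?cexp0// cexpD. Qed.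

Lemma kernNC M (x y : E) : ((kernN B M x y)%:C : C) =
  \sum_(k : {ffun 'I_N -> 'I_(2 * M).+1}) (kcoefN k)%:C *
    (expf (imz (freq k)) x * expf (imz (fun j => - freq k j)) y).
Proof.
rewrite /kernN rmorph_prod /=; under eq_bigr do rewrite kernC.
rewrite bigA_distr_bigA /=; apply: eq_bigr => k _.
rewrite big_split /= -rmorph_prod /=; congr (_ * _).
rewrite /expf -cexpD -cexp_sum; congr cexp.
rewrite /cdot -big_split /=; apply: eq_bigr => j _.
by rewrite /freq /imz; apply: complex_eqP; rewrite ?ReD ?ImD ?ReM ?ImM /=; ring.
Qed.

Definition fcoef (phi : E -> C) (xi : 'I_N -> R) : C :=
  ((2 * B) ^- N)%:C * cbint B (fun y => phi y * expf (imz (fun j => - xi j)) y).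

Definition trigmean (phi : E -> C) M : E -> C := fun x =>
  \sum_(k : {ffun 'I_N -> 'I_(2 * M).+1})
    ((kcoefN k)%:C * fcoef phi (freq k)) * expf (imz (freq k)) x.

Lemma trigmeanE (phi : E -> C) M x : ccont phi ->
  trigmean phi M x = ((2 * B) ^- N)%:C * cbint B (fun y => (kernN B M x y)%:C * phi y).
Proof.
move=> cphi.
have ct (k : {ffun 'I_N -> 'I_(2 * M).+1}) :
    ccont (fun y => phi y * expf (imz (fun j => - freq k j)) y).
  by apply: ccontM => //; exact: ccont_expf.
have -> : (fun y => (kernN B M x y)%:C * phi y) = (fun y =>
   \sum_(k : {ffun 'I_N -> 'I_(2 * M).+1}) ((kcoefN k)%:C * expf (imz (freq k)) x) *
     (phi y * expf (imz (fun j => - freq k j)) y)).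
  apply/funext => y; rewrite kernNC mulr_suml; apply: eq_bigr => k _.
  by move: (_ %:C) (expf _ _) (expf _ _) (phi y) => a b c d; ring.
rewrite (cbint_sum B0); last by move=> k; apply: ccontZ; exact: ct.
rewrite mulr_sumr; apply: eq_bigr => k _.
rewrite (cbintZ B0 _ (ct k)).
by rewrite /fcoef; move: (_ %:C) (_ %:C) (cbint _ _) (expf _ _) => a b c d; ring.
Qed.

Lemma smooth_trigmean phi M : smooth setT (trigmean phi M).
Proof.
apply: (smooth_sum _ openT) => k; apply: (smoothZ _ openT).
exact: (smooth_expf _ openT).1.
Qed.

(** Integration by parts in the Fourier coefficients produces the factors that differentiating the
    exponentials produces. Hence uniform convergence of the means extends to all derivatives. *)
Lemma foldr_trigmean b phi M s x : b < B -> test_on (@box R b N) phi ->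
  dw (trigmean phi M) s x = trigmean (dw phi s) M x.
Proof.
move=> bB tphi; rewrite /trigmean.
have se k := (@smooth_expf R N setT (imz (@freq M k)) openT).
rewrite (foldr_sum openT)//; last first.
  by move=> k; apply: (smoothZ _ openT); exact: (se k).1.
apply: eq_bigr => k _; rewrite (foldrZ openT)//; last exact: (se k).1.
rewrite (se k).2// /fcoef (fourier_parts_word B0 _ _ bB tphi).
have -> : \prod_(j <- s) - imz (fun j0 => - freq k j0) j = \prod_(j <- s) imz (freq k) j.
  apply: eq_bigr => j _; apply: complex_eqP; rewrite ?ReN ?ImN /= ?oppr0//.
  by rewrite opprK.
by move: (_ %:C) (_ %:C) (cbint _ _) (expf _ _) (\prod_(_ <- _) _) => ? ? ? ? ?; ring.
Qed.

Lemma trigmean_cvg b phi s e : b < B -> test_on (@box R b N) phi -> 0 < e ->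
  exists M0 : nat, forall M x, (M0 <= M)%N -> box (B / 2) x ->
    normc (dw (trigmean phi M) s x - dw phi s x) <= e.
Proof.
move=> bB tphi e0; set psi := dw phi s.
have cpsi : ccont psi.
  apply: smooth_ccont; apply: smooth_foldr; exact: tphi.1.
set V := (2 * B) ^+ N; have V0 : 0 < V by rewrite exprn_gt0// mulr_gt0.
have e2 : 0 < V * (e / 2) by rewrite mulr_gt0// divr_gt0.
have [M1 hM1] := korovkin B0 (ccont_Re cpsi) e2.
have [M2 hM2] := korovkin B0 (ccont_Im cpsi) e2.
exists (maxn M1 M2) => M x; rewrite geq_max => /andP[MM1 MM2] xB.
rewrite (foldr_trigmean _ _ _ bB tphi) (trigmeanE _ _ cpsi) -/psi -/V.
have := hM1 M x MM1 xB; have := hM2 M x MM2 xB; rewrite -/V => h2 h1.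
have H (I g : R) : `|I - V * g| <= V * (e / 2) -> `|V^-1 * I - g| <= e / 2.
  move=> h; rewrite -(ler_pM2l V0) -{1}(gtr0_norm V0) -normrM mulrBr mulrA.
  by rewrite divff ?mul1r// gt_eqF.
apply: le_trans (ler_normc_ReIm _) _; rewrite [leRHS]splitr.
apply: lerD.
- rewrite ReD ReN ReM /= mul0r subr0; under eq_fun do rewrite ReM /= mul0r subr0.
  exact: H.
- rewrite ImD ImN ImM /= mul0r addr0; under eq_fun do rewrite ImM /= mul0r addr0.
  exact: H.
Qed.

(* The coefficients of the kernel are [binomial(2M, M+n) / binomial(2M, M)]. *)
Lemma kcoef_bounds M (i : nat) : (i <= 2 * M)%N ->
  0 <= kcoef M i <= 1 /\ 1 - kcoef M i <= (M%:R - i%:R) ^+ 2 * iS R M.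
Proof.
(* By symmetry it is enough to take i = M + n. The quotient (M-n)/(M+n+1) of consecutive
   coefficients misses 1 by at most (2n+1)/(M+1), and the odd numbers add up to n^2. *)
have K n : (n <= M)%N -> 0 <= kcoef M (M + n) <= 1 /\
    1 - kcoef M (M + n) <= n%:R ^+ 2 * iS R M.
  elim: n => [|n IHn] nM.
    rewrite addn0 /kcoef (_ : 2 * M - M = M)%N; last by rewrite mul2n -addnn addnK.
    rewrite -expr2 divff ?expf_neq0 ?pnatr_eq0 -?lt0n ?fact_gt0//.
    by rewrite ler01 lexx subrr expr0n mul0r.
  have [/andP[k0 k1] kb] := IHn (ltnW nM).
  have e1 : (2 * M - (M + n) = M - n)%N by rewrite mul2n -addnn subnDl.
  have e2 : (2 * M - (M + n.+1) = (M - n).-1)%N by rewrite mul2n -addnn subnDl subnS.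
  have e4 : (2 * n + 1)%:R = 2 * n%:R + 1 :> R by rewrite natrD natrM.
  have d0 : (M + n).+1%:R != 0 :> R by rewrite pnatr_eq0.
  have mn0 : (0 < M - n)%N by rewrite subn_gt0.
  have step : kcoef M (M + n.+1) = kcoef M (M + n) * ((M - n)%:R / (M + n).+1%:R).
    have e3 : ((M - n)`! = (M - n) * ((M - n).-1)`!)%N.
      by rewrite -[in LHS](prednK mn0) factS (prednK mn0).
    rewrite /kcoef e2 e1 e3 addnS factS !natrM.
    have h1 : ((M + n)`!)%:R != 0 :> R by rewrite pnatr_eq0 -lt0n fact_gt0.
    have h2 : (((M - n).-1)`!)%:R != 0 :> R by rewrite pnatr_eq0 -lt0n fact_gt0.
    have h3 : (M - n)%:R != 0 :> R by rewrite pnatr_eq0 -lt0n.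
    by field; rewrite -natrD nat1r d0 h1 h2 h3.
  have r0 : 0 <= (M - n)%:R / (M + n).+1%:R :> R by rewrite divr_ge0.
  have r1 : (M - n)%:R / (M + n).+1%:R <= 1 :> R.
    rewrite ler_pdivrMr ?ltr0n// mul1r ler_nat.
    exact: (leq_trans (leq_subr _ _) (leqW (leq_addr _ _))).
  have r2 : 1 - (M - n)%:R / (M + n).+1%:R <= (2 * n + 1)%:R * iS R M :> R.
    have -> : 1 - (M - n)%:R / (M + n).+1%:R = (2 * n + 1)%:R / (M + n).+1%:R :> R.
      rewrite -{1}(divff d0) -mulrBl; congr (_ / _); rewrite natrB ?(ltnW nM)//.
      by rewrite e4 -natr1 natrD; ring.
    rewrite ler_wpM2l// /iS lef_pV2 ?posrE ?ltr0n// ler_nat ltnS leq_addr//.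
  rewrite step; split; first by rewrite mulr_ge0//= mulr_ile1.
  move: r0 r1 r2; set r := _ / _ => r0 r1 r2.
  have -> : n.+1%:R ^+ 2 * iS R M = n%:R ^+ 2 * iS R M + (2 * n + 1)%:R * iS R M.
    by rewrite e4 -natr1; ring.
  have -> : 1 - kcoef M (M + n) * r = 1 - kcoef M (M + n) + kcoef M (M + n) * (1 - r).
    by ring.
  apply: lerD => //; apply: le_trans r2.
  by rewrite -[leRHS]mul1r ler_wpM2r// subr_ge0.
move=> i2; have [Mi|iM] := leqP M i.
  have iM : (i - M <= M)%N by rewrite leq_subLR addnn -mul2n.
  have := K _ iM; rewrite subnKC// => -[? h]; split=> //.
  by rewrite (natrB _ Mi) in h; rewrite -sqrrN opprB.
have iM' : (M - i <= M)%N by exact: leq_subr.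
have := K _ iM'; have -> : kcoef M (M + (M - i)) = kcoef M i.
  rewrite /kcoef; have -> : (M + (M - i) = 2 * M - i)%N.
    by rewrite addnBA ?(ltnW iM)// addnn mul2n.
  by rewrite subKn// [X in _ / X]mulrC.
by rewrite (natrB _ (ltnW iM)).
Qed.

End TrigonometricApproximation.

(** * Gevrey cut-off functions *)

Section GevreyBump.
Variable R : realType.

Section Exponential.
Variable a : nat.
Hypothesis a_gt0 : (0 < a)%N.

(** The n-th derivative of exp(-x^(-a)) is the same exponential times the sum over k of [bcoef n k]
    x^(-(ka+n)); the two terms of the recursion differentiate the power and the exponential. *)
Fixpoint bcoef (n k : nat) : R :=
  match n with
  | 0 => (k == 0%N)%:R
  | n'.+1 => - (k * a + n')%:R * bcoef n' k +
      a%:R * (if k is k'.+1 then bcoef n' k' else 0)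
  end.

Lemma bcoef_gt n k : (n < k)%N -> bcoef n k = 0.
Proof.
elim: n k => [|n IHn] [|k]//= nk.
by rewrite !IHn ?mulr0 ?addr0// ltnW.
Qed.

(** With 2^k k! in the denominator, the sum over k against y^(ak) is at most exp(y^a / 2), half of
    the available decay. The constant comes from (ka + n) + 2ak <= (3a+1)(n+1) for k <= n+1. *)
Lemma bcoef_le n k :
  `|bcoef n k| <= (3 * a + 1)%:R ^+ n * n`!%:R / (2 ^+ k * k`!%:R).
Proof.
elim: n k => [|n IHn] k /=.
  case: k => [|k] /=; first by rewrite normr1 !expr0 fact0 !mulr1 invr1 mulr1.
  by rewrite normr0 divr_ge0.
have [nk|kn] := ltnP n.+1 k.
  rewrite bcoef_gt ?(ltnW nk)// mulr0 add0r.
  case: k nk => //= k nk.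
  by rewrite bcoef_gt// mulr0 normr0 divr_ge0 ?mulr_ge0.
set A : R := (3 * a + 1)%:R ^+ n * n`!%:R.
have A0 : 0 <= A by rewrite mulr_ge0.
set D : R := 2 ^+ k * k`!%:R.
have D0 : 0 < D :> R by rewrite mulr_gt0 ?exprn_gt0 ?ltr0n ?fact_gt0.
have t1 : `|- (k * a + n)%:R * bcoef n k| <= (k * a + n)%:R * (A / D).
  by rewrite normrM normrN normr_nat ler_wpM2l// IHn.
have t2 : `|a%:R * (if k is k'.+1 then bcoef n k' else 0)| <= (2 * a * k)%:R * (A / D).
  rewrite normrM normr_nat /D; clear D D0 t1 kn; case: k => [|k'].
    by rewrite normr0 mulr0 muln0 mul0r.
  rewrite -mulnA mulnCA natrM -mulrA ler_wpM2l//; apply: le_trans (IHn k') _.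
  rewrite -/A exprS factS !natrM.
  have h1 : (k'`!)%:R != 0 :> R by rewrite pnatr_eq0 -lt0n fact_gt0.
  have h2 : (2 : R) ^+ k' != 0 by rewrite expf_neq0// pnatr_eq0.
  rewrite le_eqVlt; apply/orP; left; apply/eqP.
  by field; rewrite h1 h2 nat1r pnatr_eq0.
apply: le_trans (ler_normD _ _) _; apply: le_trans (lerD t1 t2) _.
rewrite -mulrDl -natrD mulrA ler_wpM2r ?invr_ge0 ?(ltW D0)//.
rewrite exprS factS natrM.
have -> : (3 * a + 1)%:R * (3 * a + 1)%:R ^+ n * (n.+1%:R * n`!%:R) =
   ((3 * a + 1) * n.+1)%:R * A :> R by rewrite /A natrM; ring.
by rewrite ler_wpM2r// ler_nat; nia.
Qed.

Lemma bcoef_sum n (y : R) :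
  \sum_(k < n.+2) bcoef n.+1 k * y ^+ (k * a + n.+1) =
  \sum_(k < n.+1) - (k * a + n)%:R * bcoef n k * y ^+ (k * a + n.+1) +
  \sum_(k < n.+1) a%:R * bcoef n k * y ^+ (k.+1 * a + n.+1).
Proof.
rewrite /=; under eq_bigr do rewrite mulrDl.
rewrite big_split /=; congr (_ + _).
  by rewrite big_ord_recr/= bcoef_gt// mulr0 mul0r addr0.
rewrite big_ord_recl /= mulr0 mul0r add0r.
by apply: eq_bigr => k _; rewrite /bump leq0n add1n.
Qed.

Definition psi (n : nat) (x : R) : R :=
  if 0 < x then (\sum_(k < n.+1) bcoef n k * x^-1 ^+ (k * a + n)) * expR (- x^-1 ^+ a)
  else 0.

Lemma is_derive_invX (x : R) m : 0 < x ->
  is_derive x 1 (fun t => t^-1 ^+ m) (- m%:R * x^-1 ^+ m.+1).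
Proof.
move=> x0; have xn0 : x != 0 by rewrite gt_eqF.
have d1 : is_derive x 1 (fun t : R => t^-1) (- x^-1 ^+ 2).
  have did : derivable (id : R -> R) x 1 by exact: derivable_id.
  have d := derivableV (xn0 : (id : R -> R) x != 0) did.
  have e := deriveV (xn0 : (id : R -> R) x != 0) did.
  apply: (DeriveDef d); rewrite e derive_id.
  by rewrite /GRing.scale/= mulr1 exprVn.
apply: (is_derive_eq (is_derive_comp_expn m d1)).
case: m => [|m] /=; first by rewrite !mul0r oppr0 mul0r.
by rewrite !exprS expr0; ring.
Qed.

Lemma is_derive_sumR (I : Type) (r : seq I) (F : I -> R -> R) (l : I -> R) (x : R) :
  (forall i, is_derive x 1 (F i) (l i)) ->
  is_derive x 1 (fun y => \sum_(i <- r) F i y) (\sum_(i <- r) l i).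
Proof.
move=> dF; elim: r => [|i r IHr].
  by rewrite big_nil; under eq_fun do rewrite big_nil; apply: is_derive_cst.
by rewrite big_cons; under eq_fun do rewrite big_cons; exact: (is_deriveD (dF i) IHr).
Qed.

Lemma is_derive_mulc (c : R) (F : R -> R) (l : R) (x : R) :
  is_derive x 1 F l -> is_derive x 1 (fun y => c * F y) (c * l).
Proof. exact: is_deriveZ. Qed.

Lemma psi_derive_gt0 n (x : R) : 0 < x -> is_derive x 1 (psi n) (psi n.+1 x).
Proof.
move=> x0.
pose p (t : R) := (\sum_(k < n.+1) bcoef n k * t^-1 ^+ (k * a + n)).
have dp : is_derive x 1 p
    (\sum_(k < n.+1) bcoef n k * (- (k * a + n)%:R * x^-1 ^+ (k * a + n).+1)).
  by apply: is_derive_sumR => k; apply: is_derive_mulc; exact: is_derive_invX.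
have de : is_derive x 1 (fun t => expR (- t^-1 ^+ a))
    (expR (- x^-1 ^+ a) * (a%:R * x^-1 ^+ a.+1)).
  have d1 := is_deriveN (is_derive_invX a x0).
  apply: (is_derive_eq (is_derive1_comp (is_derive_expR _) d1)).
  by rewrite /=; ring.
have near_gt : \near x, p x * expR (- x^-1 ^+ a) = psi n x.
  have : \forall t \near x, 0 < t by exact: lt_nbhsr.
  by apply: filterS => t t0; rewrite /psi t0.
apply: (near_eq_is_derive near_gt).
apply: (is_derive_eq (is_deriveM dp de)).
rewrite /psi x0 /GRing.scale/= -/(p x) bcoef_sum.
set y := x^-1; set e := expR _.
rewrite -[p x * _]/(p x * (e * (a%:R * y ^+ a.+1))) mulrDl [RHS]addrC.
congr (_ + _).
  rewrite [e * (a%:R * _)]mulrC mulrA; congr (_ * e); rewrite /p mulr_suml.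
  apply: eq_bigr => k _.
  have -> : (k.+1 * a + n.+1 = (k * a + n) + a.+1)%N by rewrite mulSn; lia.
  rewrite -/y [in RHS]exprD; move: (y ^+ (k * a + n)) (y ^+ a.+1) (bcoef n k) => u v w.
  by ring.
rewrite mulrC; congr (_ * _); apply: eq_bigr => k _.
by rewrite addnS mulrCA mulrA.
Qed.

Lemma expr_fact_le (z : R) n : 0 <= z -> z ^+ n <= n`!%:R * expR z.
Proof.
move=> z0; case: n => [|n]; first by rewrite expr0 fact0 mul1r -expR0 ler_expR.
rewrite mulrC -ler_pdivrMr ?ltr0n ?fact_gt0//.
by apply: le_trans (expR_ge1Dxn n z0); rewrite lerDr.
Qed.

(** The remaining half of the decay controls y^(an) by 2^n n!. Taking the a-th root afterwards gives
    n!^(1/a), which is where the Gevrey order 1 + 1/a comes from. *)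
Lemma psi_main_bound n (y : R) : 0 <= y ->
  (y ^+ n * expR (- (y ^+ a / 2))) ^+ a <= 2 ^+ n * n`!%:R.
Proof.
move=> y0; have z0 : 0 <= y ^+ a / 2 by rewrite divr_ge0// exprn_ge0.
have h := expr_fact_le n z0.
have -> : (y ^+ n * expR (- (y ^+ a / 2))) ^+ a =
    2 ^+ n * ((y ^+ a / 2) ^+ n * expR (- (y ^+ a / 2)) ^+ a).
  rewrite exprMn exprAC [(y ^+ a / 2) ^+ n]expr_div_n mulrA [2 ^+ n * _]mulrC.
  by rewrite divfK// expf_neq0// pnatr_eq0.
apply: ler_wpM2l; first by rewrite exprn_ge0.
set z := y ^+ a / 2 in z0 h *; set e := expR (- z).
have e0 : 0 < e by exact: expR_gt0.
have e1 : e <= 1 by rewrite -expR0 ler_expR oppr_le0.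
have h2 : z ^+ n * e <= n`!%:R.
  by have := ler_wpM2r (ltW e0) h; rewrite -mulrA expRxMexpNx_1 mulr1.
apply: le_trans h2; apply: ler_wpM2l; first by rewrite exprn_ge0.
by rewrite -(prednK a_gt0) exprS ger_pMr// exprn_ile1// ltW.
Qed.

Lemma psi_le n (x : R) : 0 < x ->
  `|psi n x| <= (3 * a + 1)%:R ^+ n * n`!%:R * (x^-1 ^+ n * expR (- (x^-1 ^+ a / 2))).
Proof.
move=> x0; rewrite /psi x0; set y := x^-1.
have y0 : 0 <= y by rewrite invr_ge0 ltW.
set A : R := (3 * a + 1)%:R ^+ n * n`!%:R.
have A0 : 0 <= A by rewrite mulr_ge0.
have S : `|\sum_(k < n.+1) bcoef n k * y ^+ (k * a + n)| <=
    A * (y ^+ n * expR (y ^+ a / 2)).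
  apply: le_trans (ler_norm_sum _ _ _) _.
  have T (k : nat) : `|bcoef n k * y ^+ (k * a + n)| <=
      A * y ^+ n * ((y ^+ a / 2) ^+ k / k`!%:R).
    have -> : y ^+ (k * a + n) = (y ^+ a) ^+ k * y ^+ n by rewrite exprD mulnC exprM.
    have u0 : 0 <= (y ^+ a) ^+ k by rewrite !exprn_ge0.
    have v0 : 0 <= y ^+ n by rewrite exprn_ge0.
    rewrite expr_div_n normrM [`|_ * y ^+ n|]ger0_norm ?mulr_ge0//.
    apply: le_trans (ler_wpM2r _ (bcoef_le n k)) _; first by rewrite mulr_ge0.
    rewrite -/A; move: ((y ^+ a) ^+ k) (y ^+ n) => u v.
    have h1 : (k`!)%:R != 0 :> R by rewrite pnatr_eq0 -lt0n fact_gt0.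
    have h2 : (2 : R) ^+ k != 0 by rewrite expf_neq0// pnatr_eq0.
    rewrite le_eqVlt; apply/orP; left; apply/eqP.
    have fe (p c d q w : R) : c != 0 -> d != 0 ->
        p / (d * c) * (q * w) = p * w * (q / d / c).
      by move=> c0 d0; field; rewrite c0 d0.
    exact: fe.
  have T2 : \sum_(k < n.+1) `|bcoef n k * y ^+ (k * a + n)| <=
      \sum_(k < n.+1) A * y ^+ n * ((y ^+ a / 2) ^+ k / k`!%:R).
    by apply: ler_sum => k _; exact: T.
  apply: le_trans T2 _.
  rewrite -mulr_sumr -mulrA ler_wpM2l// ler_wpM2l ?exprn_ge0//.
  rewrite -(big_mkord xpredT (fun k => (y ^+ a / 2) ^+ k / k`!%:R)).
  have z0 : 0 <= y ^+ a / 2 by rewrite divr_ge0// exprn_ge0.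
  have c := is_cvg_series_exp_coeff (y ^+ a / 2).
  have nd : nondecreasing_seq (series (exp_coeff (y ^+ a / 2))).
    by apply/nondecreasing_seqP => m; rewrite !seriesEnat/= big_nat_recr//= lerDl exp_coeff_ge0.
  exact: nondecreasing_cvgn_le nd c n.+1.
rewrite normrM [`|expR _|]gtr0_norm ?expR_gt0//.
apply: le_trans (ler_wpM2r (expR_ge0 _) S) _.
rewrite -mulrA; apply: ler_wpM2l => //; rewrite -mulrA; apply: ler_wpM2l.
  exact: exprn_ge0.
by rewrite -expRD ler_expR; move: (y ^+ a) => z; lra.
Qed.

Definition gev (C H sg : R) (n : nat) : R := C * H ^+ n * n`!%:R `^ sg.

Lemma psi_gevrey n (x : R) :
  `|psi n x| <= gev 1 (2 * (3 * a + 1)%:R) (1 + a%:R^-1) n.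
Proof.
have f1 : 1 <= n`!%:R :> R by rewrite ler1n fact_gt0.
have f0 : 0 <= n`!%:R :> R by exact: le_trans f1.
rewrite /gev mul1r.
have [x0|x0] := ltP 0 x; last first.
  by rewrite /psi ltNge x0/= normr0 mulr_ge0 ?exprn_ge0 ?mulr_ge0 ?powR_ge0.
apply: le_trans (psi_le n x0) _.
have y0 : 0 <= x^-1 by rewrite invr_ge0 ltW.
have := psi_main_bound n y0; set Y := x^-1 ^+ n * _ => hY.
have Y0 : 0 <= Y by rewrite mulr_ge0 ?exprn_ge0 ?expR_ge0.
have ai0 : 0 <= a%:R^-1 :> R by rewrite invr_ge0.
have an0 : a%:R != 0 :> R by rewrite pnatr_eq0 -lt0n.
have hY' : Y <= 2 ^+ n * n`!%:R `^ a%:R^-1.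
  have -> : Y = (Y ^+ a) `^ a%:R^-1.
    by rewrite -powR_mulrn// -powRrM mulfV// powRr1.
  apply: le_trans (ge0_ler_powR ai0 _ _ hY) _; rewrite ?nnegrE ?exprn_ge0 ?mulr_ge0 ?exprn_ge0//.
  rewrite powRM ?exprn_ge0// ler_wpM2r ?powR_ge0// -powR_mulrn// -powRrM.
  apply: ler_powR; first by rewrite ler1n.
  by rewrite -[leRHS]mulr1 ler_wpM2l// invf_le1 ?ltr0n// ler1n.
apply: le_trans (ler_wpM2l _ hY') _; first by rewrite mulr_ge0 ?exprn_ge0.
rewrite powRD; last by apply/implyP => _; rewrite pnatr_eq0 -lt0n fact_gt0.
rewrite powRr1// exprMn le_eqVlt; apply/orP; left; apply/eqP; ring.
Qed.

(** For the differentiability at 0: two powers of 1/x are borrowed from the bound of order n+2. *)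
Lemma psi_quad n : exists C : R, forall x, 0 < x -> `|psi n x| <= C * x ^+ 2.
Proof.
exists ((3 * a + 1)%:R ^+ n * n`!%:R * (1 + 2 ^+ n.+2 * n.+2`!%:R)) => x x0.
apply: le_trans (psi_le n x0) _.
have y0 : 0 <= x^-1 by rewrite invr_ge0 ltW.
have := psi_main_bound n.+2 y0; set Y := x^-1 ^+ n.+2 * _ => hY.
have Y0 : 0 <= Y by rewrite mulr_ge0 ?exprn_ge0 ?expR_ge0.
(* Any constant will do here, so no a-th root is taken. *)
have Y1 : Y <= 1 + Y ^+ a.
  have [Y1|Y1] := leP Y 1; first by rewrite (le_trans Y1)// lerDl exprn_ge0.
  by apply: ler_wpDl => //; rewrite -{1}[Y]expr1 ler_eXn2l.
rewrite -[X in _ <= X]mulrA; apply: ler_wpM2l; first by rewrite mulr_ge0 ?exprn_ge0.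
have -> : x^-1 ^+ n * expR (- (x^-1 ^+ a / 2)) = Y * x ^+ 2.
  have e2 : x^-1 ^+ n.+2 = x^-1 ^+ n * x^-1 ^+ 2 by rewrite -exprD addn2.
  rewrite /Y e2; move: (x^-1 ^+ n) (expR _) => u e.
  have -> : u * x^-1 ^+ 2 * e * x ^+ 2 = u * e * (x^-1 ^+ 2 * x ^+ 2).
    by move: (x^-1 ^+ 2) (x ^+ 2) => v w; ring.
  by rewrite -exprMn mulVf ?gt_eqF// expr1n mulr1.
apply: ler_wpM2r; first by rewrite exprn_ge0// ltW.
by apply: le_trans Y1 _; rewrite lerD2l.
Qed.

Lemma psi_derive n (x : R) : is_derive x 1 (psi n) (psi n.+1 x).
Proof.
have [x0|x0|->] := ltgtP x 0; last 1 first.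
- have e0 m : psi m 0 = 0 by rewrite /psi ltxx.
  rewrite e0; apply/is_deriveP => e e0'.
  have [C hC] := psi_quad n.
  have C1 : 0 < `|C| + 1 by rewrite ltr_wpDl.
  have H2 : \forall h \near (0 : R)^', `|h| < e / (`|C| + 1).
    by apply: cvg_within; apply/nbhs_normP; exists (e / (`|C| + 1)) => /=;
      [rewrite divr_gt0|move=> y /=; rewrite sub0r normrN].
  have H3 : \forall h \near (0 : R)^', h != 0 by exact: nbhs_dnbhs_neq.
  apply: filterS2 H2 H3 => h hd h0.
  rewrite addr0 [_%:A]mulr1 e0 subr0 sub0r normrN normrM normfV.
  rewrite mulrC ler_pdivrMr ?normr_gt0//.
  have [hp|hn] := ltP 0 h; last by rewrite /psi ltNge hn/= normr0 mulr_ge0// ltW.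
  apply: le_trans (hC h hp) _; rewrite (gtr0_norm hp) expr2 mulrA ler_wpM2r ?(ltW hp)//.
  move: hd; rewrite (gtr0_norm hp) ltr_pdivlMr// => /ltW hd.
  apply: le_trans hd; rewrite mulrC ler_wpM2l ?(ltW hp)//.
  by rewrite (le_trans (ler_norm C))// lerDl.
- have -> : psi n.+1 x = 0 by rewrite /psi ltNge ltW.
  have d0 : is_derive x 1 (fun _ : R => 0 : R) 0 by exact: is_derive_cst.
  apply: near_eq_is_derive d0.
  have : \forall t \near x, t < 0 by exact: lt_nbhsl.
  by apply: filterS => t t0; rewrite /psi ltNge ltW.
- exact: psi_derive_gt0.
Qed.

Lemma psi0_gt0 (x : R) : 0 < x -> 0 < psi 0 x.
Proof.
by move=> x0; rewrite /psi x0 big_ord_recl big_ord0 /= mul0n addr0 expr0 mulr1 mul1r expR_gt0.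
Qed.

Lemma psi_le0 n (x : R) : x <= 0 -> psi n x = 0.
Proof. by move=> x0; rewrite /psi ltNge x0. Qed.

End Exponential.
End GevreyBump.

(** * Gevrey bumps and plateaus in one variable *)

Section Plateau.
Variable R : realType.
Implicit Types p q : nat -> R -> R.

(** A function is carried together with all its derivatives, so that no derivative operator has to
    be iterated. *)
Definition is_jet p := forall n (x : R), is_derive x 1 (p n) (p n.+1 x).

Lemma jet_continuous p n : is_jet p -> continuous (p n).
Proof.
move=> jp x; apply/differentiable_continuous/derivable1_diffP.
exact: (ex_derive (is_derive := jp n x)).
Qed.

Lemma jet_affine p (c b : R) : is_jet p ->
  is_jet (fun n x => c ^+ n * p n (c * x + b)).
Proof.
move=> jp n x.
have d1 : is_derive x 1 (fun t : R => c * t + b) c.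
  apply: (is_derive_eq (is_deriveD (is_derive_mulc c (is_derive_id x (1 : R)))
    (is_derive_cst b x (1 : R)))).
  by rewrite addr0 mulr1.
have := is_derive_mulc (c ^+ n) (@is_derive1_comp _ (p n) (fun t => c * t + b) x _ _ (jp n (c * x + b)) d1).
by move=> H; apply: (is_derive_eq H); rewrite exprSr; ring.
Qed.

Definition jetM p q : nat -> R -> R := fun n x =>
  \sum_(i < n.+1) 'C(n, i)%:R * (p i x * q (n - i)%N x).

Lemma jetM_jet p q : is_jet p -> is_jet q -> is_jet (jetM p q).
Proof.
move=> jp jq n x.
have D : is_derive x 1 (jetM p q n) (\sum_(i < n.+1) 'C(n, i)%:R *
    (p i.+1 x * q (n - i)%N x + p i x * q (n - i).+1 x)).
  apply: is_derive_sumR => i; apply: is_derive_mulc.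
  apply: (is_derive_eq (is_deriveM (jp i x) (jq (n - i)%N x))).
  by rewrite /GRing.scale/= addrC; congr (_ + _); rewrite mulrC.
apply: (is_derive_eq D); rewrite /jetM.
under eq_bigr do rewrite mulrDr; rewrite big_split /=.
rewrite [RHS]big_ord_recl /= bin0 subn0 mul1r.
have -> : \sum_(i < n.+1) 'C(n.+1, bump 0 i)%:R * (p (bump 0 i) x * q (n.+1 - bump 0 i)%N x)
  = \sum_(i < n.+1) 'C(n, i.+1)%:R * (p i.+1 x * q (n - i)%N x)
  + \sum_(i < n.+1) 'C(n, i)%:R * (p i.+1 x * q (n - i)%N x).
  rewrite -big_split /=; apply: eq_bigr => i _.
  by rewrite /bump leq0n add1n binS natrD subSS mulrDl.
rewrite addrA addrC; congr (_ + _).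
rewrite [LHS]big_ord_recl /= bin0 subn0 mul1r; congr (_ + _).
rewrite [RHS]big_ord_recr /= bin_small// mul0r addr0.
apply: eq_bigr => i _; rewrite /bump leq0n add1n; congr (_ * (_ * _)).
by rewrite -subSn// subSS.
Qed.

Lemma gev_ge0 (C H sg : R) n : 0 <= C -> 0 <= H -> 0 <= gev C H sg n.
Proof. by move=> C0 H0; rewrite mulr_ge0 ?powR_ge0// mulr_ge0 ?exprn_ge0. Qed.

Lemma fact_mul_le i j : (i`! * j`! <= (i + j)`!)%N.
Proof.
have h := @bin_fact (i + j) i (leq_addr _ _).
by rewrite -h addKn leq_pmull// bin_gt0 leq_addr.
Qed.

Lemma gevM (C C' H sg : R) i j : 0 <= C -> 0 <= C' -> 0 <= H -> 0 <= sg ->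
  gev C H sg i * gev C' H sg j <= gev (C * C') H sg (i + j).
Proof.
move=> C0 C'0 H0 sg0; rewrite /gev.
have -> : C * H ^+ i * i`!%:R `^ sg * (C' * H ^+ j * j`!%:R `^ sg) =
   C * C' * H ^+ (i + j) * (i`! * j`!)%:R `^ sg.
  by rewrite natrM powRM// exprD; ring.
apply: ler_wpM2l; first by rewrite !mulr_ge0 ?exprn_ge0.
apply: ge0_ler_powR => //; rewrite ?nnegrE// ler_nat; exact: fact_mul_le.
Qed.

(** Leibniz: i! j! <= (i+j)! bounds each product, and the binomial coefficients sum to 2^n, absorbed
    into 2H. *)
Lemma jetM_gev p q (C C' H sg : R) n x : 0 <= C -> 0 <= C' -> 0 <= H -> 0 <= sg ->
  (forall n, `|p n x| <= gev C H sg n) -> (forall n, `|q n x| <= gev C' H sg n) ->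
  `|jetM p q n x| <= gev (C * C') (2 * H) sg n.
Proof.
move=> C0 C'0 H0 sg0 hp hq; apply: le_trans (ler_norm_sum _ _ _) _.
have T (i : 'I_n.+1) : true -> `|'C(n, i)%:R * (p i x * q (n - i)%N x)| <=
    'C(n, i)%:R * gev (C * C') H sg n.
  move=> _; rewrite normrM normr_nat ler_wpM2l// normrM.
  apply: le_trans (ler_pM _ _ (hp _) (hq _)) _ => //.
  by apply: le_trans (gevM _ _ C0 C'0 H0 sg0) _; rewrite subnKC// -ltnS.
apply: le_trans (ler_sum _ T) _.
rewrite -mulr_suml -natr_sum.
have -> : (\sum_(i < n.+1) 'C(n, i) = 2 ^ n)%N.
  rewrite -[2%N]/(1 + 1)%N expnDn; apply: eq_bigr => i _.
  by rewrite !exp1n !muln1.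
rewrite /gev exprMn natrX le_eqVlt; apply/orP; left; apply/eqP; ring.
Qed.

Variable sg : R.
Hypothesis sg1 : 1 < sg.

Lemma bump_exists : exists p (H : R), [/\ is_jet p, 1 <= H,
  forall n x, `|p n x| <= gev 1 H sg n,
  forall n (x : R), 1 <= `|x| -> p n x = 0 &
  forall x : R, 0 <= p 0%N x /\ (`|x| < 1 -> 0 < p 0%N x)].
Proof.
(* The exponent [a] is taken so large that the order 1 + 1/a does not exceed sg. *)
have [a0 ha0] := @iS_small R 1 (sg - 1) (etrans (subr_gt0 _ _) sg1).
pose a := a0.+1; have a_gt0 : (0 < a)%N by [].
have sga : 1 + a%:R^-1 <= sg by move: ha0; rewrite mul1r /iS -/a; lra.
pose H0 : R := 2 * (3 * a + 1)%:R.
have H01 : 1 <= H0 by rewrite /H0 -natrM ler1n addn1 mulnS.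
have hpsi n x : `|psi a n x| <= gev 1 H0 sg n.
  apply: le_trans (psi_gevrey a_gt0 n x) _; rewrite /gev -/H0.
  apply: ler_wpM2l; first by rewrite mul1r exprn_ge0// (le_trans _ H01).
  by apply: ler_powR => //; rewrite ler1n fact_gt0.
pose p (n : nat) (x : R) : R := 1 ^+ n * psi a n (1 * x + 1).
pose q (n : nat) (x : R) : R := (-1) ^+ n * psi a n (-1 * x + 1).
have jp : is_jet p by apply: jet_affine; exact: psi_derive.
have jq : is_jet q by apply: jet_affine; exact: psi_derive.
exists (jetM p q), (2 * H0); split.
- exact: jetM_jet.
- by move: H01; lra.
- move=> n x; have := @jetM_gev p q 1 1 H0 sg n x; rewrite mul1r; apply=> //.
  + by rewrite (le_trans _ H01).
  + by rewrite ltW// (lt_trans _ sg1).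
  + by move=> m; rewrite /p expr1n !mul1r; exact: hpsi.
  + by move=> m; rewrite /q normrM normrX normrN1 expr1n mul1r; exact: hpsi.
- move=> n x x1; apply: big1 => i _.
  have [h|h] : x <= -1 \/ 1 <= x.
  + by have [x0|x0] := ger0P x; move: x1; [rewrite ger0_norm//; right|
      rewrite ltr0_norm// => ?; left; lra].
  + by rewrite /p psi_le0 ?mulr0 ?mul0r ?mulr0//; lra.
  + by rewrite /q psi_le0 ?mulr0//; lra.
- move=> x; rewrite /jetM big_ord_recl big_ord0 addr0 bin0 mul1r /p /q !expr0 !mul1r mulN1r.
  have pn (y : R) : 0 <= psi a 0 y.
    have [y0|y0] := leP y 0; first by rewrite psi_le0.
    by rewrite ltW// psi0_gt0.
  split=> [|x1]; first by rewrite mulr_ge0.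
  by move: x1; rewrite ltr_norml => /andP[? ?]; rewrite mulr_gt0// psi0_gt0//; lra.
Qed.

(* A primitive of a bump function, truncated to the left, is a smooth step. *)
Lemma plateau_exists : exists h (C H : R), [/\ is_jet h, 0 <= C /\ 1 <= H,
  forall n x, `|h n x| <= gev C H sg n,
  forall n (x : R), 3 <= `|x| -> h n x = 0 &
  forall x : R, `|x| <= 1 -> h 0%N x = 1].
Proof.
have [p [H [jp H1 hp p0 p_ge0]]] := bump_exists.
pose F (y : R) := \int[@lebesgue_measure R]_(t in `[-5, y]) p 0%N t.
have cp := @jet_continuous p 0%N jp.
have dF (x : R) : -5 < x -> is_derive x 1 F (p 0%N x).
  move=> x5; have [||||d e] := @continuous_FTC1_closed R (p 0%N) (-5) x (x + 1).
  - by rewrite ltrDl.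
  - apply: continuous_compact_integrable; first exact: segment_compact.
    exact: continuous_subspaceT.
  - exact: x5.
  - exact: cp.
  - by apply: (DeriveDef d); rewrite -derive1E.
have F0 y : y <= -1 -> F y = 0.
  move=> y1; rewrite /F (@eq_Rintegral _ _ _ _ _ (fun=> 0)); last first.
    move=> t; rewrite inE/= in_itv/= => /andP[_ ty].
    by apply: p0; rewrite ler0_norm; lra.
  by rewrite Rintegral_cst// mul0r.
pose S y := if y <= -2 then 0 else F y.
have S0 y : y <= -1 -> S y = 0 by move=> y1; rewrite /S F0//; case: ifP.
have dS (x : R) : is_derive x 1 S (p 0%N x).
  have [x1|x1] := ltP x (-1).
    have -> : p 0%N x = 0 by apply: p0; rewrite ler0_norm; lra.
    have d0 : is_derive x 1 (fun _ : R => 0 : R) 0 by exact: is_derive_cst.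
    apply: near_eq_is_derive d0.
    have : \forall t \near x, t < -1 by exact: lt_nbhsl.
    by apply: filterS => t /ltW t1; rewrite S0.
  have x5 : -5 < x by lra.
  apply: near_eq_is_derive (dF x x5).
  have : \forall t \near x, -2 < t by apply: lt_nbhsr; lra.
  by apply: filterS => t t2; rewrite /S leNgt t2.
have mv u v : u <= v -> exists2 c, c \in `[u, v]%R & S v - S u = p 0%N c * (v - u).
  move=> uv; apply: (MVT_segment uv (fun x _ => dS x)).
  by apply: derivable_within_continuous => x _; exact: (ex_derive (is_derive := dS x)).
have S1 y : 1 <= y -> S y = S 1.
  move=> y1; have [c] := mv 1 y y1; rewrite in_itv/= => /andP[c1 _] e.
  apply/eqP; rewrite -subr_eq0 e p0 ?mul0r// ger0_norm; lra.
have SM : S 1 > 0.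
  have df (x : R) : x \in `](-1), 1[%R -> is_derive x 1 S (p 0%N x) by move=> _; exact: dS.
  have cS : {within `[(-1), 1], continuous S}.
    by apply: derivable_within_continuous => x _; exact: (ex_derive (is_derive := dS x)).
  have lt11 : (-1 : R) < 1 by lra.
  have [c] := MVT lt11 df cS; rewrite in_itv/= => /andP[c1 c2] e.
  have -> : S 1 = p 0%N c * (1 - (-1)) by rewrite -e (S0 (-1)) ?subr0.
  have pc : 0 < p 0%N c by apply: (p_ge0 c).2; rewrite ltr_norml c1.
  by apply: mulr_gt0 => //; lra.
pose C := `|S 1|^-1 * (2 + 2 * S 1).
have hS y : `|S y| <= 2 + S 1.
  have [y1|y1] := leP y (-1); first by rewrite S0// normr0; lra.
  have [y2|y2] := leP 1 y; first by rewrite S1// gtr0_norm//; lra.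
  have [c _ e] := mv (-1) y (ltW y1).
  have -> : S y = p 0%N c * (y - (-1)) by rewrite -e (S0 (-1)) ?subr0.
  rewrite normrM; have := hp 0%N c; rewrite /gev fact0 powR1 !mulr1 => hc.
  have h2 : `|y - -1| <= 2 by rewrite ger0_norm; lra.
  by apply: le_trans (ler_pM _ _ hc h2) _ => //; rewrite mul1r; lra.
pose g n := if n is n'.+1 then p n' else S.
have jg : is_jet g by case=> [|n] x; [exact: dS|exact: jp].
(* [S] is 0 up to -1 and constant from 1 on. For |x| <= 1 the two shifted arguments lie on opposite
   sides of the step, for |x| >= 3 on the same side. *)
pose h (n : nat) (x : R) : R := (S 1)^-1 * (1 ^+ n * g n (1 * x + 2) - 1 ^+ n * g n (1 * x - 2)).
have jh : is_jet h.
  move=> n x; apply: is_derive_mulc; apply: is_deriveB.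
    exact: (jet_affine 1 2 jg).
  exact: (jet_affine 1 (-2) jg).
have hg n y : `|g n y| <= gev (2 + S 1) H sg n.
  have f1 m : 1 <= m`!%:R `^ sg.
    rewrite -{1}(powRr0 (m`!%:R)); apply: ler_powR; first by rewrite ler1n fact_gt0.
    by rewrite ltW// (lt_trans _ sg1).
  case: n => [|n] /=; first by rewrite /gev fact0 powR1 !mulr1; exact: hS.
  apply: le_trans (hp n y) _; rewrite /gev.
  apply: ler_pM; rewrite ?powR_ge0 ?mulr_ge0 ?exprn_ge0 ?(le_trans _ H1)//.
    apply: ler_pM; rewrite ?exprn_ge0 ?(le_trans _ H1)//; first by move: SM; lra.
    by rewrite exprS ler_peMl// exprn_ge0// (le_trans _ H1).
  apply: ge0_ler_powR; rewrite ?nnegrE//; first by rewrite ltW// (lt_trans _ sg1).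
  by rewrite ler_nat factS leq_pmull.
exists h, ((S 1)^-1 * (2 * (2 + S 1))), H; split=> //.
- by split=> //; rewrite mulr_ge0 ?invr_ge0 ?(ltW SM)// mulr_ge0// addr_ge0// ltW.
- move=> n x; rewrite /h !expr1n !mul1r normrM gtr0_norm ?invr_gt0//.
  rewrite /gev -!mulrA ler_wpM2l ?invr_ge0 ?(ltW SM)//.
  apply: le_trans (ler_normB _ _) _.
  apply: le_trans (lerD (hg n _) (hg n _)) _.
  by rewrite /gev le_eqVlt; apply/orP; left; apply/eqP; ring.
- move=> n x x3; rewrite /h !expr1n !mul1r.
  have [h1|h1] : x <= -3 \/ 3 <= x.
  + by have [x0|x0] := ger0P x; move: x3; [rewrite ger0_norm//; right|
      rewrite ltr0_norm// => ?; left; lra].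
  + case: n => [|n] /=.
      by rewrite (S0 (x + 2)) ?(S0 (x - 2)) ?subrr ?mulr0//; lra.
    rewrite (p0 n (x + 2)) ?(p0 n (x - 2)) ?subrr ?mulr0//;
      by rewrite ler0_norm; lra.
  + case: n => [|n] /=.
      by rewrite (S1 (x + 2)) ?(S1 (x - 2)) ?subrr ?mulr0//; lra.
    rewrite (p0 n (x + 2)) ?(p0 n (x - 2)) ?subrr ?mulr0//;
      by rewrite ger0_norm; lra.
- move=> x; rewrite ler_norml => /andP[x1 x2].
  rewrite /h !expr1n !mul1r /= (S1 (x + 2)) ?(S0 (x - 2)) ?subr0 ?mulVf ?gt_eqF//; lra.
Qed.

End Plateau.

(** * Polynomials without zeros on a polydisc *)

Section Polynomials.
Variables (R : realType) (N : nat).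
Local Notation C := (R[i]).
Local Notation poly := (mpoly N C).
Implicit Types (P q : poly) (z : 'I_N -> C).

Definition deg_le d q := forall b, (d < mdeg b)%N -> mcoeff b q = 0.

(** The linear form on polynomials sending the monomial of exponent m to [F m]. Evaluation at a
    point and the action of index shifts on a sequence are both of this form. *)
Definition pairing (F : multinom N -> C) q : C := \sum_(m <- msupp q) mcoeff m q * F m.

Lemma pairing_bmultinom d F q : deg_le d q ->
  pairing F q = \sum_(b : bmultinom N d.+1) mcoeff b q * F b.
Proof.
move=> dq.
have -> : \sum_(b : bmultinom N d.+1) mcoeff b q * F b =
    \sum_(b : bmultinom N d.+1) \sum_(m <- msupp q) (mcoeff m q * F m) * (m == b)%:R.
  apply: eq_bigr => b _; rewrite {1}[q]mpolyE raddf_sum /= mulr_suml.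
  apply: eq_bigr => m _; rewrite mcoeffZ mcoeffX.
  by case: eqP => [->|_]; rewrite ?mulr1// !mulr0 mul0r.
rewrite exchange_big /= /pairing big_seq [RHS]big_seq; apply: eq_bigr => m mq.
have md : (mdeg m < d.+1)%N.
  by rewrite ltnNge; apply/negP => /dq; move: mq; rewrite mcoeff_msupp => /eqP.
rewrite (bigD1 (BMultinom md))//= eqxx mulr1 big1 ?addr0// => b bm.
case: eqP => [e|_]; last by rewrite mulr0.
by case/negP: bm; apply/eqP/val_inj.
Qed.

Lemma deg_le_leq d d' q : (d <= d')%N -> deg_le d q -> deg_le d' q.
Proof. by move=> dd dq b db; apply: dq; exact: leq_ltn_trans db. Qed.

Lemma deg_leD d q r : deg_le d q -> deg_le d r -> deg_le d (q + r).
Proof. by move=> dq dr b db; rewrite mcoeffD dq// dr// addr0. Qed.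

Lemma deg_leZ d (c : C) q : deg_le d q -> deg_le d (c *: q).
Proof. by move=> dq b db; rewrite mcoeffZ dq// mulr0. Qed.

Lemma deg_leMX d q j : deg_le d q -> deg_le d.+1 (mpolyX C (mnm1 j) * q).
Proof.
move=> dq b db; apply/eqP; rewrite mpoly_mulC mcoeff_eq0; apply/negP.
rewrite (perm_mem (msuppMX _ _)) => /mapP[m mq e].
move: db; rewrite e mdegD mdeg1 add1n ltnS => /dq.
by move: mq; rewrite mcoeff_msupp => /eqP.
Qed.

Lemma deg_le_msize q : deg_le (msize q).-1 q.
Proof.
move=> b db; apply/eqP; rewrite mcoeff_eq0; apply: msize_mdeg_ge.
by move: db; case: (mmeasure _ _).
Qed.

Lemma pairingD d F q r : deg_le d q -> deg_le d r ->
  pairing F (q + r) = pairing F q + pairing F r.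
Proof.
move=> dq dr; rewrite !(@pairing_bmultinom d)//; last exact: deg_leD.
by rewrite -big_split; apply: eq_bigr => b _; rewrite mcoeffD mulrDl.
Qed.

Lemma pairingZ d F (c : C) q : deg_le d q ->
  pairing F (c *: q) = c * pairing F q.
Proof.
move=> dq; rewrite !(@pairing_bmultinom d)//; last exact: deg_leZ.
by rewrite mulr_sumr; apply: eq_bigr => b _; rewrite mcoeffZ mulrA.
Qed.

Lemma pairing_sum d F (I : Type) (r : seq I) (q : I -> poly) :
  (forall i, deg_le d (q i)) ->
  pairing F (\sum_(i <- r) q i) = \sum_(i <- r) pairing F (q i) /\
  deg_le d (\sum_(i <- r) q i).
Proof.
move=> dq; elim: r => [|i r [IH1 IH2]].
  rewrite !big_nil; split; last by move=> b _; rewrite mcoeff0.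
  by rewrite /pairing msupp0 big_nil.
rewrite !big_cons; split; last exact: deg_leD.
by rewrite (@pairingD d) // IH1.
Qed.

Lemma pairingMX F q j :
  pairing F (mpolyX C (mnm1 j) * q) = pairing (fun b => F (mnm_add (mnm1 j) b)) q.
Proof.
rewrite /pairing mpoly_mulC (perm_big _ (msuppMX q (mnm1 j))) big_map.
by apply: eq_bigr => m _; rewrite mcoeffMX.
Qed.

Lemma pairing1 F : pairing F 1 = F mnm0.
Proof. by rewrite /pairing msupp1 big_seq1 mcoeff1 eqxx mul1r. Qed.

Definition linf z (j : 'I_N) : poly := mpolyC N (z j) - mpolyX C (mnm1 j).

Lemma linfE z j q : linf z j * q = z j *: q + (-1) *: (mpolyX C (mnm1 j) * q).
Proof. by rewrite /linf mulrBl mul_mpolyC scaleN1r. Qed.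

Lemma deg_le_word z (s : seq 'I_N) : deg_le (size s) (\prod_(j <- s) linf z j).
Proof.
elim: s => [|j s IHs].
  rewrite big_nil => b b0; rewrite mcoeff1; case: eqP b0 => // ->.
  by rewrite mdeg0.
rewrite big_cons linfE /=; apply: deg_leD; apply: deg_leZ.
  exact: deg_le_leq IHs.
exact: deg_leMX.
Qed.

(* [P(z - X)], whose coefficients are the Taylor coefficients of [P] at [z]. *)
Definition taylor P z : poly := mmap (@mpolyC N C) (linf z) P.

Lemma taylorE P z : taylor P z =
  \sum_(a <- msupp P) mcoeff a P *: \prod_(j <- mword a) linf z j.
Proof.
rewrite /taylor /mmap; apply: eq_bigr => a _.
by rewrite mul_mpolyC /mmap1 prod_mword.
Qed.

Lemma deg_le_taylor P z d : deg_le d P -> deg_le d (taylor P z).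
Proof.
move=> dP; rewrite taylorE big_seq.
elim/big_rec : _ => [b _|a q aP dq]; first by rewrite mcoeff0.
apply: deg_leD (dq); apply: deg_leZ; apply: (@deg_le_leq (size (mword a))); last exact: deg_le_word.
rewrite size_mword leqNgt; apply/negP => /dP.
by move: aP; rewrite mcoeff_msupp => /eqP.
Qed.

Lemma meval_taylor P z w :
  meval w (taylor P z) = meval (fun j => z j - w j) P.
Proof.
rewrite taylorE raddf_sum /=; apply: eq_bigr => a _.
rewrite mevalZ rmorph_prod /= /mmap1 -prod_mword; congr (_ * _).
by apply: eq_bigr => j _; rewrite rmorphB /= mevalC mevalXU.
Qed.

Lemma meval_pairing q w : meval w q = pairing (fun b => \prod_j w j ^+ b j) q.
Proof. by []. Qed.

Lemma mcoeff0_taylor P z : mcoeff mnm0 (taylor P z) = meval z P.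
Proof.
have -> : meval z P = meval (fun=> 0) (taylor P z).
  by rewrite meval_taylor; apply: meval_eq => j; rewrite subr0.
rewrite meval_pairing {1}[taylor P z]mpolyE raddf_sum /=.
apply: eq_bigr => m _; rewrite mcoeffZ mcoeffX; congr (_ * _).
case: eqP => [->|m0]; first by rewrite big1// => j _; rewrite mnm0E expr0.
have [/forallP h|/forallPn[j hj]] := boolP [forall j, m j == 0%N].
  by case: m0; apply/mnmP => j; rewrite mnm0E; apply/eqP.
by rewrite (bigD1 j)//= expr0n (negbTE hj) mul0r.
Qed.

(* Restricting to complex lines, each factor [1 - w/r] has modulus at most 2. *)
Lemma line_growth P z w d : deg_le d P ->
  (forall t : C, normc t <= 1 -> meval (fun j => z j + t * w j) P != 0) ->
  normc (meval (fun j => z j + w j) P) <= 2 ^+ d * normc (meval z P).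
Proof.
move=> dP nz.
pose q : {poly C} := mmap (@polyC C) (fun j => (z j)%:P + (w j) *: 'X) P.
have qE t : q.[t] = meval (fun j => z j + t * w j) P.
  rewrite /q /meval /mmap horner_sum; apply: eq_bigr => a _.
  rewrite hornerM hornerC /mmap1 horner_prod; congr (_ * _).
  by apply: eq_bigr => j _; rewrite horner_exp !hornerE mulrC.
have qs : (size q <= d.+1)%N.
  rewrite /q /mmap big_seq; apply: (leq_trans (size_sum _ _ _)).
  apply/bigmax_leqP_seq => a _ aP.
  have ad : (mdeg a <= d)%N.
    rewrite leqNgt; apply/negP => /dP; move: aP; rewrite mcoeff_msupp => /eqP//.
  rewrite mul_polyC; apply: leq_trans (size_scale_leq _ _) _.
  rewrite /mmap1 -prod_mword; apply: leq_trans (_ : (mdeg a).+1 <= _)%N => //.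
  rewrite -size_mword; elim: (mword a) => [|j s IHs]; first by rewrite big_nil size_poly1.
  rewrite big_cons; apply: leq_trans (size_polyMleq _ _) _.
  have h : (size ((z j)%:P + w j *: 'X : {poly C})%R <= 2)%N.
    apply: leq_trans (size_polyD _ _) _; rewrite geq_max.
    rewrite (leq_trans (size_polyC_leq1 _))//=.
    by apply: leq_trans (size_scale_leq _ _) _; rewrite size_polyX.
  by rewrite -subn1 leq_subLR (leq_trans (leq_add h IHs)).
have [r qr] := closed_field_poly_normal q.
have q0 : q != 0.
  apply/eqP => q0; have := nz 0; rewrite -qE q0 horner0 eqxx.
  by rewrite Normc.normc0 ler01 => /(_ isT).
have lc0 : lead_coef q != 0 by rewrite lead_coef_eq0.
have rs : (size r <= d)%N.
  by move: qs; rewrite qr size_scale// size_prod_XsubC.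
have hr x : x \in r -> 1 <= normc x.
  move=> xr; rewrite leNgt; apply/negP => x1; have := nz x (ltW x1).
  by rewrite -qE qr hornerZ -/(root _ _) (eqP (_ : root _ x)) ?root_prod_XsubC// mulr0 eqxx.
have e1 : meval (fun j => z j + w j) P = q.[1].
  by rewrite qE; apply: meval_eq => j; rewrite mul1r.
have e0 : meval z P = q.[0].
  by rewrite qE; apply: meval_eq => j; rewrite mul0r addr0.
have hE t : q.[t] = lead_coef q * \prod_(x <- r) (t - x).
  rewrite {1}qr hornerZ horner_prod; congr (_ * _).
  by apply: eq_bigr => x _; rewrite hornerXsubC.
rewrite e1 e0 !hE !Normc.normcM mulrCA; apply: ler_wpM2l; first exact: normc_ge0.
apply: (@le_trans _ _ (2 ^+ size r * normc (\prod_(x <- r) (0 - x)))); last first.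
  apply: ler_wpM2r; first exact: normc_ge0.
  by rewrite ler_weXn2l// ler1n.
rewrite !normc_prod; elim: r hr {qr rs hE} => [|x r IHr] hr; first by rewrite !big_nil expr0 mulr1.
rewrite !big_cons /= exprS mulrACA; apply: ler_pM.
- exact: normc_ge0.
- by apply: prodr_ge0 => *; exact: normc_ge0.
- rewrite sub0r normc_opp; apply: le_trans (ler_normcB _ _) _.
  by rewrite Normc.normc1; have := hr x (mem_head _ _); lra.
- by apply: IHr => y yr; apply: hr; rewrite inE yr orbT.
Qed.

(** The Vandermonde matrix of d+1 distinct nodes in [0, 1) is invertible; row k of weights extracts
    the coefficient of degree k from the values at the nodes. *)
Lemma interpolation d : exists w : 'I_d.+1 -> 'I_d.+1 -> C, forall k l : 'I_d.+1,
  \sum_i w k i * (i%:R / d.+1%:R) ^+ l = (k == l)%:R.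
Proof.
pose a : 'rV[C]_d.+1 := \row_i (i%:R / d.+1%:R).
have dn : d.+1%:R != 0 :> C by rewrite pnatr_eq0.
have V : Vandermonde d.+1 a \in unitmx.
  rewrite unitmxE det_Vandermonde unitfE; apply/prodf_neq0 => i _.
  apply/prodf_neq0 => j ij; rewrite !mxE -mulrBl mulf_neq0 ?invr_eq0//.
  by rewrite subr_eq0 eqr_nat neq_ltn ij orbT.
pose W := invmx (Vandermonde d.+1 a).
exists (fun k i => W i k) => k l.
have := mulmxV V; move=> /matrixP /(_ l k); rewrite !mxE => e.
rewrite eq_sym -e; apply: eq_bigr => i _.
by rewrite !mxE mulrC.
Qed.

(** A substitute for Cauchy's estimates: the coefficients are recovered by interpolation on a
    product grid inside the polydisc, and there [line_growth] bounds the values by 2^d |P(z)|. The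
    constant depends on P only through d. *)
Lemma taylor_coef_bound P d : deg_le d P -> exists2 C0 : R, 0 < C0 &
  forall z (rho : R), 0 < rho ->
  (forall w, (forall j, normc (w j) <= rho) -> meval (fun j => z j - w j) P != 0) ->
  forall b, normc (mcoeff b (taylor P z)) * rho ^+ mdeg b <= C0 * normc (meval z P).
Proof.
move=> dP; have [v hv] := interpolation d.
pose A : R := \sum_k \sum_i normc (v k i).
have A0 : 0 <= A by apply: sumr_ge0 => k _; apply: sumr_ge0 => i _; exact: normc_ge0.
have vA k : \sum_i normc (v k i) <= A.
  rewrite /A [leRHS](bigD1 k)//= lerDl; apply: sumr_ge0 => k' _.
  by apply: sumr_ge0 => i _; exact: normc_ge0.
exists ((A + 1) ^+ N * 2 ^+ d) => [|z rho rho0 nz b].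
  by rewrite mulr_gt0 ?exprn_gt0// ltr_wpDl.
have [db|bd] := ltnP d (mdeg b).
  rewrite (deg_le_taylor z dP db) Normc.normc0 mul0r !mulr_ge0 ?exprn_ge0 ?normc_ge0//.
  by rewrite addr_ge0.
have le_b (a : multinom N) j : (mdeg a <= d)%N -> (a j < d.+1)%N.
  by move=> ad; rewrite ltnS (leq_trans _ ad)// mdegE (bigD1 j)//= leq_addr.
pose ob (a : multinom N) (j : 'I_N) : 'I_d.+1 := inord (a j).
pose pt (k : {ffun 'I_N -> 'I_d.+1}) (j : 'I_N) : C := rho%:C * ((k j)%:R / d.+1%:R).
have ptn k j : normc (pt k j) <= rho.
  rewrite Normc.normcM normc_real (gtr0_norm rho0) Normc.normcM Normc.normcV !normc_nat.
  by rewrite ger_pMr// ler_pdivrMr ?ltr0n// mul1r ler_nat ltnW.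
have growth k : normc (meval (pt k) (taylor P z)) <= 2 ^+ d * normc (meval z P).
  rewrite meval_taylor; apply: (line_growth dP) => t t1.
  have -> : (fun j => z j + t * - pt k j) = (fun j => z j - t * pt k j).
    by apply/funext => j; rewrite mulrN.
  apply: nz => j; rewrite Normc.normcM -[leRHS]mul1r.
  by apply: ler_pM => //; exact: normc_ge0.
have key : mcoeff b (taylor P z) * (rho%:C) ^+ mdeg b =
   \sum_(k : {ffun 'I_N -> 'I_d.+1}) (\prod_j v (ob b j) (k j)) * meval (pt k) (taylor P z).
  have ev k : meval (pt k) (taylor P z) = \sum_(a : bmultinom N d.+1)
      mcoeff a (taylor P z) * \prod_j pt k j ^+ (a : multinom N) j.
    by rewrite meval_pairing (pairing_bmultinom _ (deg_le_taylor z dP)).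
  under eq_bigr do rewrite ev mulr_sumr.
  rewrite exchange_big /=.
  (* The sum over the grid factors over the coordinates into Kronecker symbols, which select the
     exponent b. *)
  have sel (a : bmultinom N d.+1) : \sum_(k : {ffun 'I_N -> 'I_d.+1})
      (\prod_j v (ob b j) (k j)) * (mcoeff a (taylor P z) * \prod_j pt k j ^+ (a : multinom N) j) =
    mcoeff a (taylor P z) * (rho%:C) ^+ mdeg a * \prod_j (ob b j == ob a j)%:R.
    have hva j : (ob b j == ob a j)%:R = \sum_(i < d.+1) v (ob b j) i *
        (i%:R / d.+1%:R) ^+ (a : multinom N) j :> C.
      by rewrite -hv; apply: eq_bigr => i _; rewrite /ob inordK// le_b// -ltnS bmdeg.
    under [in RHS]eq_bigr do rewrite hva.
    rewrite bigA_distr_bigA /= mulr_sumr; apply: eq_bigr => k _.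
    have -> : \prod_j pt k j ^+ (a : multinom N) j =
       (rho%:C) ^+ mdeg a * \prod_j ((k j)%:R / d.+1%:R) ^+ (a : multinom N) j.
      rewrite mdegE expr_sum -big_split /=; apply: eq_bigr => j _.
      by rewrite /pt exprMn.
    rewrite [in RHS]big_split /= mulrCA -[in RHS]mulrA.
    by congr (_ * _); rewrite mulrCA.
  under [in RHS]eq_bigr do rewrite sel.
  have bd' : (mdeg b < d.+1)%N by rewrite ltnS.
  have e1 : \prod_j (ob b j == ob b j)%:R = 1 :> C.
    by rewrite big1// => j _; rewrite eqxx.
  rewrite (bigD1 (BMultinom bd'))//= e1 mulr1.
  rewrite big1 ?addr0// => a ab.
  have [/forallP h|/forallPn[j hj]] := boolP [forall j, ob b j == ob a j].
    case/negP: ab; apply/eqP/val_inj/mnmP => j /=; have /eqP := h j.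
    move=> /(congr1 (@nat_of_ord _)); rewrite /ob !inordK ?le_b// -ltnS bmdeg//.
  by rewrite [X in _ * X](bigD1 j)//= (negbTE hj) mul0r mulr0.
have -> : normc (mcoeff b (taylor P z)) * rho ^+ mdeg b =
    normc (mcoeff b (taylor P z) * (rho%:C) ^+ mdeg b).
  by rewrite Normc.normcM normcX normc_real gtr0_norm.
rewrite key; apply: le_trans (normc_sum _ _ _) _.
have T (k : {ffun 'I_N -> 'I_d.+1}) : true ->
    normc ((\prod_j v (ob b j) (k j)) * meval (pt k) (taylor P z)) <=
    (\prod_j normc (v (ob b j) (k j))) * (2 ^+ d * normc (meval z P)).
  move=> _; rewrite Normc.normcM normc_prod; apply: ler_wpM2l => //.
  by apply: prodr_ge0 => j _; exact: normc_ge0.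
apply: le_trans (ler_sum _ T) _.
rewrite -mulr_suml -(bigA_distr_bigA (fun j i => normc (v (ob b j) i))) /= -mulrA; apply: ler_wpM2r.
  by rewrite mulr_ge0 ?exprn_ge0 ?normc_ge0.
rewrite -[X in _ ^+ X](card_ord N) -prodr_const; apply: ler_prod => j _.
rewrite (le_trans (vA _)) ?lerDl// andbT.
by apply: sumr_ge0 => i _; exact: normc_ge0.
Qed.

End Polynomials.

(** * Gevrey cut-offs on cubes of R^N *)

Section Cutoffs.
Variables (R : realType) (N : nat).
Local Notation C := (R[i]).
Local Notation E := 'rV[R]_N.
Local Notation dw := (foldr (@pderiv R N)).
Implicit Types (q : 'I_N -> nat -> R -> R) (b : multinom N).

Definition tens q b (x : E) : C := \prod_k (q k (b k) (x 0 k))%:C.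

Lemma is_pd_prod0 j (r : seq 'I_N) (Q : pred 'I_N) (F : 'I_N -> E -> C) (x : E) :
  (forall k, Q k -> is_pd j (F k) x 0) ->
  is_pd j (fun y => \prod_(k <- r | Q k) F k y) x 0.
Proof.
move=> dF; elim: r => [|k r IHr].
  rewrite (_ : (fun y => _) = fun=> 1); first exact: is_pd_cst.
  by apply/funext => y; rewrite big_nil.
have [Qk|nQk] := boolP (Q k); last first.
  by under eq_fun do rewrite big_cons (negbTE nQk).
under eq_fun do rewrite big_cons Qk.
by apply: is_pd_eq (is_pdM (dF k Qk) IHr) _; rewrite mul0r mulr0 addr0.
Qed.

Lemma is_pd_tens q b j (x : E) : (forall k, is_jet (q k)) ->
  is_pd j (tens q b) x (tens q (mnm_add (mnm1 j) b) x).
Proof.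
move=> jq; have -> : tens q b = fun y : E =>
    (q j (b j) (y 0 j))%:C * \prod_(k | k != j) (q k (b k) (y 0 k))%:C.
  by apply/funext => y; rewrite /tens (bigD1 j).
apply: is_pd_eq (is_pdM (is_pd_coord j (jq j (b j) _)) (is_pd_prod0 _ _)) _.
  move=> k kj; apply: is_pd_eq (is_pd_coord j (jq k (b k) _)) _.
  by rewrite eq_sym (negbTE kj) mul0r.
rewrite mulr0 addr0 eqxx mul1r /tens [RHS](bigD1 j)//= mnmDE mnm1E eqxx add1n.
congr (_ * _); apply: eq_bigr => k kj.
by rewrite mnmDE mnm1E eq_sym (negbTE kj) add0n.
Qed.

Lemma ccont_tens q b : (forall k, is_jet (q k)) -> ccont (tens q b).
Proof.
move=> jq; rewrite /tens.
have H (r : seq 'I_N) : ccont (fun x : E => \prod_(k <- r) (q k (b k) (x 0 k))%:C).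
  elim: r => [|k r IHr]; first by under eq_fun do rewrite big_nil; exact: ccont_cst.
  under eq_fun do rewrite big_cons.
  apply: ccontM IHr => x; split; last exact: cst_continuous.
  apply: (@continuous_comp _ _ _ (fun y : E => y 0 k) (q k (b k))).
    exact: coord_continuous.
  exact: jet_continuous.
exact: H.
Qed.

Lemma smooth_tens q : (forall k, is_jet (q k)) -> forall b,
  smooth setT (tens q b) /\ forall s (x : E),
    dw (tens q b) s x = tens q (foldr (fun j => mnm_add (mnm1 j)) b s) x.
Proof.
move=> jq b; have [h1 h2] := @smooth_family R N setT openT _ (tens q)
  (fun j => mnm_add (mnm1 j)) (fun b x _ => ccont_tens b jq x)
  (fun b j x _ => is_pd_tens b j x jq) b.
by split=> // s x; exact: h2.
Qed.

Lemma gev_prod (A H sg : R) (r : seq 'I_N) b : 0 <= A -> 0 <= H -> 0 <= sg ->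
  \prod_(k <- r) gev A H sg (b k) <= gev (A ^+ size r) H sg (\sum_(k <- r) b k).
Proof.
move=> A0 H0 sg0; elim: r => [|k r IHr].
  by rewrite !big_nil /gev !expr0 !mul1r fact0 powR1.
rewrite !big_cons /= exprS; apply: le_trans (gevM _ _ _ _ _ _) => //; last first.
  exact: exprn_ge0.
by apply: ler_wpM2l => //; exact: gev_ge0.
Qed.

(** A tensor product of rescaled plateaus. It is returned with all its derivatives as a family
    indexed by multi-indices, which is the index set of the later recursion. *)
Lemma cutoff_exists (sg : R) (x0 : E) (r : R) : 1 < sg -> 0 < r ->
  exists (chi : multinom N -> E -> C) (A H : R),
  [/\ 0 <= A /\ 1 <= H,
   forall b, smooth setT (chi b) /\
     forall j (x : E), is_pd j (chi b) x (chi (mnm_add (mnm1 j) b) x),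
   forall b (x : E), ~ (forall k, `|x 0 k - x0 0 k| <= 3 * r) -> chi b x = 0,
   forall x : E, (forall k, `|x 0 k - x0 0 k| <= r) -> chi mnm0 x = 1 &
   forall b x, normc (chi b x) <= gev A H sg (mdeg b)].
Proof.
move=> sg1 r0; have [h [A [H [jh [A0 H1] hb h0 h1]]]] := plateau_exists sg1.
pose q k n x : R := (r^-1) ^+ n * h n (r^-1 * x + - (x0 0 k / r)).
have jq k : is_jet (q k) by exact: jet_affine.
have rV0 : 0 <= r^-1 by rewrite invr_ge0 ltW.
have sc k (x : E) : `|r^-1 * x 0 k + - (x0 0 k / r)| = `|x 0 k - x0 0 k| / r.
  by rewrite mulrC -mulrBl normrM (ger0_norm rV0).
have H0 : 0 <= H by lra.
have Hr : 0 <= H * r^-1 by exact: mulr_ge0.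
(* Rescaling by r costs H/r per derivative; the extra H keeps the constant at least 1. *)
exists (tens q), (A ^+ N), (H * (1 + r^-1)); split.
- split; first exact: exprn_ge0.
  by rewrite mulrDr mulr1 ler_wpDr.
- by move=> b; split; [exact: (smooth_tens jq b).1 | move=> j x; exact: is_pd_tens].
- move=> b x /existsNP[k /negP]; rewrite -ltNge => xk.
  rewrite /tens (bigD1 k)//= {1}/q h0 ?mulr0 ?mul0r//.
  by rewrite sc ler_pdivlMr// ltW.
- move=> x xr; rewrite /tens big1// => k _.
  by rewrite mnm0E /q expr0 mul1r h1// sc ler_pdivrMr// mul1r.
- move=> b x; rewrite /tens normc_prod.
  apply: (@le_trans _ _ (\prod_k gev A (H * (1 + r^-1)) sg (b k))).
    apply: ler_prod => k _; rewrite normc_ge0 andTb normc_real /q normrM.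
    rewrite ger0_norm ?exprn_ge0//.
    apply: le_trans (ler_wpM2l (exprn_ge0 _ rV0) (hb _ _)) _.
    rewrite /gev mulrA; apply: ler_wpM2r; first exact: powR_ge0.
    rewrite mulrCA; apply: ler_wpM2l => //; rewrite mulrC -exprMn.
    apply: lerXn2r; rewrite ?nnegrE// ?mulr_ge0 ?addr_ge0//.
    by apply: ler_wpM2l => //; rewrite lerDr.
  have := @gev_prod A (H * (1 + r^-1)) sg (index_enum 'I_N) b A0.
  rewrite mdegE [X in _ ^+ X](_ : _ = N); last first.
    by rewrite -[index_enum _]enumT size_enum_ord.
  by apply; [rewrite mulr_ge0// addr_ge0|lra].
Qed.

End Cutoffs.

(** * Decay of localized Fourier transforms *)

Section DistributionBound.
Variables (R : realType) (N : nat).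
Local Notation E := 'rV[R]_N.
Local Notation C := (R[i]).
Local Notation dw f s := (foldr (@pderiv R N) f s).
Variables (Q : set E) (u : (E -> C) -> C).

Lemma distr_small (A0 : R) k (e : R) phi :
  (forall phi, test_on Q phi -> normc (u phi) <=
     A0 * \sum_(a : bmultinom N k.+1) sup (range (fun x => normc (mderiv a phi x)))) ->
  test_on Q phi -> (forall s x, (size s <= k)%N -> normc (dw phi s x) <= e) ->
  normc (u phi) <= `|A0| * (#|{: bmultinom N k.+1}|%:R * e).
Proof.
move=> hu tphi he; apply: le_trans (hu _ tphi) _.
(* [sup] returns a default value on unbounded sets; the bound [e] ensures that these are genuine
   suprema. *)
have S (i : bmultinom N k.+1) :
    0 <= sup (range (fun x => normc (mderiv i phi x))) <= e.
  have ub : ubound (range (fun x => normc (mderiv i phi x))) e.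
    move=> _ [x _ <-]; rewrite mderivE; apply: he.
    by rewrite size_mword -ltnS bmdeg.
  have ne : range (fun x => normc (mderiv i phi x)) !=set0.
    by exists (normc (mderiv i phi 0)); exists 0.
  apply/andP; split; last exact: ge_sup.
  apply: le_trans (ub_le_sup _ _); first exact: (normc_ge0 (mderiv i phi 0)).
    by exists e.
  by exists 0.
have S0 : 0 <= \sum_(i : bmultinom N k.+1) sup (range (fun x => normc (mderiv i phi x))).
  by apply: sumr_ge0 => i _; case/andP: (S i).
apply: le_trans (ler_wpM2r S0 (ler_norm A0)) _; apply: ler_wpM2l => //.
have H (i : bmultinom N k.+1) : true -> sup (range (fun x => normc (mderiv i phi x))) <= e.
  by move=> _; case/andP: (S i).
by apply: le_trans (ler_sum _ H) _; rewrite sumr_const -[_ *+ _]mulr_natl.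
Qed.

End DistributionBound.

(** * Exponentials weighted by derivatives of the cut-off *)

Section WeightedExponentials.
Variables (R : realType) (N : nat).
Local Notation C := (R[i]).
Local Notation E := 'rV[R]_N.
Local Notation dw := (foldr (@pderiv R N)).
Local Notation multi := (multinom N).
Variable chi : multi -> E -> C.
Hypothesis chi_pd : forall b, smooth setT (chi b) /\
  forall j (x : E), is_pd j (chi b) x (chi (mnm_add (mnm1 j) b) x).

Definition wexp (z : 'I_N -> C) b (x : E) : C := chi b x * expf z x.

Lemma smooth_wexp z b : smooth setT (wexp z b).
Proof. exact: (smoothM openT (chi_pd b).1 (smooth_expf z openT).1). Qed.

Lemma pderiv_wexp z b j : pderiv j (wexp z b) =
  fun x => wexp z (mnm_add (mnm1 j) b) x + z j * wexp z b x.
Proof.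
apply/funext => x; apply: is_pd_val.
apply: is_pd_eq (is_pdM ((chi_pd b).2 j x) (is_pd_expf j z x)) _.
by rewrite /wexp mulrCA.
Qed.

Lemma foldr_wexp z b s j (x : E) : dw (wexp z b) (rcons s j) x =
  dw (wexp z (mnm_add (mnm1 j) b)) s x + z j * dw (wexp z b) s x.
Proof.
rewrite foldr_rcons pderiv_wexp.
have h := smoothZ (z j) openT (smooth_wexp z b).
rewrite (foldrD openT s (smooth_wexp z (mnm_add (mnm1 j) b)) h I).
by rewrite (foldrZ openT (z j) s (smooth_wexp z b) I).
Qed.

(** Each letter falls either on the exponential, at cost [a], or on the cut-off, at cost [g]. The
    cap [L] is there because a Gevrey bound is geometric only up to a fixed order. *)
Lemma wexp_word_bound L (A g a : R) z (x : E) : 0 <= g -> 0 <= A -> 0 <= a ->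
  (forall j, normc (z j) <= a) -> normc (expf z x) <= 1 ->
  (forall b, (mdeg b <= L)%N -> normc (chi b x) <= A * g ^+ mdeg b) ->
  forall s b, (mdeg b + size s <= L)%N ->
  normc (dw (wexp z b) s x) <= (a + g) ^+ size s * (A * g ^+ mdeg b).
Proof.
move=> g0 A0 a0 za ez hc; elim/last_ind => [|s j IHs] b.
  rewrite addn0 expr0 mul1r => /hc h; rewrite /= /wexp Normc.normcM.
  rewrite -[leRHS]mulr1; apply: ler_pM => //; exact: normc_ge0.
rewrite size_rcons addnS => bL; rewrite foldr_wexp.
apply: le_trans (ler_normcD _ _) _; rewrite Normc.normcM.
have h1 : (mdeg (mnm_add (mnm1 j) b) + size s <= L)%N by rewrite mdegD mdeg1 add1n addSn.
have h2 : (mdeg b + size s <= L)%N by exact: ltnW.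
apply: le_trans (lerD (IHs _ h1) (ler_pM (normc_ge0 _) (normc_ge0 _) (za j) (IHs _ h2))) _.
rewrite mdegD mdeg1 add1n [g ^+ _.+1]exprS [(a + g) ^+ (size s).+1]exprS.
by rewrite le_eqVlt; apply/orP; left; apply/eqP; ring.
Qed.

Section Action.
Variables (U Q : set E) (u : (E -> C) -> C).
Hypothesis (uD : forall (c : C) phi psi, test_function U phi -> test_function U psi ->
     u (fun x => c * phi x + psi x) = c * u phi + u psi).
Hypothesis (cQ : compact Q) (QU : Q `<=` U).
Hypothesis chi0 : forall b x, ~ Q x -> chi b x = 0.

Lemma closed_Q : closed Q.
Proof. by apply: compact_closed => //; exact: norm_hausdorff. Qed.

Lemma test_wexp z b : test_on Q (wexp z b).
Proof.
split; first exact: smooth_wexp.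
by move=> x /chi0 h; rewrite /wexp h mul0r.
Qed.

Lemma test_wexp_word z b s : test_function U (dw (wexp z b) s).
Proof. by exists Q; split=> //; apply: test_on_foldr closed_Q (test_wexp z b). Qed.

(* Since [- d_j] sends the weighted exponential of index [b] to [- z j] times itself minus
   the one of index [b + e_j], transposed derivatives act as polynomials in [- z j - X_j],
   [X_j] being the shift of the index. *)
Lemma wexp_pairing z s b : (-1) ^+ size s * u (dw (wexp z b) s) =
  pairing (fun b' => u (wexp z (mnm_add b b'))) (\prod_(j <- s) linf (fun j => - z j) j).
Proof.
elim/last_ind: s b => [|s j IHs] b.
  rewrite big_nil pairing1 expr0 mul1r /=.
  by congr u; congr wexp; apply/mnmP => j; rewrite mnmDE mnm0E addn0.
have -> : dw (wexp z b) (rcons s j) = fun x => z j * dw (wexp z b) s x +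
    dw (wexp z (mnm_add (mnm1 j) b)) s x.
  by apply/funext => x; rewrite foldr_wexp addrC.
rewrite (uD _ (test_wexp_word z b s) (test_wexp_word z _ s)).
rewrite big_rcons /= mpoly_mulC linfE size_rcons exprS.
have dW : deg_le (size s) (\prod_(i <- s) linf (fun j => - z j) i).
  exact: deg_le_word.
have dX := @deg_leMX R N _ _ j dW.
have d1 := deg_le_leq (leqnSn _) (@deg_leZ R N _ (- z j) _ dW).
have d2 := @deg_leZ R N _ (-1) _ dX.
rewrite (pairingD _ d1 d2) (pairingZ _ _ dW) (pairingZ _ _ dX).
rewrite pairingMX -IHs.
have -> : (fun b' => u (wexp z (mnm_add b (mnm_add (mnm1 j) b')))) =
    (fun b' => u (wexp z (mnm_add (mnm_add (mnm1 j) b) b'))).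
  apply/funext => b'; congr u; congr wexp; apply/mnmP => k.
  by rewrite !mnmDE addnCA addnA.
by rewrite -IHs; ring.
Qed.

(** Summing [wexp_pairing] over the monomials of P, the transposed operator acts on the sequence of
    the [u (wexp z b)] as P(-z - X). The constant term P(-z) is what the recursion divides by. *)
Lemma diffop_wexp P z b : diffop_distr P u (wexp z b) =
  pairing (fun b' => u (wexp z (mnm_add b b'))) (taylor P (fun j => - z j)).
Proof.
rewrite taylorE.
have dP := @deg_le_msize R N P; set d := _.-1 in dP.
have dT a : deg_le d (mcoeff a P *: \prod_(j <- mword a) linf (fun j => - z j) j).
  have [ad|da] := leqP (mdeg a) d.
    apply: deg_leZ; apply: (@deg_le_leq R N (size (mword a))); last exact: deg_le_word.
    by rewrite size_mword.
  by rewrite (dP _ da) scale0r => b' _; rewrite mcoeff0.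
rewrite (pairing_sum _ (msupp P) dT).1.
apply: eq_bigr => a _; rewrite (@pairingZ R N (size (mword a))); last exact: deg_le_word.
rewrite -wexp_pairing.
by rewrite size_mword mderivE.
Qed.

Lemma wexp_trivial_bound (A0 : R) k :
  (forall phi, test_on Q phi -> normc (u phi) <=
     A0 * \sum_(a : bmultinom N k.+1) sup (range (fun x => normc (mderiv a phi x)))) ->
  forall L (A g a : R) z, 0 <= g -> 0 <= A -> 0 <= a ->
  (forall j, normc (z j) <= a) -> (forall x, normc (expf z x) <= 1) ->
  (forall b x, (mdeg b <= L)%N -> normc (chi b x) <= A * g ^+ mdeg b) ->
  forall b, (mdeg b + k <= L)%N -> normc (u (wexp z b)) <=
    `|A0| * #|{: bmultinom N k.+1}|%:R * (1 + a + g) ^+ k * (A * g ^+ mdeg b).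
Proof.
move=> hu L A g a z g0 A00 a0 za ez hc b bL.
have B0 : 0 <= (1 + a + g) ^+ k * (A * g ^+ mdeg b).
  by rewrite mulr_ge0 ?exprn_ge0 ?mulr_ge0 ?exprn_ge0// !addr_ge0.
rewrite -!mulrA; apply: (distr_small hu (test_wexp z b)) => s x sk.
have sL : (mdeg b + size s <= L)%N by rewrite (leq_trans _ bL)// leq_add2l.
apply: le_trans (wexp_word_bound g0 A00 a0 za (ez x) (hc^~ x) sL) _.
apply: ler_wpM2r; first by rewrite mulr_ge0 ?exprn_ge0.
apply: (@le_trans _ _ ((1 + a + g) ^+ size s)).
  by apply: lerXn2r; rewrite ?nnegrE ?addr_ge0//; lra.
by apply: ler_weXn2l => //; lra.
Qed.

End Action.
End WeightedExponentials.

Section SourceBound.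
Variables (R : realType) (N : nat).
Local Notation C := (R[i]).
Local Notation E := 'rV[R]_N.
Local Notation dw := (foldr (@pderiv R N)).
Local Notation multi := (multinom N).

Lemma mword_single (j : 'I_N) i : mword (mnm_muln (mnm1 j) i) = nseq i j.
Proof.
rewrite /mword.
have H (r : seq 'I_N) : uniq r ->
    flatten [seq nseq (mnm_muln (mnm1 j) i k) k | k <- r] = if j \in r then nseq i j else [::].
  elim: r => [//|k r IHr] /= /andP[kr ur]; rewrite (IHr ur) mulmnE mnm1E inE.
  have [jk|jk] := eqVneq j k; last by rewrite mul0n.
  by rewrite -jk in kr *; rewrite (negbTE kr) cats0 mul1n.
by rewrite H ?enum_uniq// mem_enum.
Qed.

Lemma normc_expf_imz (xi : 'I_N -> R) (x : E) : normc (expf (imz xi) x) = 1.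
Proof.
rewrite /expf normc_cexp Re_cdot /imz /=.
by rewrite big1 ?expR0// => j _; rewrite mul0r.
Qed.

(** [g] is smooth only on U; elsewhere the product is locally zero, as U and the complement of Q
    cover the space. *)
Lemma test_on_glue (U Q : set E) (g phi : E -> C) : open U -> closed Q -> Q `<=` U ->
  smooth U g -> test_on Q phi -> test_on Q (fun x => g x * phi x).
Proof.
move=> oU cQ QU sg [sphi phi0]; split; last by move=> x /phi0 ->; rewrite mulr0.
apply: smooth_local => x _; have [Ux|nUx] := pselect (U x).
  exists U; first exact: Ux.
  by apply: (smoothM oU sg); exact: (smooth_sub (@subsetT _ U) sphi).
have oQ : open (~` Q) by exact: closed_openC.
exists (~` Q); first by move=> /QU.
apply: (smooth_open oQ _ (smooth_cst 0 oQ)) => y /phi0 ->.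
by rewrite mulr0.
Qed.

Variable chi : multi -> E -> C.
Hypothesis chi_pd : forall b, smooth setT (chi b) /\
  forall j (x : E), is_pd j (chi b) x (chi (mnm_add (mnm1 j) b) x).
Variables (U Q : set E).
Hypothesis (oU : open U) (cQ : compact Q) (QU : Q `<=` U).
Hypothesis chi0 : forall b x, ~ Q x -> chi b x = 0.
Variables (b B : R).
Hypothesis (bB : b < B) (B0 : 0 < B) (Qb : Q `<=` @box R b N).
Variables (g : E -> C) (j : 'I_N) (K L : nat) (Cg hs A gg : R).
Hypothesis (sg : smooth U g) (Cg0 : 0 <= Cg) (A0 : 0 <= A) (hs0 : 0 <= hs) (gg0 : 0 <= gg).
Hypothesis gK : forall i x, (i <= K)%N -> Q x ->
  normc (dw g (nseq i j) x) <= Cg * hs ^+ i.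
Hypothesis chi_le : forall b x, (mdeg b <= L)%N -> normc (chi b x) <= A * gg ^+ mdeg b.

Lemma weighted_source_bound k i m x : Q x -> (i + k <= K)%N -> (mdeg m + k <= L)%N ->
  normc (dw (fun y => dw g (nseq i j) y * chi m y) (nseq k j) x) <=
  (hs + gg) ^+ k * (Cg * hs ^+ i * (A * gg ^+ mdeg m)).
Proof.
move=> Qx; have Ux := QU Qx; have schi a := smooth_sub (@subsetT _ U) (chi_pd a).1.
elim: k i m => [|k IHk] i m.
  rewrite !addn0 expr0 mul1r Normc.normcM /= => iK mL.
  by apply: ler_pM; rewrite ?normc_ge0 ?gK ?chi_le.
rewrite !addnS => ik mk.
have -> : nseq k.+1 j = rcons (nseq k j) j by elim: (k) => //= k' <-.
rewrite (foldrM oU _ _ (smooth_foldr (nseq i j) sg) (schi m) Ux).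
have -> : pderiv j (chi m) = chi (mnm_add (mnm1 j) m).
  by apply/funext => y; apply: is_pd_val; exact: (chi_pd m).2.
apply: le_trans (ler_normcD _ _) _.
have h1 := IHk i.+1 m; have h2 := IHk i (mnm_add (mnm1 j) m).
rewrite mdegD mdeg1 add1n in h2.
rewrite addSn in h1; rewrite addSn in h2.
apply: le_trans (lerD (h1 ik (ltnW mk)) (h2 (ltnW ik) mk)) _.
rewrite [hs ^+ _.+1]exprS [(hs + gg) ^+ _.+1]exprS [gg ^+ _.+1]exprS.
by rewrite le_eqVlt; apply/orP; left; apply/eqP; ring.
Qed.

(** K integrations by parts in the single variable [j] gain |xi_j|^K; later [j] is a coordinate
    where |xi_j| is comparable to |xi|, so that only pure derivatives of [g] occur. *)
Lemma source_bound (xi : 'I_N -> R) m : (mdeg m + K <= L)%N ->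
  normc (distr_of_fun g (wexp chi (imz xi) m)) * `|xi j| ^+ K <=
  2 * ((2 * B) ^+ N * ((hs + gg) ^+ K * (Cg * (A * gg ^+ mdeg m)))).
Proof.
move=> mK; pose G (x : E) := g x * chi m x.
have clQ : closed Q by apply: compact_closed => //; exact: norm_hausdorff.
have tG : test_on Q G.
  by apply: (test_on_glue oU clQ QU sg); split; [exact: (chi_pd m).1|exact: chi0].
have tGb : test_on (@box R b N) G.
  by split; [exact: tG.1|move=> x xb; apply: tG.2 => /Qb].
have -> : distr_of_fun g (wexp chi (imz xi) m) = cbint B (fun x => G x * expf (imz xi) x).
  rewrite -cintegral_rV_cbint; last first.
    move=> x xB; rewrite tGb.2 ?mul0r// => xb; apply: xB => k.
    by apply: le_trans (xb k) _; exact: ltW.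
  by congr cintegral_rV; apply/funext => x; rewrite /G /wexp mulrA.
have := fourier_parts_word B0 (imz xi) (nseq K j) bB tGb.
move=> /(congr1 (@normc R)); rewrite Normc.normcM normc_prod.
have -> : \prod_(i <- nseq K j) normc (- imz xi i) = `|xi j| ^+ K.
  rewrite big_nseq iter_mulr_1 normc_opp; congr (_ ^+ _).
  by rewrite /imz /= expr0n /= add0r sqrtr_sqr.
rewrite mulrC => <-.
apply: (cbint_le B0).
  apply: smooth_ccont; apply: (smoothM openT); first exact: smooth_foldr tG.1.
  exact: (smooth_expf _ openT).1.
move=> x _; rewrite Normc.normcM normc_expf_imz mulr1.
have [Qx|nQx] := pselect (Q x); last first.
  rewrite (test_on_foldr _ clQ tG).2// Normc.normc0.
  by rewrite !mulr_ge0 ?exprn_ge0 ?addr_ge0.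
have := @weighted_source_bound K 0 m x Qx; rewrite add0n expr0 mulr1; exact.
Qed.

End SourceBound.

(** * What the condition (Z) says about the symbol near -i xi *)

Section EllipticBounds.
Variables (R : realType) (N : nat).
Local Notation C := (R[i]).
Implicit Types (P : mpoly N C) (xi : 'I_N -> R) (z : 'I_N -> C).

Definition norm1 xi : R := \sum_j `|xi j|.

Definition zero_cond (s : R) P := exists Cz : R, forall z, meval z P = 0 ->
  (\sum_j normc (z j)) `^ s^-1 <= Cz * (1 + \sum_j `|complex.Re (z j)|).

Lemma powR_le (x y r : R) : 0 <= r -> 0 <= x -> x <= y -> x `^ r <= y `^ r.
Proof.
by move=> r0 x0 xy; apply: ge0_ler_powR; rewrite ?nnegrE// (le_trans x0).
Qed.

Lemma powR_large (mu M : R) : 0 < mu ->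
  exists2 R0 : R, 1 <= R0 & forall L, R0 <= L -> M <= L `^ mu.
Proof.
move=> mu0; exists ((1 + `|M|) `^ mu^-1).
  apply: (@le_trans _ _ (1 `^ mu^-1)); first by rewrite powR1.
  by apply: powR_le; rewrite ?ler01 ?lerDl// invr_ge0 ltW.
move=> L h; have M1 : 0 <= 1 + `|M| by rewrite addr_ge0.
apply: (@le_trans _ _ (1 + `|M|)); first by rewrite ler_wpDl// ler_norm.
have -> : 1 + `|M| = ((1 + `|M|) `^ mu^-1) `^ mu.
  by rewrite -powRrM mulVf ?gt_eqF// powRr1.
by apply: powR_le (ltW mu0) (powR_ge0 _ _) h.
Qed.

Lemma norm1_ge0 xi : 0 <= norm1 xi. Proof. by apply: sumr_ge0. Qed.

Lemma normc_imz xi j : normc (- imz xi j) = `|xi j|.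
Proof. by rewrite normc_opp /imz /= expr0n /= add0r sqrtr_sqr. Qed.

Lemma coord_le_norm1 xi j : `|xi j| <= norm1 xi.
Proof. by rewrite /norm1 (bigD1 j)//= lerDl; apply: sumr_ge0. Qed.

(** With L the norm of xi and v = L^(1/s), a zero in the polydisc would have real part at most N c v
    and modulus at least L/2. Then (Z) gives v/2 <= D (1 + N c v), impossible for large v if N c D
    <= 1/4. *)
Lemma zero_free_polydisc s P : 1 < s -> zero_cond s P ->
  exists c R0 : R, [/\ 0 < c, 1 <= R0 & forall xi, R0 <= norm1 xi ->
  1 <= c * norm1 xi `^ s^-1 /\
  forall w, (forall j, normc (w j) <= c * norm1 xi `^ s^-1) ->
    meval (fun j => - imz xi j - w j) P != 0].
Proof.
move=> s1 [Cz hZ]; have s0 : 0 < s by lra.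
have sV0 : 0 < s^-1 by rewrite invr_gt0.
have sV1 : s^-1 < 1 by rewrite invf_lt1.
pose D := `|Cz| + 1; have D1 : 1 <= D by rewrite lerDr.
pose n : R := N%:R; have n0 : 0 <= n by exact: ler0n.
pose c := (4 * (n + 1) * D)^-1.
have c0 : 0 < c by rewrite invr_gt0 !mulr_gt0//; lra.
have nc : n * c * D <= 4^-1.
  have -> : n * c * D = 4^-1 * (n / (n + 1)).
    have Dn : D != 0 by rewrite gt_eqF//; lra.
    have nn : n + 1 != 0 by rewrite gt_eqF//; lra.
    by rewrite /c; field; rewrite ?Dn ?nn.
  have : n / (n + 1) <= 1 by rewrite ler_pdivrMr; lra.
  by move: (n / _) => q; lra.
have nc' : n * c <= 4^-1.
  have : 0 <= n * c by rewrite mulr_ge0// ltW.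
  by move: nc; move: (n * c) => q; nra.
(* The summand 1/c makes the radius c v at least 1, and 4D + 1 refutes v/2 <= D + v/4. The threshold
   [R2] keeps the perturbation w below L/2. *)
have [R1 R11 h1] := powR_large (c^-1 + 4 * D + 1) sV0.
have [R2 R21 h2] := powR_large (2 * (n * c)) (etrans (subr_gt0 _ _) sV1).
exists c, (Num.max R1 R2); split => //; first by rewrite le_max R11.
move=> xi; rewrite ge_max => /andP[/h1 L1 /h2 L2].
set L := norm1 xi in L1 L2 *; set v := L `^ s^-1 in L1 *.
have L0 : 0 <= L by exact: norm1_ge0.
have cV0 : 0 < c^-1 by rewrite invr_gt0.
have v0 : 0 <= v by exact: powR_ge0.
split; first by rewrite mulrC -ler_pdivrMr// div1r; lra.
move=> w hw; apply/eqP => /hZ.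
have nL : 2 * (n * c) * v <= L.
  have e : L = L `^ (1 - s^-1) * v.
    rewrite /v -powRD; last first.
      by apply/implyP => _; apply: contraTneq v0 => L00; move: L1; rewrite /v L00 powR0 ?gt_eqF//; lra.
    by rewrite subrK powRr1.
  by rewrite [leRHS]e ler_wpM2r.
have sw : \sum_j normc (w j) <= n * (c * v).
  apply: le_trans (ler_sum _ (fun j _ => hw j)) _.
  by rewrite sumr_const card_ord -[_ *+ _]mulr_natl.
have lower : L / 2 <= \sum_j normc (- imz xi j - w j).
  have : L - \sum_j normc (w j) <= \sum_j normc (- imz xi j - w j).
    rewrite /L /norm1 -sumrB; apply: ler_sum => j _.
    rewrite lerBlDr -normc_imz.
    apply: le_trans (ler_normcD _ _).
    by rewrite subrK.
  have : n * (c * v) <= L / 2.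
    by rewrite ler_pdivlMr// mulrC; apply: le_trans nL; rewrite !mulrA.
  by move: sw; move: (n * _) (\sum_j _) (\sum_j _) => q q1 q2; lra.
have upper : \sum_j `|complex.Re (- imz xi j - w j)| <= n * (c * v).
  apply: le_trans sw; apply: ler_sum => j _.
  rewrite ReD !ReN /imz /= oppr0 sub0r normrN; exact: ler_Re_normc.
have half : v / 2 <= (L / 2) `^ s^-1.
  rewrite powRM// ?invr_ge0//; apply: ler_wpM2l => //.
  apply: ger1_powR; last exact: ltW.
  by rewrite invr_gt0 ltr0n /= invf_le1// ler1n.
have step : (L / 2) `^ s^-1 <= (\sum_j normc (- imz xi j - w j)) `^ s^-1.
  by apply: powR_le => //; [exact: ltW|rewrite divr_ge0].
move=> hz; have : v / 2 <= D * (1 + n * (c * v)).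
  apply: le_trans half _; apply: le_trans step _; apply: le_trans hz _.
  have t0 : 0 <= 1 + \sum_j `|complex.Re (- imz xi j - w j)|.
    by rewrite addr_ge0// sumr_ge0.
  apply: le_trans (ler_wpM2r t0 (_ : Cz <= D)) _.
    by rewrite /D ler_wpDr// ler_norm.
  by apply: ler_wpM2l; [lra|rewrite lerD2l].
have : n * c * D * v <= 4^-1 * v by exact: ler_wpM2r.
have -> : D * (1 + n * (c * v)) = D + n * c * D * v by ring.
by move: (n * c * D * v) L1 => q; lra.
Qed.

(** The last item, a polynomial lower bound on |P(-i xi)|, holds because rho >= 1 bounds every
    Taylor coefficient at -i xi by C0 |P(-i xi)|, while together these coefficients reproduce the
    fixed nonzero value [meval zs P]. *)
Lemma symbol_bounds s P : 1 < s -> zero_cond s P ->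
  exists (c C0 D R0 : R) (d : nat), [/\ 0 < c, 0 < C0, 1 <= R0, deg_le d P &
  forall xi, R0 <= norm1 xi ->
  let z0 j := - imz xi j in let rho := c * norm1 xi `^ s^-1 in
  [/\ 1 <= rho, 0 < normc (meval z0 P),
     forall b, normc (mcoeff b (taylor P z0)) * rho ^+ mdeg b <= C0 * normc (meval z0 P) &
     1 <= D * (1 + norm1 xi) ^+ d * normc (meval z0 P)]].
Proof.
move=> s1 hZ; have [c [R0 [c0 R01 hP]]] := zero_free_polydisc s1 hZ.
have dP := @deg_le_msize R N P; set d := _.-1 in dP.
have [C0 C00 hT] := taylor_coef_bound dP.
(* An identically vanishing P contradicts the zero-free polydisc at any large xi. The premise covers
   N = 0, where no xi is large. *)
have [zs hzs] : exists zs, (exists2 xi, R0 <= norm1 xi & True) -> meval zs P != 0.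
  have [[zs h]|/forallNP h] := pselect (exists zs, meval zs P != 0); first by exists zs.
  exists (fun=> 0) => -[xi hxi _]; have [_ /(_ (fun=> 0))] := hP xi hxi.
  have h0 (j : 'I_N) : normc (0 : C) <= c * norm1 xi `^ s^-1.
    by rewrite Normc.normc0 mulr_ge0 ?powR_ge0// ltW.
  by move=> /(_ h0) hh; case: (h _ hh).
pose Z := 1 + \sum_j normc (zs j).
have Z1 : 1 <= Z by rewrite lerDl sumr_ge0// => j _; exact: normc_ge0.
pose m : R := #|{: bmultinom N d.+1}|%:R.
exists c, C0, (m * C0 * Z ^+ d / normc (meval zs P)), R0, d; split=> // xi hxi z0 rho.
have [r1 nz] := hP xi hxi.
have r0 : 0 < rho by exact: lt_le_trans r1.
have T := hT z0 rho r0 nz.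
have Pz0 : meval z0 P != 0.
  have h0 (j : 'I_N) : normc (0 : C) <= rho by rewrite Normc.normc0 ltW.
  have := nz (fun=> 0) h0; rewrite (meval_eq (v2 := z0))// => j.
  by rewrite subr0.
split=> //; first by rewrite normc_gt0.
have zs0 : 0 < normc (meval zs P) by rewrite normc_gt0 hzs//; exists xi.
rewrite -[_ * _ * normc _]mulrA [leRHS]mulrAC ler_pdivlMr// mul1r.
have -> : meval zs P = meval (fun j => z0 j - zs j) (taylor P z0).
  by rewrite meval_taylor; apply: meval_eq => j; rewrite opprB addrC subrK.
rewrite meval_pairing (pairing_bmultinom _ (deg_le_taylor z0 dP)).
apply: le_trans (normc_sum _ _ _) _.
pose L := 1 + norm1 xi; have L1 : 1 <= L by rewrite lerDl norm1_ge0.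
have H (b : bmultinom N d.+1) : true ->
   normc (mcoeff b (taylor P z0) * \prod_j (z0 j - zs j) ^+ (b : multinom N) j) <=
   C0 * normc (meval z0 P) * (L * Z) ^+ d.
  move=> _; rewrite Normc.normcM; apply: ler_pM; try exact: normc_ge0.
    apply: le_trans (T b); rewrite ler_peMr ?normc_ge0//.
    exact: exprn_ege1.
  have LZ1 : 1 <= L * Z by rewrite -[leLHS]mulr1 ler_pM.
  apply: (@le_trans _ _ ((L * Z) ^+ mdeg (bmnm b))); last first.
    by apply: ler_weXn2l => //; rewrite -ltnS bmdeg.
  rewrite normc_prod mdegE expr_sum; apply: ler_prod => j _.
  rewrite normc_ge0 andTb normcX.
  apply: lerXn2r; rewrite ?nnegrE ?normc_ge0//; first by rewrite (le_trans ler01).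
  apply: le_trans (ler_normcD _ _) _; rewrite [normc (- zs j)]normc_opp /z0 normc_imz.
  have h1 := coord_le_norm1 xi j.
  have h2 : normc (zs j) <= Z - 1.
    by rewrite /Z addrAC subrr add0r (bigD1 j)//= lerDl sumr_ge0// => k _; exact: normc_ge0.
  have := norm1_ge0 xi; move: h1 h2 Z1; rewrite /L; clear; move: (norm1 _) (normc _) Z (`|_|) => a e f k k1 e1 f1 a1.
  have : 0 <= a * (f - 1) by rewrite mulr_ge0// subr_ge0.
  by rewrite mulrBr mulr1 mulrDl mul1r; lra.
apply: le_trans (ler_sum _ H) _.
rewrite sumr_const -[_ *+ _]mulr_natl -/m exprMn.
rewrite /L; clear; move: (_ ^+ d) (Z ^+ d) m (normc _) => l y n p.
by rewrite le_eqVlt; apply/orP; left; apply/eqP; ring.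
Qed.

End EllipticBounds.

(** * The descending recursion and the resulting decay *)

Section FourierDecay.
Variables (R : realType) (N : nat).
Local Notation C := (R[i]).
Local Notation E := 'rV[R]_N.
Local Notation dw := (foldr (@pderiv R N)).
Local Notation multi := (multinom N).

(* Induction on [K - |b|]: the bound at [|b| >= K] is transported down to [b = 0]. *)
Lemma downward (a : multi -> R) d K (C0 V : R) : 0 <= C0 -> 0 <= V ->
  (forall b, (K <= mdeg b <= K + d)%N -> a b <= V) ->
  (forall b, (mdeg b < K)%N -> a b <= V +
     C0 * \sum_(i : bmultinom N d.+1 | mdeg (bmnm i) != 0%N) a (mnm_add b (bmnm i))) ->
  a mnm0 <= V * (1 + C0 * #|{: bmultinom N d.+1}|%:R) ^+ K.
Proof.
move=> C00 V0 hi lo; set m : R := _%:R; have m0 : 0 <= m by exact: ler0n.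
have X1 : 1 <= 1 + C0 * m by rewrite lerDl mulr_ge0.
suff H n b : (mdeg b <= K + d)%N -> (K <= mdeg b + n)%N -> a b <= V * (1 + C0 * m) ^+ n.
  by apply: H; rewrite mdeg0.
elim: n b => [|n IHn] b bd bK.
  by rewrite expr0 mulr1; apply: hi; rewrite bd andbT -[mdeg b]addn0.
have [Kb|bK'] := leqP K (mdeg b).
  apply: le_trans (hi b _) _; first by rewrite Kb.
  by rewrite ler_peMr// exprn_ege1.
apply: le_trans (lo b bK') _.
have S : \sum_(i : bmultinom N d.+1 | mdeg (bmnm i) != 0%N) a (mnm_add b (bmnm i)) <=
    m * (V * (1 + C0 * m) ^+ n).
  have H (i : bmultinom N d.+1) : mdeg (bmnm i) != 0%N ->
      a (mnm_add b (bmnm i)) <= V * (1 + C0 * m) ^+ n.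
    move=> i0; have id : (mdeg (bmnm i) < d.+1)%N by exact: bmdeg.
    by apply: IHn; rewrite mdegD; lia.
  apply: le_trans (ler_sum _ H) _.
  rewrite sumr_const -[_ *+ _]mulr_natl; apply: ler_wpM2r.
    by rewrite mulr_ge0 ?exprn_ge0 ?addr_ge0 ?mulr_ge0.
  by rewrite /m ler_nat max_card.
apply: le_trans (lerD (lexx _) (ler_wpM2l C00 S)) _.
have Y1 : 1 <= (1 + C0 * m) ^+ n by exact: exprn_ege1.
rewrite exprS; move: (_ ^+ n) Y1 => Y Y1.
have : V * 1 <= V * Y by exact: ler_wpM2l.
have -> : C0 * (m * (V * Y)) = C0 * m * V * Y by rewrite !mulrA.
have -> : V * ((1 + C0 * m) * Y) = V * Y + C0 * m * V * Y by ring.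
by rewrite mulr1 lerD2r.
Qed.

Lemma fact_le_exp m n : (m <= n)%N -> (m`! <= n ^ m)%N.
Proof.
elim: m => [//|m IHm] mn; rewrite factS expnS.
by apply: leq_mul => //; apply: IHm; exact: ltnW.
Qed.

Lemma powRX (x sg : R) m : 0 <= x -> (x ^+ m) `^ sg = (x `^ sg) ^+ m.
Proof.
move=> x0; elim: m => [|m IHm]; first by rewrite !expr0 powR1.
by rewrite !exprS powRM ?exprn_ge0// IHm.
Qed.

Lemma gev_le_pow (A H sg : R) m n : 0 <= A -> 0 <= H -> 0 <= sg -> (m <= n)%N ->
  gev A H sg m <= A * (H * n%:R `^ sg) ^+ m.
Proof.
move=> A0 H0 sg0 mn; rewrite /gev -mulrA exprMn; apply: ler_wpM2l => //.
apply: ler_wpM2l; first exact: exprn_ge0.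
rewrite -powRX//; apply: powR_le => //.
by rewrite -natrX ler_nat; exact: fact_le_exp.
Qed.

Lemma compact_cube (x0 : E) (r : R) : compact [set x : E | forall k, `|x 0 k - x0 0 k| <= r].
Proof.
have := @rV_compact R N (fun k => `[x0 0 k - r, x0 0 k + r]%classic)
  (fun=> @segment_compact _ _ _).
by congr compact; apply/seteqP; split=> x /= H k; have := H k;
  rewrite /= in_itv /= ler_distl.
Qed.

Lemma large_coord (xi : 'I_N -> R) : 0 < norm1 xi ->
  exists j, norm1 xi / N.+1%:R <= `|xi j|.
Proof.
move=> L0; have [//|/forallNP h] := pselect (exists j, norm1 xi / N.+1%:R <= `|xi j|).
have : norm1 xi <= \sum_(j < N) (norm1 xi / N.+1%:R).
  by apply: ler_sum => j _; apply: ltW; rewrite ltNge; apply/negP/h.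
rewrite sumr_const card_ord -[_ *+ _]mulr_natl mulrA ler_pdivlMr ?ltr0n//.
by rewrite mulrC ler_pM2r// ler_nat ltnn.
Qed.

End FourierDecay.

Section DecayOfCoefficients.
Variables (R : realType) (N : nat).
Local Notation C := (R[i]).
Local Notation E := 'rV[R]_N.
Local Notation dw := (foldr (@pderiv R N)).
Local Notation multi := (multinom N).

(** Dividing [nc b] by rho^|b| turns the bound on the Taylor coefficients [nT] into the uniform
    constant C0 of [downward]. As g1 <= eta rho, both the starting values at |b| >= K and the source
    terms [nS] then carry a factor eta^K. *)
Lemma decay_recursion (nc nS nT : multi -> R) d K (C0 rho g1 eta p Dp W1 W2 : R) :
  0 <= C0 -> 1 <= rho -> 0 <= g1 -> 0 <= eta <= 1 -> g1 <= eta * rho ->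
  0 < p -> 0 <= Dp -> 1 <= Dp * p -> 0 <= W1 -> 0 <= W2 -> (forall b, 0 <= nc b) ->
  (forall b, p * nc b <= nS b + \sum_(i : bmultinom N d.+1 | mdeg (bmnm i) != 0%N)
      nT (bmnm i) * nc (mnm_add b (bmnm i))) ->
  (forall b, nT b * rho ^+ mdeg b <= C0 * p) ->
  (forall b, (mdeg b <= K + d)%N -> nc b <= W1 * g1 ^+ mdeg b) ->
  (forall b, (mdeg b < K)%N -> nS b <= W2 * g1 ^+ mdeg b * eta ^+ K) ->
  nc mnm0 <= (W1 + Dp * W2) * (eta * (1 + C0 * #|{: bmultinom N d.+1}|%:R)) ^+ K.
Proof.
move=> C00 rho1 g10 /andP[eta0 eta1] g1r p0 Dp0 Dp1 W10 W20 nc0 rel hT hi lo.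
have r0 : 0 < rho by exact: lt_le_trans rho1.
have rX n : 0 < rho ^+ n by exact: exprn_gt0.
have gr n : g1 ^+ n / rho ^+ n <= eta ^+ n.
  rewrite ler_pdivrMr// -exprMn; apply: lerXn2r => //; rewrite nnegrE//.
  by rewrite mulr_ge0// ltW.
have eX n : 0 <= eta ^+ n <= 1 by rewrite exprn_ge0// exprn_ile1.
pose a b := nc b / rho ^+ mdeg b.
have a0 : a mnm0 = nc mnm0 by rewrite /a mdeg0 expr0 divr1.
rewrite -a0 exprMn mulrA; apply: downward => //.
- by rewrite mulr_ge0 ?addr_ge0 ?mulr_ge0//; case/andP: (eX K).
- move=> b /andP[Kb bK]; rewrite /a.
  apply: (@le_trans _ _ (W1 * (g1 ^+ mdeg b / rho ^+ mdeg b))).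
    by rewrite mulrA ler_pM2r ?invr_gt0//; exact: hi.
  apply: (@le_trans _ _ (W1 * eta ^+ K)).
    apply: ler_wpM2l => //; apply: le_trans (gr _) _.
    by apply: ler_wiXn2l.
  apply: ler_wpM2r; first by case/andP: (eX K).
  by rewrite lerDl mulr_ge0.
move=> b bK.
have h1 : nc b <= p^-1 * (nS b + \sum_(i : bmultinom N d.+1 | mdeg (bmnm i) != 0%N)
      nT (bmnm i) * nc (mnm_add b (bmnm i))) by rewrite ler_pdivlMl.
have -> : a b = nc b * (rho ^+ mdeg b)^-1 by [].
have rV : 0 < (rho ^+ mdeg b)^-1 by rewrite invr_gt0.
apply: le_trans (ler_wpM2r (ltW rV) h1) _.
rewrite mulrDr mulrDl; apply: lerD.
  have pD : p^-1 <= Dp by rewrite -[p^-1]mul1r ler_pdivrMr.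
  apply: (@le_trans _ _ (Dp * (W2 * eta ^+ K))); last first.
    by rewrite mulrA; apply: ler_wpM2r; [case/andP: (eX K)|rewrite lerDr].
  apply: (@le_trans _ _ (p^-1 * (W2 * eta ^+ K))); last first.
    by apply: ler_wpM2r pD; rewrite mulr_ge0//; case/andP: (eX K).
  rewrite -mulrA; apply: ler_wpM2l; first by rewrite invr_ge0 ltW.
  rewrite ler_pdivrMr//; apply: le_trans (lo b bK) _.
  rewrite -[leRHS]mulrA -[leLHS]mulrA; apply: ler_wpM2l => //.
  rewrite mulrC; apply: ler_wpM2l; first by case/andP: (eX K).
  apply: lerXn2r; rewrite ?nnegrE ?(ltW r0)//; apply: le_trans g1r _.
  by rewrite ger_pMl.
rewrite !mulr_sumr mulr_suml; apply: ler_sum => i i0.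
rewrite /a mdegD exprD.
have h2 : nT (bmnm i) <= C0 * p / rho ^+ mdeg (bmnm i) by rewrite ler_pdivlMr.
have e1 : 0 <= nc (mnm_add b (bmnm i)) * (p^-1 * (rho ^+ mdeg b)^-1).
  by rewrite mulr_ge0// mulr_ge0// invr_ge0 ltW.
have := ler_wpM2r e1 h2; move: (nc _) => x.
have pn : p != 0 by rewrite gt_eqF.
have rn : rho ^+ mdeg b != 0 by rewrite gt_eqF.
have rn' : rho ^+ mdeg (bmnm i) != 0 by rewrite gt_eqF.
move: (nT _) (rho ^+ _) (rho ^+ _) rn rn' => T y z yn zn; congr (_ <= _).
  by field; rewrite pn yn.
by field; rewrite pn yn zn.
Qed.

End DecayOfCoefficients.

Section FourierDecayOfSolutions.
Variables (R : realType) (N : nat).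
Local Notation C := (R[i]).
Local Notation E := 'rV[R]_N.
Local Notation dw := (foldr (@pderiv R N)).
Local Notation multi := (multinom N).

Lemma gevrey_word (s : R) (U Q : set E) (g : E -> C) : 0 <= s ->
  gevrey s U g -> compact Q -> Q `<=` U ->
  exists A h : R, [/\ 0 < A, 0 < h & forall j K i x, (i <= K)%N -> Q x ->
    normc (dw g (nseq i j) x) <= A * (h * K%:R `^ s) ^+ i].
Proof.
move=> s0 [_ hg] cQ QU; have [A [h [A0 h0 hA]]] := hg Q cQ QU.
exists A, h; split=> // j K i x iK Qx.
have := hA (mnm_muln (mnm1 j) i) x Qx.
rewrite mderivE mword_single mdegMn mdeg1 mul1n => /le_trans; apply.
exact: (gev_le_pow (ltW A0) (ltW h0) s0 iK).
Qed.

(** The recursion at one frequency. The cut-off is differentiated at most 2K + d + k times: up to K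
    + d by the recursion and k more by the order of [u], and up to 2K in the source terms. *)
Lemma decay_at (chi : multi -> E -> C) (U Q : set E) (u : (E -> C) -> C) (g : E -> C)
    (P : mpoly N C) (xi : 'I_N -> R) (j : 'I_N) (K k d : nat)
    (A g1 A0 b B Cg hs C0 D rho eta : R) :
  (forall b, smooth setT (chi b) /\
    forall j (x : E), is_pd j (chi b) x (chi (mnm_add (mnm1 j) b) x)) ->
  open U -> compact Q -> Q `<=` U -> (forall b x, ~ Q x -> chi b x = 0) ->
  b < B -> 0 < B -> Q `<=` @box R b N ->
  (forall (c : C) phi psi, test_function U phi -> test_function U psi ->
     u (fun x => c * phi x + psi x) = c * u phi + u psi) ->
  (forall phi, test_on Q phi -> normc (u phi) <=
     A0 * \sum_(a : bmultinom N k.+1) sup (range (fun x => normc (Defs.mderiv a phi x)))) ->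
  smooth U g -> (forall phi, test_function U phi -> diffop_distr P u phi = distr_of_fun g phi) ->
  deg_le d P -> 0 <= A -> 0 <= g1 -> 0 <= Cg -> 0 <= hs -> 0 <= C0 -> 0 <= D ->
  (forall b x, (mdeg b <= 2 * K + d + k)%N -> normc (chi b x) <= A * g1 ^+ mdeg b) ->
  (forall i x, (i <= K)%N -> Q x -> normc (dw g (nseq i j) x) <= Cg * hs ^+ i) ->
  0 <= eta <= 1 -> g1 <= eta * rho -> 1 <= rho -> hs + g1 <= eta * `|xi j| -> 0 < `|xi j| ->
  let z0 j := - imz xi j in
  0 < normc (meval z0 P) ->
  (forall b, normc (mcoeff b (taylor P z0)) * rho ^+ mdeg b <= C0 * normc (meval z0 P)) ->
  1 <= D * normc (meval z0 P) ->
  normc (u (wexp chi (imz xi) mnm0)) <=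
   (`|A0| * #|{: bmultinom N k.+1}|%:R * (1 + norm1 xi + g1) ^+ k * A +
     D * (2 * ((2 * B) ^+ N * (Cg * A)))) *
   (eta * (1 + C0 * #|{: bmultinom N d.+1}|%:R)) ^+ K.
Proof.
move=> cpd oU cQ QU c0 bB B0 Qb uD uC sg Pu dP A00 g10 Cg0 hs0 C00 D0 cb gK eta01 g1r rho1
  hg1 xj0 z0 P0 hT hD.
have [eta0 _] := andP eta01.
have n1 := norm1_ge0 xi.
have W10 : 0 <= `|A0| * #|{: bmultinom N k.+1}|%:R * (1 + norm1 xi + g1) ^+ k * A.
  by rewrite !mulr_ge0 ?exprn_ge0// !addr_ge0.
have W20 : 0 <= 2 * ((2 * B) ^+ N * (Cg * A)).
  by rewrite !mulr_ge0 ?exprn_ge0// mulr_ge0// ltW.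
pose nc m := normc (u (wexp chi (imz xi) m)).
pose nS m := normc (distr_of_fun g (wexp chi (imz xi) m)).
pose nT m := normc (mcoeff m (taylor P z0)).
apply: (@decay_recursion R N nc nS nT d K C0 rho g1 eta _ D _ _
  C00 rho1 g10 eta01 g1r P0 D0 hD W10 W20 _ _ hT).
- by move=> m; exact: normc_ge0.
- move=> m; have tw := test_wexp_word cpd cQ QU c0 (imz xi) m [::].
  have := diffop_wexp cpd uD cQ QU c0 P (imz xi) m.
  rewrite (Pu _ tw) (pairing_bmultinom _ (deg_le_taylor z0 dP)).
  have md : (mdeg (@mnm0 N) < d.+1)%N by rewrite mdeg0.
  rewrite (bigD1 (BMultinom md))//= mcoeff0_taylor.
  have -> : mnm_add m mnm0 = m by apply/mnmP => i; rewrite mnmDE mnm0E addn0.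
  move=> e; rewrite /nc -Normc.normcM.
  have -> : meval z0 P * u (wexp chi (imz xi) m) = distr_of_fun g (wexp chi (imz xi) m) -
     \sum_(i | i != BMultinom md) mcoeff (bmnm i) (taylor P z0) *
       u (wexp chi (imz xi) (mnm_add m (bmnm i))) by rewrite e addrK.
  apply: le_trans (ler_normcD _ _) _; rewrite normc_opp; apply: lerD => //.
  apply: le_trans (normc_sum _ _ _) _.
  rewrite le_eqVlt; apply/orP; left; apply/eqP.
  apply: eq_big => [i|i _]; last exact: Normc.normcM.
  by rewrite mdeg_eq0 -val_eqE.
- move=> m mK; rewrite /nc -[leRHS]mulrA.
  apply: (wexp_trivial_bound cpd c0 uC g10 A00 n1 _ _ cb).
  + by move=> i; rewrite -normc_opp normc_imz coord_le_norm1.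
  + by move=> x; rewrite normc_expf_imz.
  + by rewrite leq_add2r (leq_trans mK)// leq_add2r mul2n -addnn leq_addr.
move=> m mK.
have mL : (mdeg m + K <= 2 * K + d + k)%N.
  apply: leq_trans (leq_addr _ _); apply: leq_trans (leq_addr _ _).
  by rewrite mul2n -addnn leq_add2r ltnW.
have := source_bound cpd oU cQ QU c0 bB B0 Qb sg Cg0 A00 hs0 g10 gK cb xi mL.
rewrite -ler_pdivlMr ?exprn_gt0// => /le_trans; apply.
rewrite ler_pdivrMr ?exprn_gt0// -[leRHS]mulrA -exprMn.
have : (hs + g1) ^+ K <= (eta * `|xi j|) ^+ K.
  by apply: lerXn2r; rewrite ?nnegrE ?addr_ge0// mulr_ge0.
have V0 : 0 <= 2 * ((2 * B) ^+ N * (Cg * A)) * g1 ^+ mdeg m by rewrite mulr_ge0 ?exprn_ge0.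
move=> /(ler_wpM2l V0); congr (_ <= _).
by move: (_ ^+ K) ((2 * B) ^+ N) (g1 ^+ _) => x y z; ring.
Qed.

End FourierDecayOfSolutions.

Section FourierDecayAsymptotics.
Variables (R : realType) (N : nat).
Local Notation C := (R[i]).
Local Notation E := 'rV[R]_N.
Local Notation dw := (foldr (@pderiv R N)).

Definition cube (x0 : E) (r : R) : set E := [set x : E | forall k, `|x 0 k - x0 0 k| <= r].

Lemma cube_box (x0 : E) (r : R) : 0 < r ->
  exists2 b, 0 < b & cube x0 r `<=` @box R b N.
Proof.
move=> r0; exists (r + \sum_k `|x0 0 k|).
  by apply: ltr_wpDr => //; apply: sumr_ge0.
move=> x hx k; rewrite -[x 0 k](subrK (x0 0 k)).
apply: le_trans (ler_normD _ _) _; apply: lerD; first exact: hx.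
by rewrite (bigD1 k)//= lerDl; apply: sumr_ge0.
Qed.

Lemma powR_split (L a b : R) : 1 <= L -> L `^ a * L `^ b = L `^ (a + b).
Proof.
move=> L1; rewrite powRD//; apply/implyP => _.
by rewrite gt_eqF// (lt_le_trans ltr01).
Qed.

(** [K] stays a free parameter here; [decay_gevrey] takes it as large as allowed. *)
Lemma fourier_decay (U : set E) (u : (E -> C) -> C) (g : E -> C) (P : mpoly N C)
    (s t : R) (x0 : E) (r : R) :
  1 < s -> s < t -> 0 < r -> open U -> Defs.distribution U u -> gevrey s U g ->
  (forall phi, test_function U phi -> diffop_distr P u phi = distr_of_fun g phi) ->
  zero_cond s P -> cube x0 (3 * r) `<=` U ->
  exists chi : E -> C, [/\ test_on (cube x0 (3 * r)) chi,
    forall x, cube x0 r x -> chi x = 1 &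
    exists (A delta : R) (M : nat), [/\ 0 <= A, 0 < delta &
      forall (xi : 'I_N -> R) (K : nat), K%:R <= delta * norm1 xi `^ t^-1 ->
      normc (u (fun x => chi x * expf (imz xi) x)) <=
        A * (1 + norm1 xi) ^+ M * 2 ^- K]].
Proof.
move=> s1 st r0 oU [uD uC] gg Pu hZ QU.
have s0 : 0 < s by lra. have t0 : 0 < t by lra. have t1 : 1 < t by lra.
pose sg := t / s; have sg1 : 1 < sg by rewrite ltr_pdivlMr// mul1r.
have sg0 : 0 < sg by exact: lt_trans sg1.
have sgt : t^-1 * sg = s^-1 by rewrite /sg mulrA mulVf ?mul1r// gt_eqF.
have [chi [A [H [[A0 H1] cpd c0 c1 cb]]]] := cutoff_exists x0 sg1 r0.
set Q := cube x0 (3 * r) in QU *.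
have cQ : compact Q by exact: compact_cube.
have c0' b x : ~ Q x -> chi b x = 0 by exact: c0.
have [b b0 Qb] : exists2 b, 0 < b & Q `<=` @box R b N by apply: cube_box; exact: mulr_gt0.
have [A1 [k uk]] := uC Q cQ QU.
have [Cg [hg [Cg0 hg0 gK]]] := gevrey_word (ltW s0) gg cQ QU.
have [c [C0 [D [R0 [d [c_gt0 C00 R01 dP hS]]]]]] := symbol_bounds s1 hZ.
have [m m0 mE] : exists2 m : R, 0 <= m & #|{: bmultinom N d.+1}|%:R = m.
  by exists #|{: bmultinom N d.+1}|%:R; rewrite ?ler0n.
have [mk mk0 mkE] : exists2 m : R, 0 <= m & #|{: bmultinom N k.+1}|%:R = m.
  by exists #|{: bmultinom N k.+1}|%:R; rewrite ?ler0n.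
pose C2 := 1 + C0 * m; have C21 : 1 <= C2 by rewrite lerDl mulr_ge0// ltW.
(* Chosen so that the factor eta (1 + C0 m) of [decay_at] is 1/2. *)
pose eta := (2 * C2)^-1.
have eta0 : 0 < eta by rewrite invr_gt0 mulr_gt0//; lra.
have eta1 : eta <= 1 by rewrite invf_le1; [lra|lra].
have etaC : eta * C2 = 2^-1.
  by rewrite /eta invfM -mulrA mulVf ?mulr1// gt_eqF//; lra.
have H0 : 0 < H by lra.
(* As 3 dl <= 1, also (3 dl)^(t/s) <= 3 dl, and H (3 dl) <= eta c then gives g1 <= eta rho. *)
pose dl := Num.min 3^-1 (eta * c / (3 * H)).
have dl0 : 0 < dl.
  by rewrite lt_min invr_gt0 ltr0n /= divr_gt0// ?mulr_gt0//; lra.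
have dl3 : 3 * dl <= 1.
  have : dl <= 3^-1 by rewrite ge_min lexx.
  by lra.
have dl30 : 0 < 3 * dl by exact: mulr_gt0.
have dl1 : dl <= 1 by lra.
have dlH : H * (3 * dl) <= eta * c.
  have : dl <= eta * c / (3 * H) by rewrite ge_min lexx orbT.
  rewrite ler_pdivlMr; last lra.
  by have -> : H * (3 * dl) = dl * (3 * H) by ring.
pose B := b + 1; have bB : b < B by rewrite ltrDl.
have B0 : 0 < B by exact: lt_trans bB.
pose n : R := N.+1%:R; have n0 : 0 < n by exact: ltr0Sn.
have tV0 : 0 < t^-1 by rewrite invr_gt0.
have sV0 : 0 < s^-1 by rewrite invr_gt0.
have mu1 : 0 < 1 - s^-1 by rewrite subr_gt0 invf_lt1.
have mu2 : 0 < 1 - s / t by rewrite subr_gt0 ltr_pdivrMr// mul1r.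
(* [R2] makes d + k negligible, so that 2K + d + k <= 3 dl |xi|^(1/t). [R3] and [R4] make [g1] and
   [hs] each at most half of the bound on eta |xi_j|. *)
have [R2 R21 h2] := powR_large ((d + k)%:R / dl) tV0.
have [R3 R31 h3] := powR_large (2 * n * c) mu1.
have [R4 R41 h4] := powR_large (2 * n * hg / eta) mu2.
pose R5 := Num.max (Num.max R0 R2) (Num.max R3 R4).
(* For |xi| below [R5] no admissible K exceeds K0, and the trivial bound [T0] times 2^K0
   suffices. *)
pose K0 := Num.trunc (dl * R5 `^ t^-1).
pose T0 := `|A1| * mk * (1 + R5 + H * k%:R `^ sg) ^+ k * A.
pose V0 := 2 * ((2 * B) ^+ N * (Cg * A)).
pose T1 := `|A1| * mk * 2 ^+ k * A.
have R51 : 1 <= R5 by rewrite /R5 !le_max R01.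
have T00 : 0 <= T0.
  rewrite !mulr_ge0 ?exprn_ge0// addr_ge0//; first by lra.
  by rewrite mulr_ge0 ?powR_ge0// ltW.
have T10 : 0 <= T1 by rewrite !mulr_ge0 ?exprn_ge0.
have V00 : 0 <= V0 by rewrite !mulr_ge0 ?exprn_ge0// ?mulr_ge0// ltW.
exists (chi mnm0); split.
- by split; [exact: (cpd _).1|exact: c0'].
- by move=> x hx; exact: c1.
exists (T0 * 2 ^+ K0 + T1 + `|D| * V0), dl, (k + d)%N; split=> //.
  by rewrite !addr_ge0// mulr_ge0.
move=> xi K; set L := norm1 xi => hK.
have L0 : 0 <= L by exact: norm1_ge0.
have L1M i : 1 <= (1 + L) ^+ i by rewrite exprn_ege1// lerDl.
have K2 : 0 < 2 ^- K :> R by rewrite invr_gt0 exprn_gt0.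
have fin X : X <= (T0 * 2 ^+ K0 + T1 + `|D| * V0) * 2 ^- K ->
   X <= (T0 * 2 ^+ K0 + T1 + `|D| * V0) * (1 + L) ^+ (k + d) * 2 ^- K.
  move=> /le_trans; apply; apply: ler_wpM2r; first exact: ltW.
  by rewrite ler_peMr// !addr_ge0// mulr_ge0// exprn_ge0.
have [LR|RL] := ltP L R5.
  apply: fin; apply: (@le_trans _ _ T0).
    have g0 : 0 <= H * k%:R `^ sg by rewrite mulr_ge0 ?powR_ge0// ltW.
    have cb' b' x : (mdeg b' <= k)%N -> normc (chi b' x) <= A * (H * k%:R `^ sg) ^+ mdeg b'.
      by move=> h; exact: le_trans (cb b' x) (gev_le_pow A0 (ltW H0) (ltW sg0) h).
    have := @wexp_trivial_bound R N chi cpd Q u c0' A1 k uk k A (H * k%:R `^ sg) L (imz xi)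
      g0 A0 L0 _ _ cb' mnm0.
    rewrite mdeg0 expr0 mulr1 mkE => h; apply: le_trans (h _ _ _) _ => //.
    - by move=> i; rewrite -normc_opp normc_imz coord_le_norm1.
    - by move=> x; rewrite normc_expf_imz.
    rewrite /T0; apply: ler_wpM2r => //; apply: ler_wpM2l; first exact: mulr_ge0.
    apply: lerXn2r; rewrite ?nnegrE ?addr_ge0 ?ler01//; first by lra.
    by rewrite lerD2r lerD2l ltW.
  have KK0 : (K <= K0)%N.
    have R5p : 0 <= dl * R5 `^ t^-1 by rewrite mulr_ge0 ?powR_ge0// ltW.
    have /andP[_ lt0] := truncn_itv R5p.
    rewrite -ltnS -(ltr_nat R); apply: le_lt_trans lt0; apply: le_trans hK _.
    by apply: ler_wpM2l; [exact: ltW|apply: powR_le (ltW tV0) L0 (ltW LR)].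
  rewrite ler_pdivlMr ?exprn_gt0//.
  apply: (@le_trans _ _ (T0 * 2 ^+ K0)); last by rewrite -addrA lerDl addr_ge0// mulr_ge0.
  by apply: ler_wpM2l => //; rewrite ler_weXn2l// ler1n.
have L1 : 1 <= L by exact: le_trans RL.
have [LR0 LR2 LR3 LR4] : [/\ R0 <= L, R2 <= L, R3 <= L & R4 <= L].
  by move: RL; rewrite !ge_max => /andP[/andP[-> ->] /andP[-> ->]].
have [rho1 P0 hT hD] := hS xi LR0.
have {}h2 := h2 L LR2. have {}h3 := h3 L LR3. have {}h4 := h4 L LR4.
rewrite -/L in rho1 hT hD.
set y := L `^ t^-1 in h2 hK.
have y0 : 0 <= y by exact: powR_ge0.
have ysg : y `^ sg = L `^ s^-1 by rewrite /y -powRrM sgt.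
pose g1 := H * (2 * K + d + k)%:R `^ sg.
have dkK : (2 * K + d + k)%:R <= 3 * dl * y.
  have : (d + k)%:R <= dl * y by rewrite mulrC -ler_pdivrMr.
  rewrite -addnA (natrD _ (2 * K)) (natrM _ 2); move: (d + k)%:R => q hq.
  rewrite -[3 * dl * y]mulrA; move: hq hK; move: (dl * y) => w hq hK'; lra.
have v0 : 0 <= L `^ s^-1 by exact: powR_ge0.
have g1r : g1 <= eta * (c * L `^ s^-1).
  rewrite /g1; apply: (@le_trans _ _ (H * (3 * dl * y) `^ sg)).
    by apply: ler_wpM2l (powR_le (ltW sg0) (ler0n _ _) dkK); exact: ltW.
  rewrite powRM ?(ltW dl30)//; rewrite ysg !mulrA; apply: ler_wpM2r => //; apply: le_trans dlH.
  apply: ler_wpM2l; first exact: ltW.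
  by apply: ge1r_powR; [rewrite dl30|exact: ltW].
have g10 : 0 <= g1 by rewrite mulr_ge0 ?powR_ge0// ltW.
have [j hj] := large_coord (lt_le_trans ltr01 L1).
rewrite -/L -/n in hj.
have xj0 : 0 < `|xi j| by apply: lt_le_trans hj; rewrite divr_gt0// (lt_le_trans ltr01).
pose hs := hg * K%:R `^ s.
have hs0 : 0 <= hs by rewrite mulr_ge0 ?powR_ge0// ltW.
have vL : 2 * n * c * L `^ s^-1 <= L.
  apply: le_trans (ler_wpM2r v0 h3) _.
  by rewrite powR_split// subrK powRr1.
have hsL : 2 * n * hg / eta * L `^ (s / t) <= L.
  apply: le_trans (ler_wpM2r (powR_ge0 _ _) h4) _.
  by rewrite powR_split// subrK powRr1.
have Ks : K%:R `^ s <= L `^ (s / t).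
  rewrite mulrC powRrM; apply: (powR_le (ltW s0) (ler0n _ _)).
  apply: le_trans hK _; rewrite -/y.
  by rewrite -[leRHS]mul1r; exact: ler_wpM2r.
have hs1 : hs + g1 <= eta * `|xi j|.
  have e1 : c * L `^ s^-1 <= L / (2 * n).
    by rewrite ler_pdivlMr ?mulr_gt0// mulrC mulrA.
  have e2 : hs <= eta * (L / (2 * n)).
    rewrite mulrA ler_pdivlMr ?mulr_gt0//.
    have -> : eta * L = L * eta by rewrite mulrC.
    rewrite -ler_pdivrMr//; apply: le_trans hsL.
    apply: (@le_trans _ _ (2 * n * hg / eta * K%:R `^ s)).
      by rewrite /hs le_eqVlt; apply/orP; left; apply/eqP; ring.
    by apply: ler_wpM2l => //; rewrite divr_ge0 ?mulr_ge0// ltW.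
  have e3 : g1 <= eta * (L / (2 * n)).
    by apply: le_trans g1r _; apply: ler_wpM2l e1; exact: ltW.
  apply: (@le_trans _ _ (eta * (L / n))); last by apply: ler_wpM2l hj; exact: ltW.
  apply: le_trans (lerD e2 e3) _.
  have -> : L / n = L / (2 * n) + L / (2 * n) by field; rewrite gt_eqF.
  by rewrite mulrDr.
have cb' b' x : (mdeg b' <= 2 * K + d + k)%N -> normc (chi b' x) <= A * g1 ^+ mdeg b'.
  by move=> h; exact: le_trans (cb b' x) (gev_le_pow A0 (ltW H0) (ltW sg0) h).
have e01 : 0 <= eta <= 1 by rewrite ltW.
have hD' : 1 <= `|D| * (1 + L) ^+ d * normc (meval (fun j => - imz xi j) P).
  apply: le_trans hD _; apply: ler_wpM2r; first exact: normc_ge0.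
  by apply: ler_wpM2r; [rewrite exprn_ge0// addr_ge0|exact: ler_norm].
have DL0 : 0 <= `|D| * (1 + L) ^+ d by rewrite mulr_ge0// exprn_ge0// addr_ge0.
have main := decay_at cpd oU cQ QU c0' bB B0 Qb uD uk gg.1 Pu dP A0 g10 (ltW Cg0) hs0
   (ltW C00) DL0 cb' (fun i x => gK j K i x) e01 g1r rho1 hs1 xj0 P0 hT hD'.
apply: le_trans main _; rewrite mE mkE -/C2 etaC -/L -/V0 exprVn.
apply: ler_wpM2r; first exact: ltW.
have LM0 : 0 <= (1 + L) ^+ (k + d) by rewrite exprn_ge0// addr_ge0.
rewrite -[T0 * _ + T1 + _]addrA mulrDl; apply: ler_wpDl.
  by rewrite mulr_ge0// mulr_ge0// exprn_ge0.
rewrite mulrDl; apply: lerD.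
  have g1L : g1 <= L.
    have n1 : 1 <= 2 * n by rewrite /n -natrM ler1n.
    have : c * L `^ s^-1 <= L.
      apply: le_trans vL; rewrite -[_ * _ * _ * _]mulrA; apply: ler_peMl => //.
      by rewrite mulr_ge0// ltW.
    move=> h; apply: le_trans g1r _; apply: le_trans h.
    by rewrite ger_pMl// (lt_le_trans ltr01).
  have : (1 + L + g1) ^+ k <= 2 ^+ k * (1 + L) ^+ (k + d).
    apply: (@le_trans _ _ ((2 * (1 + L)) ^+ k)).
      have q0 : 0 <= 1 + L + g1 by rewrite !addr_ge0.
      have q1 : 1 + L + g1 <= 2 * (1 + L).
        by rewrite mulr_natl mulr2n lerD2l ler_wpDl.
      by apply: lerXn2r => //; rewrite nnegrE// (le_trans q0).
    rewrite exprMn; apply: ler_wpM2l; first exact: exprn_ge0.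
    by rewrite exprD ler_peMr// exprn_ge0// addr_ge0.
  have Z0 : 0 <= `|A1| * mk * A by rewrite !mulr_ge0.
  move=> /(ler_wpM2l Z0); rewrite /T1; clear; congr (_ <= _).
    by move: (_ ^+ _) => a1; ring.
  by move: ((1 + L) ^+ _) (2 ^+ _) => a1 a2; ring.
rewrite mulrAC; apply: ler_wpM2l; first by rewrite mulr_ge0.
by rewrite exprD ler_peMl// exprn_ge0// addr_ge0.
Qed.

End FourierDecayAsymptotics.

Section GevreyDecay.
Variables (R : realType) (N : nat).

Lemma bin_le_exp2 n k : ('C(n, k) <= 2 ^ n)%N.
Proof.
elim: n k => [|n IHn] [|k]; rewrite ?bin0 ?expn_gt0//.
by rewrite binS expnS mul2n -addnn leq_add.
Qed.

Lemma fact_add_le n m : ((n + m)`! <= 2 ^ (n + m) * (n`! * m`!))%N.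
Proof.
rewrite -(@bin_fact (n + m) n) ?leq_addr// addKn.
by rewrite leq_mul2r bin_le_exp2 orbT.
Qed.

(** Because (n+m)! <= 2^(n+m) n! m!: a fixed number of extra derivatives or powers is absorbed by
    the constants. *)
Lemma gev_shift (A h t : R) m : 0 <= A -> 0 <= h -> 0 <= t ->
  exists A' h' : R, [/\ 0 <= A', 0 <= h' & forall n, gev A h t (n + m) <= gev A' h' t n].
Proof.
move=> A0 h0 t0; pose Y := h * 2 `^ t.
have Y0 : 0 <= Y by rewrite mulr_ge0 ?powR_ge0.
exists (A * Y ^+ m * (m`!)%:R `^ t), Y; split=> //.
  by rewrite !mulr_ge0 ?exprn_ge0 ?powR_ge0.
move=> n; rewrite /gev.
have : (n + m)`!%:R `^ t <= (2 `^ t) ^+ (n + m) * (n`!%:R `^ t * m`!%:R `^ t) :> R.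
  rewrite -powRX// -powRM// -powRM ?exprn_ge0//; apply: powR_le => //.
  by rewrite -natrX -!natrM ler_nat fact_add_le.
have Ah : 0 <= A * h ^+ (n + m) by rewrite mulr_ge0 ?exprn_ge0.
move=> /(ler_wpM2l Ah) /le_trans; apply.
rewrite le_eqVlt; apply/orP; left; apply/eqP.
rewrite /Y !exprMn !exprD; move: (2 `^ t) (_ `^ t) (_ `^ t) => a b c.
by ring.
Qed.

(** With K the integer part of a multiple of |xi|^(1/t), 2^-K is exponentially small in |xi|^(1/t),
    and the t-th power of x^m <= m! e^x gives the factor m!^t. The M extra powers go through
    [gev_shift]. *)
Lemma decay_gevrey (c : ('I_N -> R) -> R) (A delta t : R) M : 1 < t -> 0 <= A -> 0 < delta ->
  (forall xi K, K%:R <= delta * norm1 xi `^ t^-1 ->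
     c xi <= A * (1 + norm1 xi) ^+ M * 2 ^- K) ->
  exists A' h : R, [/\ 0 <= A', 0 <= h &
    forall n xi, c xi * (1 + norm1 xi) ^+ n <= gev A' h t n].
Proof.
move=> t1 A0 d0 hc; have t0 : 0 < t by lra.
pose dl := Num.min delta 1.
have dl0 : 0 < dl by rewrite lt_min d0 ltr01.
have dl1 : dl <= 1 by rewrite ge_min lexx orbT.
have dld : dl <= delta by rewrite ge_min lexx.
(* The t-th power of e^(b(K+1)) is 2^(K+1), which the factor 2^-K cancels. *)
pose b : R := ln 2 / t.
have ln20 : 0 < ln 2 :> R by rewrite ln_gt0// ltr1n.
have b0 : 0 < b by rewrite divr_gt0.
have eb : expR b `^ t = 2 by rewrite -expRM /b divfK ?gt_eqF// lnK// posrE.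
pose Y := 2 * (dl * b)^-1 `^ t.
have db0 : 0 < dl * b by exact: mulr_gt0.
have Y0 : 0 <= Y by rewrite mulr_ge0 ?powR_ge0.
have A20 : 0 <= A * 2 by rewrite mulr_ge0.
have [A' [h' [A'0 h'0 hsh]]] := gev_shift M A20 Y0 (ltW t0).
exists A', h'; split=> // n xi; apply: le_trans (hsh n).
set L := norm1 xi; have L0 : 0 <= L by exact: norm1_ge0.
pose y := L `^ t^-1; have y0 : 0 <= y by exact: powR_ge0.
have yt : y `^ t = L by rewrite /y -powRrM mulVf ?gt_eqF// powRr1.
have dy0 : 0 <= dl * y by rewrite mulr_ge0// ltW.
have /andP[Kl Ku] := truncn_itv dy0; set K := Num.trunc _ in Kl Ku.
have cK : c xi <= A * (1 + L) ^+ M * 2 ^- K.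
  by apply: hc; apply: le_trans Kl _; exact: ler_wpM2r.
pose z : R := K.+1%:R / dl.
have z1 : 1 <= z by rewrite ler_pdivlMr// mul1r (le_trans dl1)// ler1n.
have z0 : 0 <= z by exact: le_trans z1.
have zt1 : 1 <= z `^ t.
  by apply: le_trans z1 (le1r_powR z1 (ltW t1)).
have Lz : 1 + L <= 2 * z `^ t.
  have : L <= z `^ t.
    by rewrite -yt; apply: powR_le (ltW t0) y0 _; rewrite ler_pdivlMr// mulrC ltW.
  by rewrite mulr_natl mulr2n; exact: lerD.
have Km m : z ^+ m <= m`!%:R * ((dl * b)^-1 ^+ m * expR b ^+ K.+1).
  have e1 : z = (dl * b)^-1 * (b * K.+1%:R).
    have dn : dl != 0 by rewrite gt_eqF.
    have bn : b != 0 by rewrite gt_eqF.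
    by rewrite /z; move: (K.+1%:R) => w; field; rewrite dn bn.
  rewrite e1 exprMn [leRHS]mulrCA; apply: ler_wpM2l; first by rewrite exprn_ge0// invr_ge0 ltW.
  by rewrite -expRM_natr; apply: expr_fact_le; rewrite mulr_ge0// ltW.
have main m : (1 + L) ^+ m <= 2 * 2 ^+ K * (Y ^+ m * m`!%:R `^ t).
  apply: (@le_trans _ _ ((2 * z `^ t) ^+ m)).
    by apply: lerXn2r; rewrite ?nnegrE// ?addr_ge0// mulr_ge0 ?powR_ge0.
  rewrite exprMn -powRX//.
  apply: (@le_trans _ _ (2 ^+ m * (m`!%:R * ((dl * b)^-1 ^+ m * expR b ^+ K.+1)) `^ t)).
    apply: ler_wpM2l; first exact: exprn_ge0.
    by apply: powR_le (ltW t0) _ (Km m); exact: exprn_ge0.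
  have v0 : 0 <= (dl * b)^-1 by rewrite invr_ge0 ltW.
  rewrite powRM ?mulr_ge0 ?exprn_ge0 ?expR_ge0// powRM ?exprn_ge0 ?expR_ge0//.
  rewrite [(expR b ^+ _) `^ t]powRX ?expR_ge0// eb [(_^-1 ^+ _) `^ t]powRX//.
  rewrite /Y exprMn exprS le_eqVlt; apply/orP; left; apply/eqP.
  by move: (_ `^ t) (_ `^ t) (2 ^+ K) => p q w; ring.
have LX : 0 <= (1 + L) ^+ n by rewrite exprn_ge0// addr_ge0.
apply: le_trans (ler_wpM2r LX cK) _.
have -> : A * (1 + L) ^+ M * 2 ^- K * (1 + L) ^+ n = A * (1 + L) ^+ (n + M) * 2 ^- K.
  by rewrite addnC exprD !mulrA mulrAC.
rewrite ler_pdivrMr ?exprn_gt0//.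
apply: le_trans (ler_wpM2l A0 (main _)) _.
rewrite /gev le_eqVlt; apply/orP; left; apply/eqP.
by move: (_ `^ t) (2 ^+ K) (Y ^+ _) => p q w; ring.
Qed.

End GevreyDecay.

(** * Local representation by Fourier series *)

Section FrequencyBoxes.
Variables (R : realType) (N : nat) (B : R).
Hypothesis B0 : 0 < B.
Local Notation E := 'rV[R]_N.
Local Notation C := (R[i]).
Local Notation l := (halffreq B).
Local Notation boxes M := {ffun 'I_N -> 'I_(2 * M).+1}.

Definition absn M (k : boxes M) (j : 'I_N) : R := `|M%:R - (k j)%:R|.

(** A weight on the frequencies whose sum is bounded independently of M; polynomial decay against it
    gives absolute convergence. *)
Definition winv M (k : boxes M) : R := \prod_j ((1 + absn k j) ^+ 2)^-1.

Lemma absn_ge0 M (k : boxes M) j : 0 <= absn k j. Proof. exact: normr_ge0. Qed.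

(** The correction -2/(M+1) carries the induction: the two new terms are at most 2/m - 2/(m+1) with
    m = M+1. *)
Lemma sum_winv1 M : \sum_(i < (2 * M).+1) ((1 + `|M%:R - i%:R|) ^+ 2)^-1 <= 4 - 2 / M.+1%:R :> R.
Proof.
elim: M => [|M IHM].
  by rewrite muln0 big_ord1 subrr normr0 addr0 expr1n invr1; lra.
rewrite (_ : (2 * M.+1) = (2 * M).+2)%N; last by rewrite mulnS.
rewrite big_ord_recr big_ord_recl /=.
have -> : \sum_(i < (2 * M).+1) ((1 + `|M.+1%:R - (bump 0 i)%:R|) ^+ 2)^-1 =
   \sum_(i < (2 * M).+1) ((1 + `|M%:R - i%:R|) ^+ 2)^-1 :> R.
  apply: eq_bigr => i _; rewrite /bump /= add1n -!natr1.
  by congr ((1 + `|_|) ^+ 2)^-1; ring.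
have -> : `|M.+1%:R - 0%:R| = M.+1%:R :> R by rewrite subr0 normr_nat.
have -> : `|M.+1%:R - (2 * M).+2%:R| = M.+1%:R :> R.
  rewrite (_ : (2 * M).+2 = M.+1 + M.+1)%N; last by rewrite mul2n -addnn addSn addnS.
  by rewrite natrD opprD addNKr normrN normr_nat.
have step : 2 * ((1 + M.+1%:R) ^+ 2)^-1 <= 2 / M.+1%:R - 2 / M.+2%:R :> R.
  rewrite -[M.+2%:R]natr1 [_ + 1]addrC; have : 0 < M.+1%:R :> R by rewrite ltr0n.
  move: (M.+1%:R) => m m0; have mn : m != 0 by rewrite gt_eqF.
  have mn1 : 1 + m != 0 by rewrite gt_eqF//; lra.
  have -> : 2 / m - 2 / (1 + m) = 2 * ((1 + m) * m)^-1 by field; rewrite mn mn1.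
  have p1 : 0 < 1 + m by lra.
  apply: ler_wpM2l => //; rewrite lef_pV2 ?posrE ?exprn_gt0 ?mulr_gt0//.
  by rewrite expr2 ler_pM2l// lerDr.
by move: IHM step; move: (\sum_(i < _) _) ((_ ^+ 2)^-1) (2 / M.+1%:R) (2 / M.+2%:R) => a b c d; lra.
Qed.

Lemma sum_winv M : \sum_(k : boxes M) winv k <= 4 ^+ N.
Proof.
rewrite /winv -(bigA_distr_bigA (fun j (i : 'I_(2 * M).+1) => ((1 + `|M%:R - i%:R|) ^+ 2)^-1)) /=.
rewrite prodr_const card_ord; apply: lerXn2r; rewrite ?nnegrE//.
  by apply: sumr_ge0 => i _; rewrite invr_ge0 exprn_ge0// addr_ge0.
by apply: le_trans (sum_winv1 M) _; rewrite gerBl.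
Qed.

Lemma winv_ge0 M (k : boxes M) : 0 <= winv k.
Proof. by apply: prodr_ge0 => j _; rewrite invr_ge0 exprn_ge0// addr_ge0// absn_ge0. Qed.

(** An index k stands for the frequency numbered M - k, so keeping the frequency in a larger box
    shifts k by M' - M. *)
Definition embed M M' (k : boxes M) : boxes M' := [ffun j => inord (k j + (M' - M))].

Definition in_box M M' (k : boxes M') : bool :=
  [forall j, (M' - M <= k j)%N && (k j <= M' + M)%N].

Lemma freq_embed M M' (k : boxes M) : (M <= M')%N -> freq B (@embed M M' k) = freq B k.
Proof.
move=> MM; apply/funext => j; rewrite /freq ffunE inordK.
  by congr (_ * _); rewrite natrD natrB//; ring.
by have := ltn_ord (k j); lia.
Qed.

Lemma in_box_embed M M' (k : boxes M) : (M <= M')%N -> in_box M (@embed M M' k).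
Proof.
move=> MM; apply/forallP => j; rewrite ffunE.
by have kj := ltn_ord (k j); rewrite inordK; lia.
Qed.

Lemma sum_in_box (V : nmodType) M M' (F : ('I_N -> R) -> V) : (M <= M')%N ->
  \sum_(k : boxes M' | in_box M k) F (freq B k) = \sum_(k : boxes M) F (freq B k).
Proof.
move=> MM.
rewrite (reindex_onto (@embed M M') (fun k' => [ffun j => inord (k' j - (M' - M))])).
  apply: eq_big => [k|k _]; last by rewrite freq_embed.
  rewrite in_box_embed//=; apply/eqP/ffunP => j; rewrite !ffunE.
  have kj : (k j <= 2 * M)%N by rewrite -ltnS ltn_ord.
  rewrite (@inordK (2 * M')); first by rewrite addnK inord_val.
  by move: kj MM; move: (nat_of_ord (k j)) => a; clear; lia.
move=> k /forallP hk; apply/ffunP => j; rewrite !ffunE; apply: val_inj => /=.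
have /andP[k1 k2] := hk j; have k3 := ltn_ord (k j).
by rewrite (@inordK (2 * M)) ?inordK; lia.
Qed.

Lemma not_in_box M M' (k : boxes M') : (M <= M')%N -> ~~ in_box M k ->
  M.+1%:R <= 1 + \sum_j absn k j.
Proof.
move=> MM /forallPn[j]; rewrite negb_and -!ltnNge => kj.
rewrite (bigD1 j)//= -natr1 [_ + 1]addrC lerD2l.
apply: ler_wpDr; first by apply: sumr_ge0 => i _; exact: absn_ge0.
rewrite /absn; case/orP: kj => kj.
  have h : (M + k j <= M')%N by lia.
  rewrite ler_normr; apply/orP; left; rewrite lerBrDr -natrD ler_nat//.
rewrite ler_normr; apply/orP; right; rewrite opprB lerBrDr -natrD ler_nat addnC.
exact: ltnW.
Qed.

(** Outside the smaller box the extra weight is at least M+1, and this one power gives the rate. *)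
Lemma box_sum_cauchy (F : ('I_N -> R) -> C) (A : R) M M' : (M <= M')%N ->
  (forall k : boxes M', normc (F (freq B k)) * (1 + \sum_j absn k j) <= A * winv k) ->
  0 <= A ->
  normc (\sum_(k : boxes M) F (freq B k) - \sum_(k : boxes M') F (freq B k)) <=
    A * 4 ^+ N * iS R M.
Proof.
move=> MM hF A0; rewrite [X in _ - X](bigID (@in_box M M')) /= sum_in_box// opprD addNKr normc_opp.
apply: le_trans (normc_sum _ _ _) _.
have H (k : boxes M') : ~~ in_box M k -> normc (F (freq B k)) <= A * iS R M * winv k.
  move=> nk; have h := not_in_box MM nk.
  have M0 : 0 < M.+1%:R :> R by rewrite ltr0n.
  have -> : A * iS R M * winv k = A * winv k / M.+1%:R.
    by rewrite /iS mulrAC.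
  rewrite ler_pdivlMr//; apply: le_trans (hF k).
  by apply: ler_wpM2l => //; exact: normc_ge0.
apply: le_trans (ler_sum _ H) _; rewrite -mulr_sumr.
have AS : 0 <= A * iS R M by rewrite mulr_ge0// iS_ge0.
rewrite [leRHS]mulrAC; apply: ler_wpM2l => //.
apply: le_trans (sum_winv M'); rewrite [leRHS](bigID (@in_box M M')) /= lerDr.
by apply: sumr_ge0 => k _; exact: winv_ge0.
Qed.

Lemma box_sum_bound (F : ('I_N -> R) -> C) (A : R) M :
  (forall k : boxes M, normc (F (freq B k)) * (1 + \sum_j absn k j) <= A * winv k) ->
  0 <= A -> normc (\sum_(k : boxes M) F (freq B k)) <= A * 4 ^+ N.
Proof.
move=> hF A0; apply: le_trans (normc_sum _ _ _) _.
apply: (@le_trans _ _ (\sum_(k : boxes M) A * winv k)).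
  apply: ler_sum => k _; apply: le_trans (hF k).
  by rewrite ler_peMr ?normc_ge0// lerDl; apply: sumr_ge0 => j _; exact: absn_ge0.
by rewrite -mulr_sumr; apply: ler_wpM2l => //; exact: sum_winv.
Qed.

Lemma freq_weight : exists2 kp : R, 1 <= kp & forall M (k : boxes M),
  1 + \sum_j absn k j <= kp * (1 + norm1 (freq B k)).
Proof.
have l0 : 0 < 2 * l by rewrite mulr_gt0// halffreq_gt0.
exists (1 + (2 * l)^-1); first by rewrite lerDl invr_ge0 ltW.
move=> M k; have e : norm1 (freq B k) = 2 * l * \sum_j absn k j.
  by rewrite /norm1 mulr_sumr; apply: eq_bigr => j _; rewrite normrM gtr0_norm.
have S0 : 0 <= \sum_j absn k j by apply: sumr_ge0 => j _; exact: absn_ge0.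
rewrite e; move: (\sum_j _) S0 => S S0; rewrite mulrDl mul1r mulrDr mulr1 mulKf ?gt_eqF//.
have : 0 <= 2 * l * S by rewrite mulr_ge0// ltW.
have : 0 <= (2 * l)^-1 by rewrite invr_ge0 ltW.
by move: (2 * l * S) (_^-1) => x y; lra.
Qed.

(** Of the 2N + q powers of decay, 2N pay for the weight [winv] and q are left. *)
Lemma winv_bound M (k : boxes M) (c A kp : R) q : 0 <= c -> 0 <= kp ->
  1 + \sum_j absn k j <= kp * (1 + norm1 (freq B k)) ->
  c * (1 + norm1 (freq B k)) ^+ (2 * N + q) <= A ->
  c * (1 + \sum_j absn k j) ^+ q <= A * kp ^+ (2 * N + q) * winv k.
Proof.
move=> c0 kp0 hk hA; set S := 1 + \sum_j absn k j in hk *.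
have S1 : 1 <= S by rewrite lerDl; apply: sumr_ge0 => j _; exact: absn_ge0.
have S0 : 0 <= S by exact: le_trans S1.
pose W := \prod_j (1 + absn k j) ^+ 2.
have W0 : 0 < W by apply: prodr_gt0 => j _; rewrite exprn_gt0// ltr_pwDl// absn_ge0.
have -> : winv k = W^-1 by rewrite /winv prodfV.
rewrite ler_pdivlMr//.
have WS : W <= S ^+ (2 * N).
  rewrite exprM -[X in _ ^+ X](card_ord N) -prodr_const; apply: ler_prod => j _.
  rewrite exprn_ge0 ?addr_ge0 ?absn_ge0//=; apply: lerXn2r; rewrite ?nnegrE//.
    by rewrite addr_ge0 ?absn_ge0.
  rewrite lerD2l (bigD1 j)//= lerDl; apply: sumr_ge0 => i _; exact: absn_ge0.
apply: (@le_trans _ _ (c * S ^+ (2 * N + q))).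
  rewrite -mulrA; apply: ler_wpM2l => //; rewrite addnC exprD.
  by apply: ler_wpM2l => //; exact: exprn_ge0.
apply: (@le_trans _ _ (c * (kp * (1 + norm1 (freq B k))) ^+ (2 * N + q))).
  apply: ler_wpM2l => //; apply: lerXn2r; rewrite ?nnegrE// mulr_ge0// addr_ge0//.
  exact: norm1_ge0.
by rewrite exprMn mulrCA mulrC; apply: ler_wpM2r => //; exact: exprn_ge0.
Qed.

End FrequencyBoxes.

Section UniformEstimates.
Variables (R : realType) (N : nat).
Local Notation E := 'rV[R]_N.
Local Notation C := (R[i]).
Local Notation dw f s := (foldr (@pderiv R N) f s).

(** Words of bounded length are finite in number; the maximum is taken letter by letter. *)
Lemma words_uniform (Q : seq 'I_N -> nat -> Prop) :
  (forall s, exists m, Q s m) -> (forall s m m', (m <= m')%N -> Q s m -> Q s m') ->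
  forall n, exists m, forall s, (size s <= n)%N -> Q s m.
Proof.
move=> ex mono n; elim: n Q ex mono => [|n IHn] Q ex mono.
  have [m hm] := ex [::]; exists m => s; rewrite leqn0 => /nilP ->; exact: hm.
have /choice[f hf] j : exists m, forall s, (size s <= n)%N -> Q (j :: s) m.
  by apply: (IHn (fun s => Q (j :: s))) => [s|s m m']; [exact: ex|exact: mono].
have [m hm] := ex [::].
exists (maxn m (\max_j f j)) => -[_|j s] /=; first by apply: mono hm; exact: leq_maxl.
rewrite ltnS => sn; apply: mono (hf j s sn).
by apply: leq_trans (leq_maxr _ _); exact: (leq_bigmax j).
Qed.

Lemma test_bounded (b : R) phi : 0 < b -> test_on (@box R b N) phi ->
  exists m : nat, forall x, normc (phi x) <= m%:R.
Proof.
move=> b0 tphi; have cp := smooth_ccont tphi.1.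
have [G1 G10 h1] := box_bounded b0 (ccont_Re cp).
have [G2 G20 h2] := box_bounded b0 (ccont_Im cp).
exists (Num.trunc (G1 + G2)).+1 => x.
have G0 : 0 <= G1 + G2 by rewrite addr_ge0// ltW.
have [xb|nxb] := pselect (box b x); last by rewrite tphi.2// Normc.normc0.
have /andP[_ /ltW] := truncn_itv G0; apply: le_trans.
by apply: le_trans (ler_normc_ReIm _) _; apply: lerD; [exact: h1|exact: h2].
Qed.

Lemma leibniz_bound f g n (F e : R) (x : E) : smooth setT f -> smooth setT g ->
  0 <= F -> 0 <= e ->
  (forall s, (size s <= n)%N -> normc (dw f s x) <= F) ->
  (forall s, (size s <= n)%N -> normc (dw g s x) <= e) ->
  forall s, (size s <= n)%N -> normc (dw (fun y => f y * g y) s x) <= 2 ^+ size s * (F * e).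
Proof.
move=> sf sg F0 e0 hf hg s.
(* Generalized to factors already differentiated along [s1] and [s2], since each letter moves onto
   one of them. *)
suff H k : (k <= n)%N -> forall s1 s2, (size s1 + k <= n)%N -> (size s2 + k <= n)%N ->
    forall s, size s = k ->
    normc (dw (fun y => dw f s1 y * dw g s2 y) s x) <= 2 ^+ k * (F * e).
  by move=> sn; apply: (H (size s) sn [::] [::]).
elim: k => [|k IHk] kn s1 s2 h1 h2 {}s.
  move=> /size0nil ->; rewrite expr0 mul1r /= Normc.normcM.
  by apply: ler_pM; rewrite ?normc_ge0 ?hf ?hg// -[size _]addn0.
case/lastP: s => [//|s j]; rewrite size_rcons => -[sk].
rewrite (foldrM openT _ _ (smooth_foldr s1 sf) (smooth_foldr s2 sg) I).
apply: le_trans (ler_normcD _ _) _; rewrite exprS -mulrA mulr_natl mulr2n.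
apply: lerD.
  apply: (IHk (ltnW kn) (j :: s1) s2 _ _ s sk); first by rewrite /= addSn -addnS.
  by apply: leq_trans h2; rewrite leq_add2l.
apply: (IHk (ltnW kn) s1 (j :: s2) _ _ s sk); last by rewrite /= addSn -addnS.
by apply: leq_trans h1; rewrite leq_add2l.
Qed.

Variables (U : set E) (u : (E -> C) -> C).
Hypothesis (uD : forall (c : C) phi psi, test_function U phi -> test_function U psi ->
     u (fun x => c * phi x + psi x) = c * u phi + u psi).

Lemma test0 : test_function U (fun=> 0).
Proof.
exists set0; split; [exact: compact0|by []|split=> //].
exact: smooth_cst openT.
Qed.

Lemma distr0 : u (fun=> 0) = 0.
Proof.
have := uD (-1) test0 test0.
by rewrite (_ : (fun=> _) = (fun=> 0)); [rewrite mulN1r addNr|apply/funext => x; rewrite mulr0 addr0].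
Qed.

Lemma test_functionZD (c : C) phi psi : test_function U phi -> test_function U psi ->
  test_function U (fun x => c * phi x + psi x).
Proof.
move=> [K1 [c1 k1 [s1 z1]]] [K2 [c2 k2 [s2 z2]]].
exists (K1 `|` K2); split; first exact: compactU.
  by rewrite subUset.
split; first exact: (smoothD openT (smoothZ c openT s1) s2).
by move=> x /not_orP[h1 h2]; rewrite z1// z2// mulr0 addr0.
Qed.

Lemma distr_sum (I : Type) (r : seq I) (a : I -> C) (F : I -> E -> C) :
  (forall i, test_function U (F i)) ->
  u (fun x => \sum_(i <- r) a i * F i x) = \sum_(i <- r) a i * u (F i) /\
  test_function U (fun x => \sum_(i <- r) a i * F i x).
Proof.
move=> tF; elim: r => [|i r [IH1 IH2]].
  rewrite (_ : (fun x => _) = fun=> 0); last by apply/funext => x; rewrite big_nil.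
  by rewrite big_nil; split; [exact: distr0|exact: test0].
rewrite (_ : (fun x => _) = fun x => a i * F i x + \sum_(i <- r) a i * F i x); last first.
  by apply/funext => x; rewrite big_cons.
rewrite uD// IH1 big_cons; split=> //; exact: test_functionZD.
Qed.

End UniformEstimates.

Section LocalSeries.
Variables (R : realType) (N : nat) (B : R).
Hypothesis B0 : 0 < B.
Local Notation E := 'rV[R]_N.
Local Notation C := (R[i]).
Local Notation dw f s := (foldr (@pderiv R N) f s).
Local Notation boxes M := {ffun 'I_N -> 'I_(2 * M).+1}.
Local Notation V := ((2 * B) ^- N).
Variables (c : ('I_N -> R) -> C) (A h t : R).
Hypothesis (A0 : 0 <= A) (h0 : 0 <= h) (t0 : 0 <= t).
Hypothesis decay : forall n xi, normc (c xi) * (1 + norm1 xi) ^+ n <= gev A h t n.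

Local Notation neg xi := (fun j => - xi j).

(** The frequencies are negated because [c] at xi is the value on the exponential of frequency xi:
    integrating against phi then gives the sum of [fcoef B phi xi * c xi]. *)
Definition psum M (x : E) : C :=
  \sum_(k : boxes M) (V%:C * c (freq B k)) * expf (imz (neg (freq B k))) x.

Let F s (x : E) xi : C :=
  (V%:C * c xi) * (\prod_(j <- s) imz (neg xi) j * expf (imz (neg xi)) x).

Lemma smooth_psum M : smooth setT (psum M).
Proof.
apply: (smooth_sum _ openT) => k; apply: (smoothZ _ openT).
exact: (smooth_expf _ openT).1.
Qed.

Lemma foldr_psum M s x : dw (psum M) s x = \sum_(k : boxes M) F s x (freq B k).
Proof.
rewrite /psum (foldr_sum openT) //; last first.
  by move=> k; apply: (smoothZ _ openT); exact: (smooth_expf _ openT).1.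
apply: eq_bigr => k _; have [se De] := @smooth_expf R N setT (imz (neg (freq B k))) openT.
by rewrite (foldrZ openT _ _ se I) De.
Qed.

Lemma V_ge0 : 0 <= V. Proof. by rewrite invr_ge0 exprn_ge0// mulr_ge0// ltW. Qed.

Lemma term_bound s x xi q :
  normc (F s x xi) * (1 + norm1 xi) ^+ q <= V * gev A h t (size s + q).
Proof.
have L1 : 1 <= 1 + norm1 xi by rewrite lerDl norm1_ge0.
have L0 : 0 <= 1 + norm1 xi by exact: le_trans L1.
rewrite /F !Normc.normcM normc_expf_imz mulr1 normc_real (ger0_norm V_ge0).
rewrite -!mulrA; apply: ler_wpM2l; first exact: V_ge0.
apply: le_trans (decay _ xi); apply: ler_wpM2l; first exact: normc_ge0.
rewrite exprD; apply: ler_wpM2r; first exact: exprn_ge0.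
rewrite normc_prod; elim: s => [|j s IHs]; first by rewrite big_nil expr0.
rewrite big_cons exprS; apply: ler_pM => //; try exact: normc_ge0.
  by apply: prodr_ge0 => i _; exact: normc_ge0.
rewrite -normc_opp normc_imz normrN; apply: le_trans (coord_le_norm1 xi j) _.
by rewrite lerDr.
Qed.

Lemma local_series : exists f, [/\ smooth setT f,
  exists A' h' : R, [/\ 0 <= A', 0 <= h' &
    forall s x, normc (dw f s x) <= gev A' h' t (size s)] &
  exists cst : R, forall M x, normc (psum M x - f x) <= cst * iS R M].
Proof.
have [kp kp1 hkp] := @freq_weight R N B B0.
have kp0 : 0 <= kp by exact: le_trans kp1.
(* 2N powers for summability and one for the rate of [box_sum_cauchy]. *)
pose q := (2 * N + 1)%N.
pose As (s : seq 'I_N) := V * gev A h t (size s + q) * kp ^+ q.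
have As0 (s : seq 'I_N) : 0 <= As s by rewrite !mulr_ge0 ?gev_ge0 ?exprn_ge0 ?V_ge0.
have hF (s : seq 'I_N) (x : E) M (k : boxes M) : normc (F s x (freq B k)) * (1 + \sum_j absn R k j) <= As s * winv R k.
  have := winv_bound (q := 1) (normc_ge0 (F s x (freq B k))) kp0 (hkp M k)
    (term_bound s x (freq B k) q).
  by rewrite expr1.
have [|f [sf hf]] := @smooth_limit R N setT openT psum smooth_psum.
  move=> s; exists (As s * 4 ^+ N) => M M' x MM _; rewrite !foldr_psum.
  by apply: box_sum_cauchy => // k; exact: hF.
exists f; split=> //; last first.
  have [cst hc] := hf [::]; exists cst => M x; exact: hc.
have VA0 : 0 <= V * kp ^+ q * A * 4 ^+ N by rewrite !mulr_ge0 ?exprn_ge0 ?V_ge0.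
have [A' [h' [A'0 h'0 hsh]]] := gev_shift q VA0 h0 t0.
exists A', h'; split=> // s x; apply: le_trans (hsh _).
have -> : gev (V * kp ^+ q * A * 4 ^+ N) h t (size s + q) = As s * 4 ^+ N.
  rewrite /As /gev; move: (_ `^ t) (h ^+ _) (kp ^+ _) => a b d; ring.
have [cst hc] := hf s; apply/ler_addgt0Pr => e e0.
have [M hM] := iS_small cst e0.
have b1 : normc (dw (psum M) s x) <= As s * 4 ^+ N.
  by rewrite foldr_psum; apply: box_sum_bound => // k; exact: hF.
have b2 := le_trans (hc M x I) hM.
have -> : dw f s x = dw (psum M) s x - (dw (psum M) s x - dw f s x).
  by rewrite opprB addrC subrK.
by apply: le_trans (ler_normcD _ _) _; rewrite normc_opp; exact: lerD.
Qed.

End LocalSeries.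

Section LocalRepresentation.
Variables (R : realType) (N : nat).
Local Notation E := 'rV[R]_N.
Local Notation C := (R[i]).
Local Notation dw f s := (foldr (@pderiv R N) f s).
Local Notation boxes M := {ffun 'I_N -> 'I_(2 * M).+1}.

(** For factors in [0, 1], one minus a product is at most the sum of the defects. *)
Lemma kcoefN_bounds M (k : boxes M) : 0 <= kcoefN R k <= 1 /\
  1 - kcoefN R k <= (1 + \sum_j absn R k j) ^+ 2 * iS R M.
Proof.
have K j := @kcoef_bounds R M (k j) (ltn_ord (k j)).
have H (r : seq 'I_N) : 0 <= \prod_(j <- r) kcoef R M (k j) <= 1 /\
    1 - \prod_(j <- r) kcoef R M (k j) <= \sum_(j <- r) absn R k j ^+ 2 * iS R M.
  elim: r => [|j r [/andP[IH1 IH2] IH3]]; first by rewrite !big_nil subrr ler01 lexx.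
  rewrite !big_cons; have [/andP[k0 k1] k2] := K j; split.
    by rewrite mulr_ge0//= mulr_ile1.
  have e : absn R k j ^+ 2 = (M%:R - (k j)%:R) ^+ 2 by rewrite /absn real_normK ?num_real.
  rewrite e; move: IH1 IH2 IH3 k0 k1 k2.
  move: (\prod_(_ <- _) _) (kcoef _ _ _) (\sum_(_ <- _) _) (_ * iS R M) => p x S y p0 p1 p2 x0 x1 x2.
  have : x * (1 - p) <= 1 - p by rewrite ler_piMl// subr_ge0.
  by rewrite mulrBr mulr1; lra.
have [h1 h2] := H (index_enum 'I_N); split=> //.
apply: le_trans h2 _; rewrite -mulr_suml; apply: ler_wpM2r; first exact: iS_ge0.
set S := \sum_j absn R k j.
have S0 : 0 <= S by apply: sumr_ge0 => j _; exact: absn_ge0.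
apply: (@le_trans _ _ (S * S)).
  rewrite {1}/S mulr_suml; apply: ler_sum => j _; rewrite expr2; apply: ler_wpM2l.
    exact: absn_ge0.
  by rewrite /S (bigD1 j)//= lerDl; apply: sumr_ge0 => i _; exact: absn_ge0.
by rewrite -expr2; apply: lerXn2r; rewrite ?nnegrE ?addr_ge0// lerDr.
Qed.

(* [u phi = u (chi phi)] is the limit of [u] on [chi] times the trigonometric means of
   [phi], i.e. of finite sums of Fourier coefficients of [phi] times those of [chi u]. *)
Lemma local_representation (U : set E) (u : (E -> C) -> C) (g : E -> C) (P : mpoly N C)
    (s t : R) (x0 : E) (r : R) :
  1 < s -> s < t -> 0 < r -> open U -> Defs.distribution U u -> gevrey s U g ->
  (forall phi, test_function U phi -> diffop_distr P u phi = distr_of_fun g phi) ->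
  zero_cond s P -> cube x0 (3 * r) `<=` U ->
  exists f : E -> C, [/\ smooth setT f,
    exists A h : R, [/\ 0 <= A, 0 <= h &
      forall s x, normc (dw f s x) <= gev A h t (size s)] &
    forall phi, test_on (cube x0 r) phi -> u phi = distr_of_fun f phi].
Proof.
move=> s1 st r0 oU dU gg Pu hZ QU; have t1 : 1 < t by exact: lt_trans st.
have t0 : 0 <= t by rewrite ltW// (lt_trans ltr01).
have [chi [tchi chi1 [A [dl [M [A0 dl0 dec]]]]]] := fourier_decay s1 st r0 oU dU gg Pu hZ QU.
set Q := cube x0 (3 * r) in QU tchi.
have cQ : compact Q by exact: compact_cube.
have clQ : closed Q by apply: compact_closed => //; exact: norm_hausdorff.
have QQ : cube x0 r `<=` Q.
  by move=> x hx k; apply: le_trans (hx k) _; rewrite ler_peMl ?ltW// ltr1n.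
have [b b0 Qb] : exists2 b, 0 < b & Q `<=` @box R b N by apply: cube_box; exact: mulr_gt0.
have [uD uC] := dU; have [A1 [k uk]] := uC Q cQ QU.
(* The period is wide enough for the supports to lie in the box of size B/2, where the trigonometric
   means converge. *)
pose B := 2 * b + 1.
have bB : b < B by rewrite /B; lra.
have B0 : 0 < B by exact: lt_trans bB.
have bB2 : b <= B / 2 by rewrite /B; lra.
pose c xi := u (fun x => chi x * expf (imz xi) x).
have [A' [h [A'0 h0 decay]]] := @decay_gevrey R N (fun xi => normc (c xi)) A dl t M t1 A0 dl0 dec.
have [f [sf hf [cst hcst]]] := local_series B0 A'0 h0 t0 decay.
exists f; split=> // phi tphi.
have tphiQ : test_on Q phi.
  by split; [exact: tphi.1|move=> x nx; apply: tphi.2 => /QQ].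
have tphib : test_on (@box R b N) phi.
  by split; [exact: tphi.1|move=> x nx; apply: tphiQ.2 => /Qb].
have tchib : test_on (@box R b N) chi.
  by split; [exact: tchi.1|move=> x nx; apply: tchi.2 => /Qb].
have cphi := smooth_ccont tphi.1.
have cf := smooth_ccont sf.
have -> : distr_of_fun f phi = cbint B (fun x => f x * phi x).
  apply: cintegral_rV_cbint => x nx; rewrite tphib.2 ?mulr0// => xb; apply: nx => j.
  by apply: le_trans (xb j) _; exact: ltW.
pose tri := trigmean B phi.
have stri n : smooth setT (tri n) by exact: smooth_trigmean.
have tchie n (z : boxes n) : test_function U (fun x => chi x * expf (imz (freq B z)) x).
  exists Q; split; [exact: cQ|exact: QU|apply: test_onM tchi _].
  exact: (smooth_expf _ openT).1.
have [G hG] := test_bounded b0 tphib.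
pose T n := u (fun x => chi x * tri n x).
have TE n : T n = \sum_(z : boxes n) ((kcoefN R z)%:C * fcoef B phi (freq B z)) * c (freq B z).
  rewrite /T -(distr_sum uD (index_enum _) _ (tchie n)).1; congr u.
  apply/funext => x; rewrite /tri /trigmean mulr_sumr; apply: eq_bigr => z _.
  by rewrite mulrCA.
have tT n : test_function U (fun x => chi x * tri n x).
  by exists Q; split; [exact: cQ|exact: QU|exact: test_onM].
have [F hF] : exists F : nat, forall w, (size w <= k)%N -> forall x, normc (dw chi w x) <= F%:R.
  apply: (words_uniform (Q := fun w m => forall x, normc (dw chi w x) <= m%:R)).
    by move=> w; apply: (test_bounded b0); exact: (test_on_foldr _ (@closed_box _ _ _) tchib).
  by move=> w m m' mm H x; apply: le_trans (H x) _; rewrite ler_nat.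
have limT e : 0 < e -> exists n0 : nat, forall n, (n0 <= n)%N -> normc (u phi - T n) <= e.
  move=> e0; pose m : R := `|A1| * #|{: bmultinom N k.+1}|%:R * (2 ^+ k * F%:R) + 1.
  have m0 : 0 < m by rewrite ltr_wpDl// !mulr_ge0 ?exprn_ge0.
  have em0 : 0 < e / m by exact: divr_gt0.
  have [n0 hn0] : exists n0 : nat, forall w, (size w <= k)%N -> forall n x, (n0 <= n)%N ->
      box (B / 2) x -> normc (dw (tri n) w x - dw phi w x) <= e / m.
    apply: (words_uniform (Q := fun w n0 => forall n x, (n0 <= n)%N ->
      box (B / 2) x -> normc (dw (tri n) w x - dw phi w x) <= e / m)).
      by move=> w; exact: (trigmean_cvg B0 w bB tphib em0).
    by move=> w n1 n2 n12 H n x nn; apply: H; exact: leq_trans nn.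
  exists n0 => n nn.
  have -> : u phi - T n = - u (fun x => chi x * (tri n x - phi x)).
    have -> : (fun x => chi x * (tri n x - phi x)) = (fun x => (-1) * phi x + chi x * tri n x).
      apply/funext => x; rewrite mulrBr.
      have [hx|hx] := pselect (cube x0 r x); first by rewrite chi1//; ring.
      by rewrite (tphi.2 x hx); ring.
    rewrite uD//; last by exists Q; split; [exact: cQ|exact: QU|exact: tphiQ].
    by rewrite -/(T n); ring.
  rewrite normc_opp.
  have sD : smooth setT (fun x => tri n x - phi x) by exact: (smoothB openT (stri n) tphi.1).
  have tD : test_on Q (fun x => chi x * (tri n x - phi x)) by exact: test_onM.
  have em := ltW em0.
  apply: le_trans (distr_small (e := 2 ^+ k * (F%:R * (e / m))) uk tD _) _.
    move=> w x wk; have [Qx|nQx] := pselect (Q x); last first.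
      rewrite (test_on_foldr w clQ tD).2// Normc.normc0.
      by rewrite mulr_ge0 ?exprn_ge0// mulr_ge0.
    apply: le_trans (leibniz_bound (n := k) tchi.1 sD (ler0n _ F) em _ _ wk) _.
    - by move=> w' wk'; exact: hF.
    - move=> w' wk'; rewrite (foldrB openT w' (stri n) tphi.1 I).
      by apply: hn0 => // j; apply: le_trans (Qb x Qx j) bB2.
    by apply: ler_wpM2r; [rewrite mulr_ge0|rewrite ler_weXn2l// ler1n].
  rewrite !mulrA ler_pdivrMr// mulrC; apply: ler_wpM2l; first exact: ltW.
  by rewrite /m !mulrA lerDl.
have [kp kp1 hkp] := @freq_weight R N B B0; have kp0 : 0 <= kp by exact: le_trans kp1.
(* 2N powers for summability and two for the square in [kcoefN_bounds]. *)
pose q := (2 * N + 2)%N.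
pose Y := gev A' h t q * kp ^+ q; have Y0 : 0 <= Y by rewrite mulr_ge0 ?gev_ge0 ?exprn_ge0.
pose W : R := (2 * B) ^- N * (2 * ((2 * B) ^+ N * G%:R)).
have V0 : 0 <= (2 * B) ^+ N by rewrite exprn_ge0// mulr_ge0// ltW.
have W0 : 0 <= W by rewrite mulr_ge0 ?invr_ge0// mulr_ge0// mulr_ge0.
have ce (xi : 'I_N -> R) : ccont (fun y : E => phi y * expf (imz (fun j => - xi j)) y).
  by apply: ccontM => //; exact: ccont_expf.
have fW xi : normc (fcoef B phi xi) <= W.
  rewrite /fcoef Normc.normcM normc_real ger0_norm ?invr_ge0//.
  apply: ler_wpM2l; first by rewrite invr_ge0.
  apply: (cbint_le B0 (ce xi)) => x _.
  by rewrite Normc.normcM normc_expf_imz mulr1.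
have csum n : ccont (psum B c n) by apply: smooth_ccont; exact: smooth_psum.
have SE n : cbint B (fun x => psum B c n x * phi x) =
    \sum_(z : boxes n) fcoef B phi (freq B z) * c (freq B z).
  have -> : (fun x => psum B c n x * phi x) = (fun x => \sum_(z : boxes n)
      (((2 * B) ^- N)%:C * c (freq B z)) * (phi x * expf (imz (fun j => - freq B z j)) x)).
    apply/funext => x; rewrite /psum mulr_suml; apply: eq_bigr => z _.
    by rewrite -mulrA [phi x * _]mulrC.
  rewrite (cbint_sum B0); last by move=> z; exact: ccontZ.
  apply: eq_bigr => z _; rewrite (cbintZ B0)// /fcoef.
  by rewrite -!mulrA [c _ * _]mulrC.
have dist1 n : normc (T n - cbint B (fun x => psum B c n x * phi x)) <= W * Y * 4 ^+ N * iS R n.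
  rewrite SE TE -sumrB; apply: le_trans (normc_sum _ _ _) _.
  have H (z : boxes n) : true -> normc ((kcoefN R z)%:C * fcoef B phi (freq B z) * c (freq B z) -
      fcoef B phi (freq B z) * c (freq B z)) <= W * Y * iS R n * winv R z.
    move=> _; have [/andP[k0 k1] k2] := kcoefN_bounds z.
    have -> : (kcoefN R z)%:C * fcoef B phi (freq B z) * c (freq B z) -
      fcoef B phi (freq B z) * c (freq B z) =
      - ((1 - kcoefN R z)%:C * (fcoef B phi (freq B z) * c (freq B z))).
      by rewrite rmorphB /= rmorph1; ring.
    rewrite normc_opp Normc.normcM normc_real ger0_norm ?subr_ge0//.
    apply: le_trans (ler_wpM2r (normc_ge0 _) k2) _; rewrite Normc.normcM.
    have wb := winv_bound (normc_ge0 (c (freq B z))) kp0 (hkp n z) (decay q (freq B z)).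
    have iS0' := iS_ge0 R n.
    apply: (@le_trans _ _ ((1 + \sum_j absn R z j) ^+ 2 * iS R n * (W * normc (c (freq B z))))).
      apply: ler_wpM2l.
        by rewrite mulr_ge0// exprn_ge0// addr_ge0// sumr_ge0// => j _; exact: absn_ge0.
      by apply: ler_wpM2r (fW _); exact: normc_ge0.
    have WS0 : 0 <= W * iS R n by exact: mulr_ge0.
    have := ler_wpM2l WS0 wb; rewrite -/q -/Y; clear.
    move: Y (normc _) (_ ^+ 2) (winv _ _) (iS _ _) => y1 y2 y3 y4 y5.
    by congr (_ <= _); ring.
  apply: le_trans (ler_sum _ H) _; rewrite -mulr_sumr [leRHS]mulrAC.
  apply: ler_wpM2l; first exact: mulr_ge0 (mulr_ge0 W0 Y0) (iS_ge0 R n).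
  exact: sum_winv.
have dist2 n : normc (cbint B (fun x => psum B c n x * phi x) - cbint B (fun x => f x * phi x)) <=
    2 * ((2 * B) ^+ N * (cst * iS R n * G%:R)).
  apply: (cbint_dist B0); [exact: ccontM|exact: ccontM|].
  move=> x _; rewrite -mulrBl Normc.normcM; apply: ler_pM; try exact: normc_ge0.
    exact: hcst.
  exact: hG.
pose Z := W * Y * 4 ^+ N + 2 * ((2 * B) ^+ N * (cst * G%:R)).
have tot n : normc (T n - cbint B (fun x => f x * phi x)) <= Z * iS R n.
  have -> : T n - cbint B (fun x => f x * phi x) =
     (T n - cbint B (fun x => psum B c n x * phi x)) +
     (cbint B (fun x => psum B c n x * phi x) - cbint B (fun x => f x * phi x)) by ring.
  apply: le_trans (ler_normcD _ _) _; apply: le_trans (lerD (dist1 n) (dist2 n)) _.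
  by rewrite le_eqVlt; apply/orP; left; apply/eqP; rewrite /Z; ring.
apply/eqP; rewrite -subr_eq0 -normc_eq0 eq_le normc_ge0 andbT; apply/ler_addgt0Pr => e e0.
have e2 : 0 < e / 2 by exact: divr_gt0.
have [n0 h1] := limT _ e2; have [n1 h2] := iS_small `|Z| e2.
pose n := maxn n0 n1.
have i1 := iS_le R (leq_maxr n0 n1); rewrite -/n in i1.
have -> : u phi - cbint B (fun x => f x * phi x) =
  (u phi - T n) + (T n - cbint B (fun x => f x * phi x)) by ring.
apply: le_trans (ler_normcD _ _) _; rewrite add0r [leRHS]splitr; apply: lerD.
  by apply: h1; exact: leq_maxl.
apply: le_trans (tot n) _; apply: le_trans h2.
apply: (@le_trans _ _ (`|Z| * iS R n)).
  by apply: ler_wpM2r; [exact: iS_ge0|exact: ler_norm].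
by apply: ler_wpM2l.
Qed.

End LocalRepresentation.

(** * Gluing and regularity *)

Section DuBoisReymond.
Variables (R : realType) (N : nat).
Local Notation E := 'rV[R]_N.
Local Notation C := (R[i]).
Local Notation dw f s := (foldr (@pderiv R N) f s).

Lemma normc_le_eps (z : C) : (forall e : R, 0 < e -> normc z <= e) -> z = 0.
Proof.
move=> h; apply/eqP; rewrite -normc_eq0 eq_le normc_ge0 andbT.
by apply/ler_addgt0Pr => e e0; rewrite add0r; exact: h.
Qed.

Lemma compact_sub_box (K : set E) : compact K -> exists2 b : R, 0 < b & K `<=` @box R b N.
Proof.
move=> /compact_bounded[M [_ hM]]; exists (`|M| + 1); first by rewrite ltr_pwDr.
move=> x Kx k; have Mlt : M < `|M| + 1 by rewrite ltr_pwDr// ler_norm.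
by apply: le_trans (hM _ Mlt x Kx); rewrite [leRHS]mx_normrE (le_trans _ (le_bigmax _ _ (0, k))).
Qed.

Lemma distr_cbint (U K : set E) (B : R) f phi : open U -> compact K -> K `<=` U ->
  0 < B -> K `<=` @box R B N -> smooth U f -> test_on K phi ->
  distr_of_fun f phi = cbint B (fun x => f x * phi x) /\ test_on K (fun x => f x * phi x).
Proof.
move=> oU cK KU B0 KB sf tphi; split; last first.
  apply: (test_on_glue oU _ KU sf tphi).
  by apply: compact_closed => //; exact: norm_hausdorff.
by apply: cintegral_rV_cbint => x nx; rewrite tphi.2 ?mulr0// => /KB.
Qed.

Lemma cube_compact_closed (y : E) (rho : R) : compact (cube y rho) /\ closed (cube y rho).
Proof.
have c := @compact_cube R N y rho; split; first exact: c.
by apply: compact_closed; [exact: norm_hausdorff|exact: c].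
Qed.

(* All Fourier coefficients of [(f1 - f2) chi] vanish, hence so do its trigonometric
   means, which converge to it. *)
Lemma du_bois_reymond (U : set E) f1 f2 (y : E) (rho : R) : open U -> 0 < rho ->
  cube y rho `<=` U -> smooth U f1 -> smooth U f2 ->
  (forall phi, test_on (cube y rho) phi -> distr_of_fun f1 phi = distr_of_fun f2 phi) ->
  f1 y = f2 y.
Proof.
move=> oU r0 QU s1 s2 h; have r3 : 0 < rho / 3 by exact: divr_gt0.
have [chi [_ [_ [_ cpd c0 c1 _]]]] := @cutoff_exists R N 2 y (rho / 3) (ltr1n R 2) r3.
have e3 : 3 * (rho / 3) = rho by field.
rewrite e3 in c0; set Q := cube y rho in QU h.
have [cQ clQ] := @cube_compact_closed y rho.
have tchi : test_on Q (chi mnm0) by split; [exact: (cpd _).1|exact: c0].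
have [b b0 Qb] := compact_sub_box cQ.
pose B := 2 * b + 1; have bB : b < B by rewrite /B; lra.
have B0 : 0 < B by exact: lt_trans bB.
have bB2 : b <= B / 2 by rewrite /B; lra.
have QB : Q `<=` @box R B N by move=> x /Qb xb k; apply: le_trans (xb k) (ltW bB).
pose G x := (f1 x - f2 x) * chi mnm0 x.
have tG : test_on Q G by apply: (test_on_glue oU clQ QU _ tchi); exact: (smoothB oU s1 s2).
have tGb : test_on (@box R b N) G.
  by split; [exact: tG.1|move=> x nx; apply: tG.2 => /Qb].
have coef xi : fcoef B G xi = 0.
  rewrite /fcoef; have te : test_on Q (fun x => chi mnm0 x * expf (imz (fun j => - xi j)) x).
    by apply: test_onM tchi _; exact: (smooth_expf _ openT).1.
  have [d1 t1] := distr_cbint oU cQ QU B0 QB s1 te.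
  have [d2 t2] := distr_cbint oU cQ QU B0 QB s2 te.
  have := h _ te; rewrite d1 d2 => /eqP; rewrite -subr_eq0 => /eqP hh.
  have c1' := smooth_ccont t1.1; have c2' := smooth_ccont t2.1.
  rewrite [X in _ * X](_ : _ = 0) ?mulr0// -hh -mulN1r -(cbintZ B0)//.
  rewrite -(cbintD B0)//; last exact: ccontZ.
  by apply: (eq_cbint B0) => x _; rewrite /G; ring.
have tri M x : trigmean B G M x = 0.
  by rewrite /trigmean big1// => k _; rewrite coef mulr0 mul0r.
have yQ : Q y by move=> k; rewrite subrr normr0 ltW.
have : G y = 0.
  apply: normc_le_eps => e e0; have [M0 hM] := @trigmean_cvg R N B B0 b G [::] e bB tGb e0.
  have yb : box (B / 2) y by move=> k; apply: le_trans (Qb y yQ k) bB2.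
  by have := hM M0 y (leqnn _) yb; rewrite /= tri sub0r normc_opp.
rewrite /G c1; last by move=> k; rewrite subrr normr0 ltW.
by rewrite mulr1 => /eqP; rewrite subr_eq0 => /eqP.
Qed.

(* Derivatives of trigonometric means do not depend on the order of differentiation. *)
Lemma foldr_perm (b : R) phi s s' : 0 < b -> test_on (@box R b N) phi -> perm_eq s s' ->
  dw phi s = dw phi s'.
Proof.
move=> b0 tphi ss; pose B := 2 * b + 1; have bB : b < B by rewrite /B; lra.
have B0 : 0 < B by exact: lt_trans bB.
have bB2 : b <= B / 2 by rewrite /B; lra.
apply/funext => x; have clb := @closed_box R N b.
have [xb|nxb] := pselect (@box R b N x); last first.
  by rewrite (test_on_foldr s clb tphi).2// (test_on_foldr s' clb tphi).2.
have xB : box (B / 2) x by move=> k; apply: le_trans (xb k) bB2.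
have tE M : dw (trigmean B phi M) s x = dw (trigmean B phi M) s' x.
  rewrite /trigmean.
  have sm (k : {ffun 'I_N -> 'I_(2 * M).+1}) : smooth setT (fun x =>
      ((kcoefN R k)%:C * fcoef B phi (freq B k)) * expf (imz (freq B k)) x).
    by apply: (smoothZ _ openT); exact: (smooth_expf _ openT).1.
  rewrite !(foldr_sum openT _ _ sm I); apply: eq_bigr => k _.
  have [se De] := @smooth_expf R N setT (imz (freq B k)) openT.
  rewrite !(foldrZ openT _ _ se I) !De//.
  by congr (_ * (_ * _)); exact: perm_big.
apply/eqP; rewrite -subr_eq0; apply/eqP; apply: normc_le_eps => e e0.
have e2 : 0 < e / 2 by exact: divr_gt0.
have [M1 h1] := trigmean_cvg B0 s bB tphi e2.
have [M2 h2] := trigmean_cvg B0 s' bB tphi e2.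
have := h1 _ x (leq_maxl M1 M2) xB; have := h2 _ x (leq_maxr M1 M2) xB.
rewrite tE; move: (dw (trigmean _ _ _) _ _) (dw phi s x) (dw phi s' x) => w p q hq hp.
have -> : p - q = (w - q) - (w - p) by ring.
by apply: le_trans (ler_normcB _ _) _; lra.
Qed.

Lemma parts (b B : R) (F phi : E -> C) s : 0 < b -> b < B -> smooth setT F ->
  test_on (@box R b N) phi ->
  cbint B (fun x => dw F s x * phi x) = (-1) ^+ size s * cbint B (fun x => F x * dw phi s x).
Proof.
move=> b0 bB sF tphi; have B0 : 0 < B by exact: lt_trans bB.
have clb := @closed_box R N b.
(* Derivatives leave [F] outermost first and so reach [phi] in reverse order. *)
have -> : dw phi s = dw phi (rev s) by apply: (foldr_perm b0 tphi); rewrite perm_sym perm_rev.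
elim: s phi tphi => [|j s IHs] phi tphi; first by rewrite expr0 mul1r.
have tp := test_on_pderiv j clb tphi.
have sFs := smooth_foldr s sF.
have tM : test_on (@box R b N) (fun x => dw F s x * phi x).
  by split; [exact: (smoothM openT sFs tphi.1)|move=> x nx; rewrite tphi.2 ?mulr0].
have := cbint_pderiv0 B0 j bB tM.
have -> : pderiv j (fun x => dw F s x * phi x) =
    fun x => dw F (j :: s) x * phi x + dw F s x * pderiv j phi x.
  apply/funext => x; apply: is_pd_val; apply: is_pdM.
    exact: (smooth_is_pd s j sF I).
  exact: (smooth_is_pd [::] j tphi.1 I).
have c1 : ccont (fun x => dw F (j :: s) x * phi x).
  apply: smooth_ccont; exact: (smoothM openT (smooth_foldr (j :: s) sF) tphi.1).
have c2 : ccont (fun x => dw F s x * pderiv j phi x).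
  apply: smooth_ccont; exact: (smoothM openT sFs tp.1).
rewrite (cbintD B0 c1 c2) => /eqP; rewrite addr_eq0 => /eqP ->.
by rewrite (IHs _ tp) /= rev_cons foldr_rcons exprS mulN1r mulNr.
Qed.

End DuBoisReymond.

Section Gluing.
Variables (R : realType) (N : nat).
Local Notation E := 'rV[R]_N.
Local Notation C := (R[i]).
Local Notation dw f s := (foldr (@pderiv R N) f s).

Lemma ball_rowP (y : E) (r : R) (z : E) : 0 < r ->
  ball y r z <-> forall k, `|y 0 k - z 0 k| < r.
Proof.
move=> r0; split=> [[_ h] k|h]; first exact: (h 0 k).
by split=> // i k; rewrite ord1; exact: h.
Qed.

Lemma ball_sub_cube (y : E) (r r' : R) : r <= r' -> ball y r `<=` cube y r'.
Proof.
move=> rr z hz; have r0 : 0 < r by case: hz.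
by move: hz => /(ball_rowP _ _ r0) h k; rewrite distrC; apply: le_trans (ltW (h k)) rr.
Qed.

Lemma small_cube (U : set E) (y : E) : open U -> U y ->
  exists2 rho : R, 0 < rho & cube y rho `<=` U.
Proof.
move=> oU Uy; have /nbhs_ballP[e /= e0 eU] : nbhs y U by exact: open_nbhs_nbhs.
exists (e / 2); first exact: divr_gt0.
move=> z hz; apply: eU; apply/(ball_rowP _ _ e0) => k; rewrite distrC.
by apply: le_lt_trans (hz k) _; rewrite ltr_pdivrMr// ltr_pMr// ltr1n.
Qed.

Lemma finite_ball_cover (U K : set E) (r : E -> R) : compact K -> K `<=` U ->
  (forall x, U x -> 0 < r x) ->
  exists l : seq E, (forall x, x \in l -> U x) /\
    forall y, K y -> exists2 x, x \in l & ball x (r x) y.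
Proof.
move=> cK KU r0; move: cK; rewrite compact_cover => cK.
have [D D1 D2] : finite_subset_cover U (fun x => ball x (r x)) K.
  apply: cK => [x _|y Ky]; first exact: ball_open.
  by exists y; [exact: KU|apply: ballxx; exact/r0/KU].
exists (finmap.enum_fset D); split=> [x /D1|y /D2[x xD yx]]; first by rewrite inE.
by exists x.
Qed.

Lemma gevrey_eq (s : R) (U : set E) (f g : E -> C) : open U -> (forall x, U x -> f x = g x) ->
  gevrey s U f -> gevrey s U g.
Proof.
move=> oU fg [sf hf]; split; first exact: (smooth_open oU fg sf).
move=> K cK KU; have [A [h [A0 h0 H]]] := hf K cK KU; exists A, h; split=> // a x Kx.
have := H a x Kx; rewrite !mderivE (foldr_open (mword a) oU fg)//; exact: KU.
Qed.

Lemma gev_mono (A A' h h' t : R) n : 0 <= A <= A' -> 0 <= h <= h' ->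
  gev A h t n <= gev A' h' t n.
Proof.
move=> /andP[A0 AA] /andP[h0 hh]; apply: ler_wpM2r; first exact: powR_ge0.
apply: ler_pM => //; first exact: exprn_ge0.
by apply: lerXn2r; rewrite ?nnegrE// (le_trans h0).
Qed.

(* The representing function is [f x = F_x x], where [F_x] represents [u] near [x]. *)
Theorem zero_cond_regularity (U : set E) (u : (E -> C) -> C) (g : E -> C) (P : mpoly N C)
    (s t : R) :
  1 < s -> s < t -> open U -> Defs.distribution U u -> gevrey s U g ->
  (forall phi, test_function U phi -> diffop_distr P u phi = distr_of_fun g phi) ->
  zero_cond s P ->
  exists f : E -> C, [/\ gevrey t U f, gevrey s U (diffop P f) &
    forall phi, test_function U phi -> u phi = distr_of_fun f phi].
Proof.
move=> s1 st oU dU gg Pu hZ; have [uD uC] := dU.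
have loc (x : E) : exists p : R * (E -> C), U x -> [/\ 0 < p.1, cube x (3 * p.1) `<=` U,
    smooth setT p.2,
    exists A h : R, [/\ 0 <= A, 0 <= h &
      forall s x, normc (dw p.2 s x) <= gev A h t (size s)] &
    forall phi, test_on (cube x p.1) phi -> u phi = distr_of_fun p.2 phi].
  have [Ux|nUx] := pselect (U x); last by exists (0, fun=> 0).
  have [rho rho0 hrho] := small_cube oU Ux.
  have r0 : 0 < rho / 3 by exact: divr_gt0.
  have e3 : 3 * (rho / 3) = rho by field.
  have hQ : cube x (3 * (rho / 3)) `<=` U by rewrite e3.
  have [F [F1 F2 F3]] := local_representation s1 st r0 oU dU gg Pu hZ hQ.
  by exists (rho / 3, F).
have [p hp] := choice loc; pose r x := (p x).1; pose F x := (p x).2.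
pose f x := F x x.
have r0 x : U x -> 0 < r x by case/hp.
have cubeU x : U x -> cube x (r x) `<=` U.
  move=> Ux; have [r1 h _ _ _] := hp x Ux => z hz; apply: h => k.
  by apply: le_trans (hz k) _; rewrite ler_peMl ?ltW// ltr1n.
have ballU x : U x -> ball x (r x) `<=` U.
  by move=> Ux z /(ball_sub_cube (lexx _)); exact: cubeU.
have oball x : open (ball x (r x)) by exact: ball_open.
have sF x : U x -> smooth setT (F x) by case/hp.
(* Near y both [F x] and [F y] represent [u], hence they agree at y. *)
have fF x : U x -> forall y, ball x (r x) y -> f y = F x y.
  move=> Ux y xy; have Uy : U y by exact: (ballU x Ux).
  have [d d0 hd] := small_cube (oball x) xy.
  pose rho := Num.min d (r y); have rho0 : 0 < rho by rewrite lt_min d0 r0.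
  have s1' : cube y rho `<=` cube x (r x).
    move=> z hz; apply: (ball_sub_cube (lexx _)); apply: hd.
    by move=> k; apply: le_trans (hz k) _; rewrite ge_min lexx.
  have s2' : cube y rho `<=` cube y (r y).
    by move=> z hz k; apply: le_trans (hz k) _; rewrite ge_min lexx orbT.
  apply: (du_bois_reymond openT rho0 (@subsetT _ _) (sF y Uy) (sF x Ux)) => phi [sphi phi0].
  have [_ _ _ _ ux] := hp x Ux; have [_ _ _ _ uy] := hp y Uy.
  rewrite -uy; last by split; [exact: sphi|move=> z nz; apply: phi0 => /s2'].
  by rewrite -ux//; split; [exact: sphi|move=> z nz; apply: phi0 => /s1'].
have center x : U x -> ball x (r x) x by move=> Ux; apply: ballxx; exact: r0.
have sf : smooth U f.
  apply: smooth_local => x Ux; exists (ball x (r x)); first exact: center.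
  have sFx := smooth_sub (@subsetT _ (ball x (r x))) (sF x Ux).
  apply: (smooth_open (oball x) _ sFx) => y xy; exact/esym/(fF x Ux y xy).
have dwf x w y : U x -> ball x (r x) y -> dw f w y = dw (F x) w y.
  by move=> Ux xy; exact: (foldr_open w (oball x) (fF x Ux) xy).
(* A cut-off equal to 1 on the cube of radius r/6 is supported in that of radius r/2, inside the
   ball where [f] is [F x]. *)
have r60 x : U x -> 0 < r x / 6 by move=> /r0 h; exact: divr_gt0.
have r6 x : U x -> r x / 6 <= r x by move=> /r0 h; lra.
have Pf x : U x -> diffop P f x = g x.
  move=> Ux; have -> : diffop P f x = diffop P (F x) x.
    apply: eq_bigr => a _; rewrite !mderivE (dwf x)//; exact: center.
  have sD : smooth setT (diffop P (F x)).
    apply: (smooth_sum _ openT) => a; apply: (smoothZ _ openT).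
    by rewrite mderivE; apply: smooth_foldr; exact: sF.
  have sDU := smooth_sub (@subsetT _ U) sD.
  apply: (du_bois_reymond oU (r0 x Ux) (cubeU x Ux) sDU gg.1) => phi tphi.
  have [cQ clQ] := @cube_compact_closed R N x (r x).
  have tf : test_function U phi by exists (cube x (r x)); split; [exact: cQ|exact: cubeU|].
  rewrite -(Pu phi tf) /diffop_distr.
  have [b b0 Qb] := compact_sub_box cQ; pose B := b + 1; have bB : b < B by rewrite ltrDl.
  have B0 : 0 < B by exact: lt_trans bB.
  have QB : cube x (r x) `<=` @box R B N by move=> z /Qb zb k; apply: le_trans (zb k) (ltW bB).
  have tb : test_on (@box R b N) phi.
    by split; [exact: tphi.1|move=> z nz; apply: tphi.2 => /Qb].
  rewrite (distr_cbint openT cQ (@subsetT _ _) B0 QB sD tphi).1.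
  have c1 a : ccont (fun z => mderiv a (F x) z * phi z).
    apply: smooth_ccont; rewrite mderivE.
    exact: (smoothM openT (smooth_foldr _ (sF x Ux)) tphi.1).
  have -> : (fun z => diffop P (F x) z * phi z) =
      (fun z => \sum_(a <- msupp P) mcoeff a P * (mderiv a (F x) z * phi z)).
    by apply/funext => z; rewrite /diffop mulr_suml; apply: eq_bigr => a _; rewrite mulrA.
  rewrite (cbint_sum B0); last by move=> a; exact: ccontZ.
  apply: eq_bigr => a _; rewrite (cbintZ B0)//; congr (_ * _).
  have td : test_on (cube x (r x)) (mderiv a phi).
    by rewrite mderivE; exact: test_on_foldr.
  have [_ _ _ _ ux] := hp x Ux; rewrite (ux _ td).
  rewrite (distr_cbint openT cQ (@subsetT _ _) B0 QB (sF x Ux) td).1.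
  by rewrite !mderivE (parts _ b0 bB (sF x Ux) tb) size_mword.
exists f; split.
- split; first exact: sf.
  move=> K cK KU.
  have [l [lU lK]] := finite_ball_cover cK KU r0.
  have [A [h [A0 h0 hA]]] : exists A h : R, [/\ 0 < A, 0 < h &
      forall x, x \in l -> forall w y, normc (dw (F x) w y) <= gev A h t (size w)].
    elim: l lU {lK} => [|x l IHl] lU; first by exists 1, 1; split=> //; exact: ltr01.
    have [|A [h [A0 h0 hl]]] := IHl; first by move=> z zl; apply: lU; rewrite inE zl orbT.
    have [_ _ _ [A' [h' [A'0 h'0 hx]]] _] := hp x (lU x (mem_head _ _)).
    exists (A' + A), (h' + h); split; [exact: ltr_wpDl|exact: ltr_wpDl|].
    move=> z; rewrite inE => /orP[/eqP ->|zl] w y.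
      apply: le_trans (hx w y) _; apply: gev_mono; apply/andP; split=> //.
        by rewrite lerDl; exact: ltW.
      by rewrite lerDl; exact: ltW.
    apply: le_trans (hl z zl w y) _; apply: gev_mono; apply/andP; split; try exact: ltW.
      by rewrite lerDr.
    by rewrite lerDr.
  exists A, h; split=> // a y Ky; have [x xl xy] := lK y Ky.
  rewrite mderivE (dwf x)//; last exact: lU.
  by rewrite -[mdeg a]size_mword; exact: hA.
- exact: (gevrey_eq oU (fun x Ux => esym (Pf x Ux)) gg).
move=> phi [K [cK KU tphi]].
have [l [lU lK]] := finite_ball_cover cK KU r60.
have [b b0 Kb] := compact_sub_box cK.
have dE psi := @distr_cbint R N U K b f psi oU cK KU b0 Kb sf.
(* A partition of unity made one ball at a time: [phi1] is localized at the head of the list, and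
   [phi2] vanishes on that ball, so the remaining balls suffice for it. *)
have : forall y, (forall x, x \in l -> ~ ball x (r x / 6) y) -> phi y = 0.
  move=> y hy; apply: tphi.2 => /lK[x xl]; exact: hy.
elim: l lU phi tphi {lK} => [|x l IHl] lU phi tphi hphi.
  have p0 : phi = fun=> 0 by apply/funext => y; apply: hphi.
  rewrite (dE _ tphi).1 p0 (distr0 uD) (@eq_cbint R N b b0 _ (fun=> 0)) ?cbint0//.
  by move=> y _; rewrite mulr0.
have Ux := lU x (mem_head _ _).
have [chi [_ [_ [_ cpd c0 c1 _]]]] := @cutoff_exists R N 2 x (r x / 6) (ltr1n R 2) (r60 x Ux).
pose phi1 y := chi mnm0 y * phi y.
have s1' : smooth setT phi1 by exact: (smoothM openT (cpd _).1 tphi.1).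
have t1 : test_on K phi1 by split; [exact: s1'|move=> y Ky; rewrite /phi1 tphi.2 ?mulr0].
have tU psi : test_on K psi -> test_function U psi by move=> ?; exists K.
pose phi2 y := (-1) * phi1 y + phi y.
have t2 : test_on K phi2.
  split; first exact: (smoothD openT (smoothZ _ openT s1') tphi.1).
  by move=> y Ky; rewrite /phi2 /phi1 tphi.2// !mulr0 addr0.
have u1 : u phi1 = distr_of_fun f phi1.
  have [_ _ _ _ ux] := hp x Ux; rewrite ux; last first.
    split; first exact: s1'.
    move=> y ny; rewrite /phi1 c0 ?mul0r// => hy; apply: ny => k.
    by apply: le_trans (hy k) _; have := r0 x Ux; rewrite /r; lra.
  congr cintegral_rV; apply/funext => y.
  have [xy|nxy] := pselect (ball x (r x) y); first by rewrite (fF x Ux y xy).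
  rewrite /phi1 c0 ?mul0r ?mulr0// => hy; apply: nxy.
  apply/(ball_rowP _ _ (r0 x Ux)) => k; rewrite distrC; apply: le_lt_trans (hy k) _.
  by have := r0 x Ux; lra.
have u2 : u phi2 = distr_of_fun f phi2.
  apply: (IHl _ phi2 t2) => [z zl|y hy]; first by apply: lU; rewrite inE zl orbT.
  have [xy|nxy] := pselect (ball x (r x / 6) y).
    rewrite /phi2 /phi1 c1; last exact: (ball_sub_cube (lexx _)).
    by rewrite mul1r mulN1r addNr.
  have p0 : phi y = 0.
    by apply: hphi => z; rewrite inE => /orP[/eqP -> //|]; exact: hy.
  by rewrite /phi2 /phi1 p0 !mulr0 addr0.
have e1 : u phi2 = -1 * u phi1 + u phi by exact: (uD _ _ _ (tU _ t1) (tU _ tphi)).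
have e2 : distr_of_fun f phi2 = -1 * distr_of_fun f phi1 + distr_of_fun f phi.
  have [d1 q1] := dE _ t1; have [d2 q2] := dE _ t2; have [d q] := dE _ tphi.
  have cc1 := smooth_ccont q1.1; have cc := smooth_ccont q.1.
  rewrite d1 d2 d -(cbintZ b0)// -(cbintD b0); [|exact: ccontZ|exact: cc].
  by apply: (eq_cbint b0) => y _; rewrite /phi2; ring.
by move: e1; rewrite u2 e2 u1 => /addrI ->.
Qed.

End Gluing.

(** * Lacunary series of exponential solutions *)

Section LacunaryFrequencies.
Variables (R : realType) (N : nat).
Local Notation C := (R[i]).
Implicit Types (P : mpoly N C) (z : 'I_N -> C).

Definition cnorm1 z : R := \sum_j normc (z j).
Definition renorm1 z : R := \sum_j `|complex.Re (z j)|.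

Lemma cnorm1_ge0 z : 0 <= cnorm1 z.
Proof. by apply: sumr_ge0 => j _; exact: normc_ge0. Qed.

Lemma renorm1_ge0 z : 0 <= renorm1 z. Proof. exact: sumr_ge0. Qed.

Lemma normc_le_cnorm1 z j : normc (z j) <= cnorm1 z.
Proof. by rewrite /cnorm1 (bigD1 j)//= lerDl; apply: sumr_ge0 => i _; exact: normc_ge0. Qed.

(** With y = L^(1/t), the t-th power of y^n <= (2t)^n n! e^(y/(2t)) costs exactly e^(y/2), half of
    the decay. *)
Lemma powR_expR_le (t L : R) n : 0 < t -> 0 <= L ->
  L ^+ n * expR (- L `^ t^-1) <= expR (- (L `^ t^-1 / 2)) * gev 1 ((2 * t) `^ t) t n.
Proof.
move=> t0 L0; pose y := L `^ t^-1; have y0 : 0 <= y by exact: powR_ge0.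
have yt : y `^ t = L by rewrite /y -powRrM mulVf ?gt_eqF// powRr1.
have t2 : 0 < 2 * t by exact: mulr_gt0.
have h : y ^+ n <= (2 * t) ^+ n * n`!%:R * expR (y / (2 * t)).
  have e : y = 2 * t * (y / (2 * t)) by rewrite mulrC divfK// gt_eqF.
  rewrite {1}e exprMn -mulrA; apply: ler_wpM2l; first by rewrite exprn_ge0// ltW.
  by apply: expr_fact_le; rewrite divr_ge0// ltW.
have {}h : L ^+ n <= gev 1 ((2 * t) `^ t) t n * expR (y / 2).
  have -> : L ^+ n = (y ^+ n) `^ t by rewrite powRX// yt.
  apply: le_trans (powR_le (ltW t0) (exprn_ge0 _ y0) h) _.
  have p0 : 0 <= (2 * t) ^+ n by rewrite exprn_ge0// ltW.
  rewrite powRM ?mulr_ge0 ?expR_ge0// powRM// powRX ?(ltW t2)// -expRM /gev mul1r.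
  have -> : y / (2 * t) * t = y / 2 by rewrite invfM mulrA mulfVK// gt_eqF.
  exact: lexx.
rewrite -/y; have -> : expR (- y) = expR (- (y / 2)) * expR (- (y / 2)).
  by rewrite -expRD; congr expR; rewrite -opprD -splitr.
rewrite mulrA mulrC; apply: ler_wpM2l; first exact: expR_ge0.
by rewrite expRN ler_pdivrMr// expR_gt0.
Qed.

Lemma expR_small (e : R) : 0 < e -> forall y, 2 / e <= y -> expR (- (y / 2)) <= e.
Proof.
move=> e0 y hy; rewrite expRN -[leRHS]invrK lef_pV2 ?posrE ?invr_gt0 ?expR_gt0//.
apply: le_trans (expR_ge1Dx _); have : e^-1 <= y / 2 by rewrite ler_pdivlMr// mulrC.
by lra.
Qed.

(** Let L be the modulus of z and v = L^(1/s). For n close to dl v, n!^s b^n is at most (L/(2m))^n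
    while some |z_j| is at least L/m. The gain 2^-n, at most e^(-n/2), pays for L^(1/t) + |Re z|,
    which the failure of (Z) makes at most dl v / 4. *)
Lemma pick_zero P (s t e b : R) : 1 < s -> s < t -> ~ zero_cond s P -> 0 < e -> 1 <= b ->
  exists z n j, [/\ meval z P = 0, expR (- (cnorm1 z `^ t^-1 / 2)) <= e, (0 < n)%N &
    b ^+ n * n`!%:R `^ s <= expR (- cnorm1 z `^ t^-1 - renorm1 z) * normc (z j) ^+ n].
Proof.
move=> s1 st nZ e0 b1; have s0 : 0 < s by lra. have t0 : 0 < t by lra.
pose m : R := N.+1%:R; have m1 : 1 <= m by rewrite ler1n.
have m0 : 0 < m by exact: lt_le_trans m1.
have b0 : 0 < b by exact: lt_le_trans b1.
have mb1 : 1 <= m * b by rewrite -[leLHS]mulr1; apply: ler_pM.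
(* Then b dl L = L/(2m), and dl^s <= dl. *)
pose dl := (2 * (m * b))^-1.
have dl0 : 0 < dl by rewrite invr_gt0 mulr_gt0// mulr_gt0.
have dl1 : dl <= 1 by rewrite invf_le1 ?mulr_gt0//; lra.
have mu0 : 0 < s^-1 - t^-1 by rewrite subr_gt0 ltf_pV2.
have tV0 : 0 < t^-1 by rewrite invr_gt0.
have [R1 R11 h1] := powR_large (8 / dl) mu0.
have [R2 R21 h2] := powR_large (2 / e) tV0.
(* 8/dl bounds |Re z| by dl v / 8 and makes dl v >= 8, so that rounding to n is harmless; [R1]
   bounds L^(1/t) by dl v / 8, and [R2] makes the exponential at most e. *)
pose Cz := Num.max (8 / dl) (Num.max R1 R2).
have Cz8 : 8 / dl <= Cz by rewrite le_max lexx.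
have Cz1 : R1 <= Cz by rewrite !le_max lexx orbT.
have Cz2 : R2 <= Cz by rewrite !le_max lexx !orbT.
have d8 : 0 < 8 / dl by exact: divr_gt0.
have Cz0 : 0 < Cz by exact: lt_le_trans Cz8.
have [z hz] : exists z, meval z P = 0 /\ Cz * (1 + renorm1 z) < cnorm1 z `^ s^-1.
  move/forallNP: nZ => /(_ Cz) /existsNP[z] /not_implyP[hz /negP].
  by rewrite -ltNge => h; exists z.
case: hz => Pz hz; set L := cnorm1 z in hz *; set v := L `^ s^-1 in hz.
have L0 : 0 <= L by exact: cnorm1_ge0.
have r0 := renorm1_ge0 z; set rh := renorm1 z in r0 hz *.
have Cv : Cz <= v by apply: le_trans (ltW hz); rewrite ler_peMr ?(ltW Cz0)// lerDl.
have v1 : 1 <= v by apply: le_trans Cv; exact: le_trans Cz1.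
have v0 : 0 <= v by exact: le_trans v1.
have vs : v `^ s = L by rewrite /v -powRrM mulVf ?gt_eqF// powRr1.
have vL : v <= L by rewrite -vs; exact: le1r_powR v1 (ltW s1).
have L1 : 1 <= L by exact: le_trans vL.
have {}h1 := h1 L (le_trans Cz1 (le_trans Cv vL)).
have {}h2 := h2 L (le_trans Cz2 (le_trans Cv vL)).
set y := L `^ t^-1 in h2 *; have y0 : 0 <= y by exact: powR_ge0.
have yv : y <= dl * v / 8.
  have e1 : y * L `^ (s^-1 - t^-1) = v by rewrite /y powR_split// addrC subrK.
  rewrite ler_pdivlMr// mulrC -ler_pdivrMl// mulrA -e1 mulrC.
  by apply: ler_wpM2l => //; rewrite mulrC.
have rv : rh <= dl * v / 8.
  have : 8 / dl * rh <= v.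
    apply: le_trans (ltW hz); apply: (@le_trans _ _ (Cz * rh)); first exact: ler_wpM2r.
    by apply: ler_wpM2l; [exact: ltW|rewrite lerDr].
  move=> h; rewrite ler_pdivlMr//.
  have -> : rh * 8 = dl * (8 / dl * rh) by field; rewrite gt_eqF.
  by apply: ler_wpM2l h; exact: ltW.
have dv0 : 0 <= dl * v by rewrite mulr_ge0// ltW.
have dv8 : 8 <= dl * v by rewrite mulrC -ler_pdivrMr//; exact: le_trans Cv.
have /andP[nl nu] := truncn_itv dv0; set n := Num.trunc _ in nl nu.
rewrite -natr1 in nu.
have Ln : L = norm1 (fun j => normc (z j)).
  by apply: eq_bigr => j _; rewrite ger0_norm ?normc_ge0.
have Lp : 0 < norm1 (fun j => normc (z j)) by rewrite -Ln; exact: lt_le_trans L1.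
have [j hj] := large_coord Lp.
rewrite -Ln -/m ger0_norm ?normc_ge0// in hj.
exists z, n, j; split=> //; first exact: expR_small.
  by rewrite -(ltr_nat R) (lt_le_trans ltr01)//; lra.
have dls : dl `^ s <= dl by apply: ge1r_powR (ltW s1); rewrite dl0.
have step1 : b * n%:R `^ s <= 2^-1 * (L / m).
  apply: (@le_trans _ _ (b * (dl * L))).
    apply: ler_wpM2l; first exact: ltW.
    apply: le_trans (powR_le (ltW s0) (ler0n _ _) nl) _.
    by rewrite powRM ?(ltW dl0)// vs; exact: ler_wpM2r.
  rewrite /dl le_eqVlt; apply/orP; left; apply/eqP.
  have bn : b != 0 by rewrite gt_eqF.
  have mn : m != 0 by rewrite gt_eqF.
  move: mn bn; clear; move: m L => m' L' mn bn.
  by field; rewrite bn mn.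
have fle : b ^+ n * n`!%:R `^ s <= (b * n%:R `^ s) ^+ n.
  rewrite exprMn; apply: ler_wpM2l; first by rewrite exprn_ge0// ltW.
  rewrite -powRX//; apply: (powR_le (ltW s0)) => //.
  by rewrite -natrX ler_nat fact_le_exp.
apply: le_trans fle _.
apply: (@le_trans _ _ ((2^-1 * (L / m)) ^+ n)).
  apply: lerXn2r; rewrite ?nnegrE//; first by rewrite mulr_ge0 ?powR_ge0// ltW.
  by rewrite mulr_ge0 ?invr_ge0// divr_ge0// ltW.
rewrite exprMn; apply: ler_pM.
- by rewrite exprn_ge0// invr_ge0.
- by rewrite exprn_ge0// divr_ge0// ltW.
- apply: (@le_trans _ _ (expR (- 2^-1) ^+ n)).
    apply: lerXn2r; rewrite ?nnegrE ?expR_ge0 ?invr_ge0//.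
    by apply: le_trans (expR_ge1Dx _); lra.
  rewrite -expRM_natr ler_expR -/L -/y -/rh.
  by move: yv rv nu dv8; clear; move: y rh (dl * v) n%:R => p q x k; lra.
- by apply: lerXn2r; rewrite ?nnegrE ?normc_ge0// divr_ge0// ltW.
Qed.

Lemma expr_superadd (x y : R) n : 0 <= x -> 0 <= y -> (0 < n)%N -> x ^+ n + y ^+ n <= (x + y) ^+ n.
Proof.
case: n => [//|n] x0 y0 _; rewrite !exprS mulrDl; apply: lerD.
  by apply: ler_wpM2l => //; apply: lerXn2r; rewrite ?nnegrE ?addr_ge0// lerDl.
by apply: ler_wpM2l => //; apply: lerXn2r; rewrite ?nnegrE ?addr_ge0// lerDr.
Qed.

End LacunaryFrequencies.

Section LacunarySeries.
Variables (R : realType) (N : nat).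
Local Notation E := 'rV[R]_N.
Local Notation C := (R[i]).
Local Notation dw f s := (foldr (@pderiv R N) f s).

Definition ratio (t : R) := (2 * t) `^ t.
(** Positive terms whose tails telescope to at most [iS R M], the rate required by
    [smooth_limit]. *)
Definition tele k : R := iS R k - iS R k.+1.

Lemma tele_gt0 k : 0 < tele k.
Proof. by rewrite /tele subr_gt0 /iS ltf_pV2 ?posrE ?ltr0n// ltr_nat. Qed.

Lemma sum_tele M M' : (M <= M')%N -> \sum_(M <= k < M') tele k = iS R M - iS R M'.
Proof.
move=> MM; have e k : (M <= k < M')%N -> tele k = - iS R k.+1 - - iS R k.
  by move=> _; rewrite /tele opprK addrC.
by rewrite (telescope_sumr_eq (fun k => - iS R k) _ MM e) opprK addrC.
Qed.

Definition gev_sum (t : R) n := \sum_(m < n.+1) gev 1 (ratio t) t m.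

Lemma gev_sum_ge t m n : (m <= n)%N -> gev 1 (ratio t) t m <= gev_sum t n.
Proof.
move=> mn; have mn1 : (m < n.+1)%N by rewrite ltnS.
rewrite /gev_sum (bigD1 (Ordinal mn1))//= lerDl; apply: sumr_ge0 => i _.
by apply: gev_ge0 => //; exact: powR_ge0.
Qed.

(* The k-th frequency is chosen after the sum of the moduli of the previous ones and the
   largest of the previous orders [n l], so that at order [n k] the k-th term dominates. *)
Lemma lacunary_choice (P : mpoly N C) (s t : R) : 1 < s -> s < t -> ~ zero_cond s P ->
  exists (z : nat -> 'I_N -> C) (n : nat -> nat) (j : nat -> 'I_N),
  [/\ forall k, meval (z k) P = 0,
      forall k, expR (- (cnorm1 (z k) `^ t^-1 / 2)) <= tele k,
      forall k l, (k < l)%N -> expR (- (cnorm1 (z l) `^ t^-1 / 2)) *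
         gev 1 (ratio t) t (n k) <= tele l,
      forall k, (0 < n k)%N &
      forall k, (\sum_(l < k) cnorm1 (z l) + (k%:R + 4) ^+ 2) ^+ n k * (n k)`!%:R `^ s <=
        expR (- cnorm1 (z k) `^ t^-1 - renorm1 (z k)) * normc (z k (j k)) ^+ n k].
Proof.
move=> s1 st nZ.
(* [p] holds the rank, the sum of the earlier moduli and the largest earlier order; [q] holds the
   frequency, its order and the coordinate. Dividing by 1 + [gev_sum] makes the new term small at
   all earlier orders at once. *)
have H (p : nat * R * nat) : exists q : ('I_N -> C) * nat * 'I_N, 0 <= p.1.2 ->
   [/\ meval q.1.1 P = 0,
    expR (- (cnorm1 q.1.1 `^ t^-1 / 2)) <= tele p.1.1 / (1 + gev_sum t p.2), (0 < q.1.2)%N &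
    (p.1.2 + (p.1.1%:R + 4) ^+ 2) ^+ q.1.2 * q.1.2`!%:R `^ s <=
      expR (- cnorm1 q.1.1 `^ t^-1 - renorm1 q.1.1) * normc (q.1.1 q.2) ^+ q.1.2].
  have gs0 : 0 <= gev_sum t p.2.
    by apply: sumr_ge0 => i _; apply: gev_ge0 => //; exact: powR_ge0.
  have e0 : 0 < tele p.1.1 / (1 + gev_sum t p.2).
    by rewrite divr_gt0 ?tele_gt0// ltr_wpDr.
  (* The choice is made for every [p], also with a negative sum, and the maximum keeps the base at
     least 1. *)
  have b1 : 1 <= Num.max 0 p.1.2 + (p.1.1%:R + 4) ^+ 2.
    apply: ler_wpDl; first by rewrite le_max lexx.
    by apply: exprn_ege1; have : 0 <= p.1.1%:R :> R by []; lra.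
  have [z [n [j [h1 h2 h3 h4]]]] := pick_zero s1 st nZ e0 b1.
  exists (z, n, j) => p0; rewrite max_r// in h4.
have [q hq] := choice H.
pose step k (st : R * nat) := let w := q (k, st.1, st.2) in
  (st.1 + cnorm1 w.1.1, maxn st.2 w.1.2).
pose fix state k : R * nat := if k is k'.+1 then step k' (state k') else (0, 0%N).
pose w k := q (k, (state k).1, (state k).2).
have stS k : (state k).1 = \sum_(l < k) cnorm1 (w l).1.1.
  by elim: k => [|k IHk]; [rewrite big_ord0|rewrite big_ord_recr -IHk].
have st0 k : 0 <= (state k).1 by rewrite stS; apply: sumr_ge0 => l _; exact: cnorm1_ge0.
have stM k l : (k < l)%N -> ((w k).1.2 <= (state l).2)%N.
  elim: l => [//|l IHl]; rewrite ltnS leq_eqVlt => /orP[/eqP ->|/IHl h] /=.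
    exact: leq_maxr.
  by apply: leq_trans h _; exact: leq_maxl.
have W k := hq (k, (state k).1, (state k).2) (st0 k).
have gs0 m : 0 <= gev_sum t m.
  by apply: sumr_ge0 => i _; apply: gev_ge0 => //; exact: powR_ge0.
have g0 m : 0 <= gev 1 (ratio t) t m by apply: gev_ge0 => //; exact: powR_ge0.
exists (fun k => (w k).1.1), (fun k => (w k).1.2), (fun k => (w k).2); split.
- by move=> k; case: (W k).
- move=> k; have [_ h _ _] := W k; apply: le_trans h _.
  have gp : 0 < 1 + gev_sum t (state k).2 by exact: ltr_wpDr (gs0 _) ltr01.
  by rewrite /= ler_pdivrMr// ler_peMr ?(ltW (tele_gt0 k))// lerDl.
- move=> k l kl; have [_ h _ _] := W l.
  apply: le_trans (ler_wpM2r (g0 _) h) _ => /=.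
  have gp : 0 < 1 + gev_sum t (state l).2 by exact: ltr_wpDr (gs0 _) ltr01.
  rewrite mulrAC ler_pdivrMr//; apply: ler_wpM2l; first exact: ltW (tele_gt0 l).
  by apply: le_trans (gev_sum_ge t (stM k l kl)) _; rewrite lerDr.
- by move=> k; case: (W k).
- by move=> k; have [_ _ _ h] := W k; rewrite -stS.
Qed.

Lemma normc_expf_ball (z : 'I_N -> C) (x : E) : ball (0 : E) 1 x ->
  normc (expf z x) <= expR (renorm1 z).
Proof.
move=> /(ball_rowP _ _ ltr01) xb; rewrite /expf normc_cexp ler_expR Re_cdot.
apply: le_trans (ler_norm _) _; apply: le_trans (ler_norm_sum _ _ _) _.
apply: ler_sum => j _; have := xb j; rewrite mxE sub0r normrN normrM => h.
move: h; move: (`|x 0 j|) (`|complex.Re (z j)|) (normr_ge0 (x 0 j)) (normr_ge0 (complex.Re (z j))).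
by move=> a b a0 b0 a1; nra.
Qed.

Theorem lacunary_counterexample (P : mpoly N C) (s t : R) :
  1 < s -> s < t -> ~ zero_cond s P ->
  exists U : set E, open U /\ exists u : E -> C,
    [/\ gevrey t U u, ~ gevrey s U u & gevrey s U (diffop P u)].
Proof.
move=> s1 st nZ; have t0 : 0 < t by lra. have s0 : 0 < s by lra.
have [z [n [j [Pz ztele ztele2 n0 zbig]]]] := lacunary_choice s1 st nZ.
pose U : set E := ball (0 : E) 1; have oU : open U by exact: ball_open.
have U0 : U 0 by apply: ballxx.
exists U; split=> //.
pose a k : R := expR (- cnorm1 (z k) `^ t^-1 - renorm1 (z k)).
have a0 k : 0 <= a k by exact: expR_ge0.
pose F M (x : E) : C := \sum_(k < M) (a k)%:C * expf (z k) x.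
pose T w (x : E) k : C := (a k)%:C * (\prod_(i <- w) z k i * expf (z k) x).
have g0 m : 0 <= gev 1 (ratio t) t m by apply: gev_ge0 => //; exact: powR_ge0.
have sF M : smooth U (F M).
  by apply: (smooth_sum _ oU) => k; apply: (smoothZ _ oU); exact: (smooth_expf _ oU).1.
have dF M w x : U x -> dw (F M) w x = \sum_(k < M) T w x k.
  move=> Ux; rewrite /F (foldr_sum oU)//; last first.
    by move=> k; apply: (smoothZ _ oU); exact: (smooth_expf _ oU).1.
  apply: eq_bigr => k _; have [se De] := @smooth_expf R N U (z k) oU.
  by rewrite (foldrZ oU _ _ se Ux) De.
have prodz w k : normc (\prod_(i <- w) z k i) <= cnorm1 (z k) ^+ size w.
  rewrite normc_prod; elim: w => [|i w IHw]; first by rewrite big_nil.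
  rewrite big_cons exprS; apply: ler_pM => //; first exact: normc_ge0.
    by apply: prodr_ge0 => l _; exact: normc_ge0.
  exact: normc_le_cnorm1.
have Tb0 w x k : U x -> normc (T w x k) <=
    cnorm1 (z k) ^+ size w * expR (- cnorm1 (z k) `^ t^-1).
  move=> Ux; rewrite /T !Normc.normcM normc_real ger0_norm//.
  have h1 := prodz w k; have h2 := normc_expf_ball (z k) Ux.
  apply: (@le_trans _ _ (a k * (cnorm1 (z k) ^+ size w * expR (renorm1 (z k))))).
    by apply: ler_wpM2l => //; apply: ler_pM => //; exact: normc_ge0.
  by rewrite mulrCA /a -expRD subrK.
have Tb w x k : U x -> normc (T w x k) <= gev 1 (ratio t) t (size w) * tele k.
  move=> Ux; apply: le_trans (Tb0 w x k Ux) _.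
  apply: le_trans (powR_expR_le _ t0 (cnorm1_ge0 _)) _.
  by rewrite mulrC; apply: ler_wpM2l.
have diffF M M' w x : (M <= M')%N -> U x ->
    normc (dw (F M) w x - dw (F M') w x) <= gev 1 (ratio t) t (size w) * iS R M.
  move=> MM Ux; rewrite !dF// -!(big_mkord xpredT (T w x)) (big_cat_nat (leq0n M) MM) /=.
  rewrite opprD addNKr normc_opp; apply: le_trans (normc_sum _ _ _) _.
  apply: (@le_trans _ _ (\sum_(M <= k < M') gev 1 (ratio t) t (size w) * tele k)).
    by apply: ler_sum => k _; exact: Tb.
  rewrite -mulr_sumr sum_tele//; apply: ler_wpM2l => //.
  by rewrite gerBl; exact: iS_ge0.
have [|u [su hu]] := @smooth_limit R N U oU F sF.
  by move=> w; exists (gev 1 (ratio t) t (size w)) => M M' x; exact: diffF.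
have ub w x : U x -> normc (dw u w x) <= gev 1 (ratio t) t (size w).
  move=> Ux; apply/ler_addgt0Pr => e e0; have [c hc] := hu w.
  have [M hM] := iS_small c e0.
  have -> : dw u w x = dw (F M) w x - (dw (F M) w x - dw u w x) by rewrite opprB addrC subrK.
  apply: le_trans (ler_normcB _ _) _; apply: lerD; last exact: le_trans (hc M x Ux) hM.
  have := diffF 0%N M w x (leq0n M) Ux; rewrite iS0 mulr1.
  by rewrite (dF 0%N w x Ux) big_ord0 sub0r normc_opp.
have Pu x : U x -> 0 = diffop P u x.
  move=> Ux; apply/esym; apply: normc_le_eps => e e0.
  have /choice[c hc] := fun a => hu (mword a).
  have [M hM] := iS_small (\sum_(b <- msupp P) normc (mcoeff b P) * c b) e0.
  have PF : diffop P (F M) x = 0.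
    rewrite /diffop; under eq_bigr do rewrite mderivE dF// mulr_sumr.
    rewrite exchange_big big1// => k _.
    have -> : \sum_(b <- msupp P) mcoeff b P * T (mword b) x k =
        (a k)%:C * expf (z k) x * meval (z k) P.
      rewrite meval_pairing /pairing mulr_sumr; apply: eq_bigr => b _.
      by rewrite /T prod_mword; ring.
    by rewrite Pz mulr0.
  rewrite -[diffop P u x]subr0 -PF /diffop -sumrB.
  apply: le_trans (normc_sum _ _ _) _; apply: le_trans hM; rewrite mulr_suml.
  apply: ler_sum => b _; rewrite -mulrBr Normc.normcM -mulrA.
  apply: ler_wpM2l; first exact: normc_ge0.
  by rewrite !mderivE normc_distC; exact: hc.
exists u; split.
- split=> // K cK KU; exists 1, (ratio t); split; [exact: ltr01|by rewrite powR_gt0// mulr_gt0|].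
  move=> b x Kx; rewrite mderivE; apply: le_trans (ub (mword b) x (KU x Kx)) _.
  by rewrite size_mword.
- case=> _ /(_ [set 0] (@compact_set1 _ _)) [|A [h [A0 h0 hA]]]; first by move=> _ ->.
  pose k := Num.trunc (A + h).
  have Ah0 : 0 <= A + h by rewrite addr_ge0// ltW.
  have /andP[_ kAh] := truncn_itv Ah0; rewrite -/k -natr1 in kAh.
  (* q dominates both constants of the alleged G^s bound, and q + 1 = k + 4 is the number whose
     square enters [zbig]. *)
  pose q : R := k%:R + 3; have k0 : 0 <= k%:R :> R by [].
  have qA : A <= q by rewrite /q; lra.
  have qh : h <= q by rewrite /q; lra.
  have q3 : 3 <= q by rewrite /q; lra.
  have up : normc (dw u (nseq (n k) (j k)) 0) <= A * h ^+ n k * (n k)`!%:R `^ s.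
    have := hA (mnm_muln (mnm1 (j k)) (n k)) 0 erefl.
    by rewrite mderivE mword_single mdegMn mdeg1 mul1n.
  have [c hc] := hu (nseq (n k) (j k)); have [M1 hM1] := iS_small c (@ltr01 R).
  pose M := maxn M1 k.+1.
  have kM : (k < M)%N by exact: leq_maxr.
  have c0 : 0 <= c.
    have := hc 0%N 0 U0; rewrite iS0 mulr1; apply: le_trans; exact: normc_ge0.
  have hM : normc (dw (F M) (nseq (n k) (j k)) 0 - dw u (nseq (n k) (j k)) 0) <= 1.
    apply: le_trans (hc M 0 U0) _; apply: le_trans hM1.
    by apply: ler_wpM2l => //; apply: iS_le; exact: leq_maxl.
  pose f := (n k)`!%:R `^ s; pose S := \sum_(l < k) cnorm1 (z l).
  have S0 : 0 <= S by apply: sumr_ge0 => l _; exact: cnorm1_ge0.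
  have f1 : 1 <= f.
    have : 1 `^ s <= f by apply: (powR_le (ltW s0)) => //; rewrite ler1n fact_gt0.
    by rewrite powR1.
  have low : (S + (q + 1) ^+ 2) ^+ n k * f - S ^+ n k - 1 <=
      normc (dw (F M) (nseq (n k) (j k)) 0).
    rewrite dF// (bigD1 (Ordinal kM))//=.
    have e1 : normc (T (nseq (n k) (j k)) 0 k) = a k * normc (z k (j k)) ^+ n k.
      rewrite /T !Normc.normcM normc_real ger0_norm// big_nseq iter_mulr_1 normcX.
      have -> : expf (z k) (0 : E) = 1.
        rewrite /expf (_ : cdot _ _ = 0) ?cexp0//.
        by rewrite /cdot big1// => i _; rewrite mxE mulr0.
      by rewrite Normc.normc1 mulr1.
    (* Earlier terms are bounded by their powers alone, with sum at most S^n; later ones were chosen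
       small at the order [n k], with sum at most 1. *)
    have e2 : normc (\sum_(l < M | l != Ordinal kM) T (nseq (n k) (j k)) 0 l) <= S ^+ n k + 1.
      apply: le_trans (normc_sum _ _ _) _.
      apply: (@le_trans _ _ (\sum_(l < M) ((if (l < k)%N then cnorm1 (z l) ^+ n k else 0) + tele l))).
        rewrite [leRHS](bigD1 (Ordinal kM))//=; apply: ler_wpDl.
          by rewrite ltnn add0r ltW// tele_gt0.
        apply: ler_sum => l lk; have := Tb0 (nseq (n k) (j k)) 0 l U0; rewrite size_nseq.
        case: (ltngtP l k) => kl; last by case/eqP: lk; apply: val_inj.
          move=> h'; apply: ler_wpDr; first exact: ltW (tele_gt0 l).
          apply: le_trans h' _; apply: ler_piMr; first by rewrite exprn_ge0// cnorm1_ge0.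
          by rewrite -expR0 ler_expR oppr_le0 powR_ge0.
        move=> h'; rewrite add0r; apply: le_trans h' _.
        apply: le_trans (powR_expR_le _ t0 (cnorm1_ge0 _)) _.
        exact: ztele2.
      rewrite big_split /=; apply: lerD; last first.
        rewrite -(big_mkord xpredT tele) sum_tele// iS0 gerBl; exact: iS_ge0.
      have -> : \sum_(l < M) (if (l < k)%N then cnorm1 (z l) ^+ n k else 0) =
          \sum_(l < k) cnorm1 (z l) ^+ n k.
        rewrite -(big_mkord xpredT (fun l => if (l < k)%N then cnorm1 (z l) ^+ n k else 0)).
        rewrite (big_cat_nat (leq0n k) (ltnW kM)) /= [X in _ + X]big_nat_cond.
        rewrite [X in _ + X]big1 ?addr0; last first.
          by move=> l /andP[/andP[kl _] _]; rewrite ltnNge kl.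
        rewrite big_mkord; apply: eq_bigr => l _; by rewrite ltn_ord.
      suff sup m : \sum_(l < m) cnorm1 (z l) ^+ n k <= (\sum_(l < m) cnorm1 (z l)) ^+ n k.
        exact: sup.
      elim: m => [|m IHm]; first by rewrite !big_ord0 exprn_ge0.
      rewrite !big_ord_recr /=; apply: le_trans (expr_superadd _ _ (n0 k)).
      + by rewrite lerD2r.
      + by apply: sumr_ge0 => l _; exact: cnorm1_ge0.
      + exact: cnorm1_ge0.
    have e3 := zbig k; rewrite -/S -/f -/(a k) -e1 in e3.
    have q1 : q + 1 = k%:R + 4 by rewrite /q; ring.
    rewrite q1; move: e2 e3.
    move: (\sum_(l < M | _) _) (T _ _ k) (_ * f) (S ^+ n k) => x y p r hx hp.
    have : normc y <= normc (y + x) + normc x.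
      have e : y = y + x - x by rewrite addrK.
      by rewrite {1}e; exact: ler_normcB.
    by lra.
  (* This is why the base contains a square: of (q+1)^(2n) >= (q+1) q^n, the part q q^n beats A h^n,
     and the remaining q^n >= 3 beats the two errors of size 1. *)
  have low2 : S ^+ n k + (q * q ^+ n k + q ^+ n k) <= (S + (q + 1) ^+ 2) ^+ n k.
    have q0 : 0 <= q by lra.
    apply: le_trans (expr_superadd S0 (exprn_ge0 2 (addr_ge0 q0 ler01)) (n0 k)).
    rewrite lerD2l -[X in _ + X]mul1r -mulrDl -exprM mulnC exprM expr2.
    apply: ler_pM; [by rewrite addr_ge0|exact: exprn_ge0| |].
      by rewrite -[leLHS]expr1; apply: ler_weXn2l; [rewrite lerDr|exact: n0].
    by apply: lerXn2r; rewrite ?nnegrE ?addr_ge0// lerDl.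
  have f0 : 0 <= f by exact: le_trans f1.
  have fin : A * h ^+ n k <= q * q ^+ n k.
    apply: ler_pM => //; [exact: ltW|by rewrite exprn_ge0// ltW|].
    by apply: lerXn2r => //; rewrite nnegrE ?(ltW h0)// (le_trans _ q3).
  have qn : 3 <= q ^+ n k.
    have q1 : 1 <= q by apply: le_trans q3; rewrite ler1n.
    by apply: le_trans q3 _; exact: ler_eXnr (n0 k) q1.
  have tri : normc (dw (F M) (nseq (n k) (j k)) 0) <= normc (dw u (nseq (n k) (j k)) 0) + 1.
    rewrite -[dw (F M) _ _](subrK (dw u (nseq (n k) (j k)) 0)) addrC.
    by apply: le_trans (ler_normcD _ _) _; rewrite lerD2l.
  have m1 := ler_wpM2r f0 low2; have m2 := ler_wpM2r f0 fin.
  have m3 : S ^+ n k * 1 <= S ^+ n k * f by apply: ler_wpM2l => //; exact: exprn_ge0.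
  have m4 : 3 * 1 <= q ^+ n k * f by apply: ler_pM.
  have contra (x1 x2 x3 x4 x5 x6 x7 : R) : x2 <= x3 * f -> x5 * f - x6 - 1 <= x1 ->
      x1 <= x2 + 1 -> (x6 + (x4 + x7)) * f <= x5 * f -> x3 * f <= x4 * f ->
      x6 * 1 <= x6 * f -> 3 * 1 <= x7 * f -> False.
    clear; rewrite !mulrDl; move: (x3 * f) (x5 * f) (x6 * f) (x4 * f) (x7 * f).
    by move=> y1 y2 y3 y4 y5; lra.
  exact: (contra _ _ _ _ _ _ _ up low tri m1 m2 m3 m4).
have gz : gevrey s U (fun=> 0).
  split; first exact: (smooth_cst 0 oU).
  move=> K cK KU; exists 1, 1; split; [exact: ltr01|exact: ltr01|move=> b x Kx].
  rewrite mderivE.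
  have -> : dw (fun=> 0 : C) (mword b) x = 0.
    elim: (mword b) x {Kx} => [//|i w IHw] x /=.
    rewrite (_ : dw (fun=> 0) w = fun=> 0); last exact/funext.
    by apply: is_pd_val; exact: is_pd_cst.
  by rewrite Normc.normc0 mul1r expr1n mul1r powR_ge0.
exact: (gevrey_eq oU Pu gz).
Qed.

End LacunarySeries.

Theorem corollary3p5 (R : realType) (N : nat) (P : mpoly N R[i]) (s : R)
    (hs : 1 < s) (hP : ~ hypoelliptic_distr_gevrey P s) :
  forall t : R, s < t ->
    exists U : set 'rV[R]_N, open U /\
    exists u : 'rV[R]_N -> R[i],
      [/\ gevrey t U u, ~ gevrey s U u & gevrey s U (diffop P u)].
Proof.
move=> t st; apply: contrapT => nex; apply: hP => U oU u dU [g [gg Pu]].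
have [hZ|nZ] := pselect (zero_cond s P); last first.
  by case: nex; exact: lacunary_counterexample hs st nZ.
have [f [gf gPf uf]] := zero_cond_regularity hs st oU dU gg Pu hZ.
exists f; split; last exact: uf.
by apply: contrapT => ngf; case: nex; exists U; split=> //; exists f.
Qed.
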